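(* Let $n\ge 2$, let $M=\mathbb{S}^n\subset\mathbb{R}^{n+1}$ with its canonical metric $g$, and let $q\neq 0$, $r\neq -1$ be real constants. Consider the equation $$ u_t=u^{-r}\big(\triangle_g u+u^q\big),\qquad (x,t)\in M\times\mathbb{R}. $$ After the rotation normalization described in the context and stereographic projection from the north pole, so that points of $\mathbb{S}^n$ minus the north pole are represented by $x\in\mathbb{R}^n$, the symmetry groups of this equation are generated by the following transformations of $(x,t,u)$ (where $\varepsilon\in\mathbb{R}$ is a group parameter and $A\in SO(n)$): (1) if $q$, $r+1$, $1$ are mutually distinct: $(x,t,u)\mapsto(x,t+\varepsilon,u)$ and $(x,t,u)\mapsto(Ax,t,u)$; (2) if $q=r+1\neq 1$: $(x,t,u)\mapsto\Big(x,\,-\frac1r\ln(e^{-rt}-r\varepsilon),\,u\,(e^{-rt}-r\varepsilon)^{-1/r}e^{-t}\Big)$, $(x,t,u)\mapsto(x,t+\varepsilon,u)$ and $(x,t,u)\mapsto(Ax,t,u)$; (3) if $q=1\neq r+1$: $(x,t,u)\mapsto(x,e^{\varepsilon}t,e^{\varepsilon/r}u)$, $(x,t,u)\mapsto(x,t+\varepsilon,u)$ and $(x,t,u)\mapsto(Ax,t,u)$; (4) if $r+1=1\neq q$: $(x,t,u)\mapsto(x,t+\varepsilon,u)$ and $(x,t,u)\mapsto(Ax,t,u)$; (5) if $q=r+1=1$: $(x,t,u)\mapsto(x,t,e^{\varepsilon}u)$, $(x,t,u)\mapsto(x,t+\varepsilon,u)$ and $(x,t,u)\mapsto(Ax,t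,u)$.
   Context: $\triangle_g$ is the Laplace–Beltrami operator of $(M,g)$. Coordinates. Write points of $\mathbb{S}^n$ as $(y,z)\in\mathbb{R}^n\times\mathbb{R}$ with $|y|^2+z^2=1$; the north pole is $(0,1)$. Stereographic projection from the north pole is $x=\frac{y}{1-z}\in\mathbb{R}^n$, with inverse $(y,z)=\big(\frac{2x}{|x|^2+1},\frac{|x|^2-1}{|x|^2+1}\big)$. In these coordinates $g_{ij}=\frac{4\delta_{ij}}{(|x|^2+1)^2}$ and the equation reads $$u^ru_t=\frac{(|x|^2+1)^2}{4}\triangle u-(n-2)\frac{|x|^2+1}{2}\,x\cdot\nabla u+u^q,$$ with $\triangle,\nabla$ the flat Laplacian and gradient of $\mathbb{R}^n$. Rotation normalization. The symmetry group action is normalized, after a rotation, so that it fixes a point of the sphere, which is taken to be the north pole $(0,1)$. Symmetry groups. A (local) one-parameter group of transformations $g(\varepsilon)$ of $(x,t,u)$-space with infinitesimal generator $\overrightarrow{v}=\sum_i\xi^i(x,t,u)\partial_{x^i}+\eta(x,t,u)\partial_t+\phi(x,t,u)\partial_u$ is a one-parameter symmetry group of a second order equation $F(x,t,u,Du,D^2u,u_t)=0$ if and only if $pr^{(2)}\overrightarrow{v}\,F=0$ at all $(x,t,u,Du,D^2u,u_t)$ with $F=0$, where $u,Du,D^2u,u_t$ are regarded as independent variables and $pr^{(2)}\overrightarrow{v}$ is the standard second prolongation (Lie point symmetries).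
   Formalization: In case (5) the equation is linear, so (x,t,u)↦(x,t,u+εb(x,t)) with b solving b_t=Δ_g b+b (e.g. b=e^t) is also a symmetry; the listed generators are incomplete and these superposition groups are added. Throughout u>0, as real powers require. *)

(* Defs.v *)
From HB Require Import structures.
From mathcomp Require Import all_boot all_order all_algebra.
From mathcomp Require Import all_classical all_reals all_analysis.

Set Implicit Arguments.
Unset Strict Implicit.
Unset Printing Implicit Defensive.

Import Order.TTheory GRing.Theory Num.Theory.
Import numFieldNormedType.Exports.

Local Open Scope classical_set_scope.
Local Open Scope ring_scope.

(* Conventions: vectors of R^n are rows, so [A x] is [x *m A^T].  The last of
   the n + 1 independent variables is the time t, the first n are the
   stereographic coordinates x. *)

(* (x,t,u)-space, and its tangent vectors (xi, eta, phi) *)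
Notation pt R n := ('rV[R]_(n + 1) * R)%type.

(* Second order jets ((z, u), p, H): z = (x,t), p = (u_i) and H = (u_ij) are
   the first and second derivatives in the n + 1 variables z. *)
Notation jet R n := (pt R n * 'rV[R]_(n + 1) * 'M[R]_(n + 1))%type.

Section Space.
Variables (R : realType) (n : nat).
Local Notation pt := (pt R n).

(* Since r and q are arbitrary reals, the dependent variable ranges over
   u > 0. *)
Definition space : set pt := [set p | 0 < p.2].

Definition point (x : 'rV[R]_n) (t u : R) : pt := (row_mx x (const_mx t), u).

Definition tidx : 'I_(n + 1) := rshift n ord0.

Definition xc (p : pt) : 'rV[R]_n := lsubmx p.1.
Definition tc (p : pt) : R := p.1 0 tidx.
Definition uc (p : pt) : R := p.2.

Definition normsq (x : 'rV[R]_n) : R := \sum_i x 0 i ^+ 2.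

End Space.

Section Smooth.
Variables (R : realType) (V W : normedModType R).

Definition iterD (vs : seq V) (f : V -> W) : V -> W :=
  foldr (fun v g => 'D_v g) f vs.

(* C^oo on an open set D (V finite dimensional): all iterated directional
   derivatives are Frechet differentiable on D. *)
Definition smooth_on (D : set V) (f : V -> W) : Prop :=
  forall (vs : seq V) (p : V), D p -> differentiable (iterD vs f) p.

End Smooth.

Section LocalGroups.
Variables (R : realType) (n : nat).
Local Notation pt := (pt R n).
Local Notation space := (@space R n).

Record local_flow := LocalFlow {
  dom : set (R * pt);
  flow : R -> pt -> pt }.

(* Local one-parameter group of transformations of (x,t,u)-space, i.e. local
   action of the additive group of R, not necessarily defined for all e. *)
Record is_one_param_group (G : local_flow) : Prop := {
  opg_open : open (dom G);
  opg_dom : forall e p, dom G (e, p) -> space p;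
  opg_dom0 : forall p, space p -> dom G (0, p);
  opg_space : forall e p, dom G (e, p) -> space (flow G e p);
  opg_smooth : smooth_on (dom G) (fun ep : R * pt => flow G ep.1 ep.2);
  opg0 : forall p, space p -> flow G 0 p = p;
  opgD : forall d e p, dom G (d, p) -> dom G (e, flow G d p) ->
    dom G (e + d, p) -> flow G e (flow G d p) = flow G (e + d) p;
  opgN : forall e p, dom G (e, p) ->
    dom G (- e, flow G e p) /\ flow G (- e) (flow G e p) = p }.

Definition is_generator (G : local_flow) (v : pt -> pt) : Prop :=
  forall p, space p -> is_derive (0 : R) (1 : R) (fun e => flow G e p) (v p).

(* Membership in the Lie algebra of the transformations generated by the
   one-parameter groups in L: linear combinations of their generators. *)
Definition generated_by (L : set local_flow) (v : pt -> pt) : Prop :=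
  exists (k : nat) (h : 'I_k -> local_flow) (w : 'I_k -> pt -> pt)
         (c : 'I_k -> R),
    (forall i, L (h i) /\ is_generator (h i) (w i)) /\
    (forall p, space p -> v p = \sum_(i < k) c i *: w i p).

End LocalGroups.

Section Prolongation.
Variables (R : realType) (n : nat).
Local Notation pt := (pt R n).
Local Notation jet := (jet R n).

Definition jpt (j : jet) : pt := j.1.1.
Definition j1 (j : jet) : 'rV[R]_(n + 1) := j.1.2.
Definition j2 (j : jet) : 'M[R]_(n + 1) := j.2.

Definition dz (i : 'I_(n + 1)) (f : pt -> R) : pt -> R :=
  'D_((delta_mx 0 i, 0) : pt) f.
Definition du (f : pt -> R) : pt -> R := 'D_((0, 1) : pt) f.

(* total derivatives D_i f and D_i D_k f of a function of (z, u) *)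
Definition totalD (i : 'I_(n + 1)) (f : pt -> R) (j : jet) : R :=
  dz i f (jpt j) + j1 j 0 i * du f (jpt j).

Definition totalDD (i k : 'I_(n + 1)) (f : pt -> R) (j : jet) : R :=
  dz i (dz k f) (jpt j)
  + j1 j 0 k * dz i (du f) (jpt j) + j1 j 0 i * dz k (du f) (jpt j)
  + j1 j 0 i * j1 j 0 k * du (du f) (jpt j)
  + j2 j i k * du f (jpt j).

Definition zcoef (v : pt -> pt) (l : 'I_(n + 1)) (p : pt) : R := (v p).1 0 l.
Definition ucoef (v : pt -> pt) (p : pt) : R := (v p).2.

(* phi^i = D_i (phi - zeta^l u_l) + zeta^l u_il *)
Definition pr_coef1 (v : pt -> pt) (i : 'I_(n + 1)) (j : jet) : R :=
  totalD i (ucoef v) j - \sum_l totalD i (zcoef v l) j * j1 j 0 l.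

(* phi^ik = D_i D_k (phi - zeta^l u_l) + zeta^l u_ikl *)
Definition pr_coef2 (v : pt -> pt) (i k : 'I_(n + 1)) (j : jet) : R :=
  totalDD i k (ucoef v) j - \sum_l totalDD i k (zcoef v l) j * j1 j 0 l
  - \sum_l (totalD i (zcoef v l) j * j2 j k l
            + totalD k (zcoef v l) j * j2 j i l).

Definition pr2 (v : pt -> pt) (j : jet) : jet :=
  (v (jpt j), \row_i pr_coef1 v i j, \matrix_(i, k) pr_coef2 v i k j).

Definition is_infinitesimal_symmetry (F : jet -> R) (v : pt -> pt) : Prop :=
  forall j : jet, space (jpt j) -> (j2 j)^T = j2 j -> F j = 0 ->
    'D_(pr2 v j) F j = 0.

End Prolongation.

Section Equation.
Variables (R : realType) (n : nat).
Local Notation pt := (pt R n).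
Local Notation jet := (jet R n).

(* Laplace-Beltrami operator of g_ij = 4 delta_ij / (|x|^2 + 1)^2 *)
Definition laplace_beltrami (j : jet) : R :=
  (normsq (xc (jpt j)) + 1) ^+ 2 / 4
    * (\sum_(i < n) j2 j (lshift 1 i) (lshift 1 i))
  - (n%:R - 2) * ((normsq (xc (jpt j)) + 1) / 2)
    * (\sum_(i < n) xc (jpt j) 0 i * j1 j 0 (lshift 1 i)).

(* u^r u_t - (Delta_g u + u^q) *)
Definition heat (q r : R) (j : jet) : R :=
  uc (jpt j) `^ r * j1 j 0 (tidx n)
  - (laplace_beltrami j + uc (jpt j) `^ q).

(* The north pole corresponds to |x| -> oo: the spatial part of v tends to 0
   there in the norm of g, |xi|_g^2 = 4 |xi|^2 / (|x|^2 + 1)^2. *)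
Definition fixes_north_pole (v : pt -> pt) : Prop :=
  forall t u : R, 0 < u -> forall e : R, 0 < e -> exists K : R,
    forall x : 'rV[R]_n, K < normsq x ->
      4 * normsq (xc (v (point x t u))) / (normsq x + 1) ^+ 2 < e.

(* The one-parameter groups in L are one-parameter groups of transformations,
   and the normalized one-parameter symmetry groups of the equation are exactly
   those which they generate. *)
Definition symmetry_groups_generated_by (q r : R) (L : set (local_flow R n)) :
    Prop :=
  (forall G, L G -> is_one_param_group G /\ exists v, is_generator G v) /\
  (forall (G : local_flow R n) (v : pt -> pt),
     is_one_param_group G -> is_generator G v ->
     (is_infinitesimal_symmetry (heat q r) v /\ fixes_north_pole v
      <-> generated_by L v)).

End Equation.

Section Transformations.
Variables (R : realType) (n : nat).
Local Notation pt := (pt R n).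
Local Notation space := (@space R n).
Local Notation local_flow := (local_flow R n).

Definition everywhere : set (R * pt) := [set ep | space ep.2].

Definition time_translation : local_flow :=
  LocalFlow everywhere (fun e p => point (xc p) (tc p + e) (uc p)).

Definition special_orthogonal : set 'M[R]_n :=
  [set A | A *m A^T = 1%:M /\ \det A = 1].

Definition one_param_subgroup_SO (A : R -> 'M[R]_n) : Prop :=
  [/\ forall e, special_orthogonal (A e),
      forall d e, A (d + e) = A d *m A e
    & smooth_on setT A].

Definition rotation (A : R -> 'M[R]_n) : local_flow :=
  LocalFlow everywhere (fun e p => point (xc p *m (A e)^T) (tc p) (uc p)).

Definition rotations : set local_flow :=
  [set G | exists2 A, one_param_subgroup_SO A & G = rotation A].

Definition exp_time (r : R) : local_flow :=
  LocalFlow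
    [set ep | space ep.2 /\ 0 < expR (- (r * tc ep.2)) - r * ep.1]
    (fun e p =>
       let s := expR (- (r * tc p)) - r * e in
       point (xc p) (- r^-1 * ln s)
             (uc p * s `^ (- r^-1) * expR (- tc p))).

Definition dilation (r : R) : local_flow :=
  LocalFlow everywhere
    (fun e p => point (xc p) (expR e * tc p) (expR (e / r) * uc p)).

Definition u_scaling : local_flow :=
  LocalFlow everywhere (fun e p => point (xc p) (tc p) (expR e * uc p)).

Definition jet_of (b : 'rV[R]_(n + 1) -> R) (z : 'rV[R]_(n + 1)) : jet R n :=
  ((z, b z), \row_i 'D_(delta_mx 0 i) b z,
   \matrix_(i, k) 'D_(delta_mx 0 i) ('D_(delta_mx 0 k) b) z).

(* solutions (of any sign) of b_t = Delta_g b + b *)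
Definition linear_solution (b : 'rV[R]_(n + 1) -> R) : Prop :=
  smooth_on setT b /\
  forall z, j1 (jet_of b z) 0 (tidx n) = laplace_beltrami (jet_of b z) + b z.

Definition superposition (b : 'rV[R]_(n + 1) -> R) : local_flow :=
  LocalFlow
    [set ep | space ep.2 /\ 0 < uc ep.2 + ep.1 * b ep.2.1]
    (fun e p => point (xc p) (tc p) (uc p + e * b p.1)).

(* For q = r + 1 = 1 the equation u_t = Delta_g u + u is linear, so adding
   multiples of a solution is a symmetry (e.g. u + e exp(t)). *)
Definition superpositions : set local_flow :=
  [set G | exists2 b, linear_solution b & G = superposition b].

End Transformations.

Arguments time_translation R n : clear implicits.
Arguments rotations R n _ : clear implicits.
Arguments u_scaling R n : clear implicits.
Arguments exp_time {R} n r.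
Arguments dilation {R} n r.
Arguments superpositions R n _ : clear implicits.

(* Main.v *)
Require Import Defs.
From HB Require Import structures.
From mathcomp Require Import all_boot all_order all_algebra.
From mathcomp Require Import all_classical all_reals all_analysis.
From mathcomp Require Import ring lra.
Import Order.TTheory GRing.Theory Num.Theory.
Import numFieldNormedType.Exports.
Local Open Scope classical_set_scope.
Local Open Scope ring_scope.

Set Implicit Arguments.
Unset Strict Implicit.
Unset Printing Implicit Defensive.

(** A symmetry group enters the statement only through its generator
    [v = (xi, eta, phi)], so one has to determine the vector fields that satisfy
    the infinitesimal criterion and fix the north pole, and to compare them with
    the linear span of the generators of the given groups.

    Necessity. The equation restricts the Hessian of [u] only through its spatial
    trace, so the trace-free part may be varied freely in the criterion
    ([traceless_test]). This makes [eta] a function of [t] alone and [xi], at each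
    time, a conformal field of R^n independent of [u]:
    [d i (xi k) + d k (xi i) = 2 mu delta_ik]. Separating the powers of the first
    derivatives of [u] then gives [phi_uu = 0], [r phi = u (eta_t - 2 sigma)], a
    gradient equation and a constant term, where
    [sigma = mu - (x . xi) / w], with [w = (|x|^2 + 1) / 2], is the factor by which
    [xi] scales the round metric [g]. The conformal equation implies
    [Delta_g sigma = - n sigma] ([laplace_sigma]). With [A = eta_t - 2 sigma] the
    constant term, multiplied by [r], becomes
    [A_t u^(r+1) - 2 n sigma u + ((1 - q) A - 2 r sigma) u^q = 0] for all [u > 0]
    ([growth_equation]). Distinct powers of [u] are linearly independent
    ([powR_independent]), and if [r <> 0] this gives [sigma = 0], except that for
    [q = 1] and [r = - n] the coefficient of [sigma] vanishes and the gradient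
    equation [u^r xi_t + 2 w^2 grad phi_u = (2 - n) w^2 grad sigma] is needed as
    well. If [r = 0], then [A = 0], so [sigma] does not depend on [x] and vanishes
    by the eigenvalue equation.

    Hence [xi] is a Killing field. Its product with the velocity of a geodesic is
    constant along the geodesic; on the geodesics through the north pole, where
    [xi] vanishes, the constant is [0] ([clairaut], [radial_axis0]). So
    [x . xi = 0], and since the gradient of [xi] is constant, [xi = x B] with [B]
    antisymmetric ([killing_linear]); the gradient equation shows that [B] does
    not depend on [t]. There remain ordinary differential equations for [eta] if
    [r <> 0], and for [r = 0] the two coefficients of [phi = a u + b]. In each case the result is a normal form
    [(x B, c + k T(t), k S(t) u + h(x, t))], with [T] and [S] fixed functions and
    [h] a solution of the linear equation in the last case, [0] in the others.

    Sufficiency and generation. A field in normal form satisfies the criterion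
    ([symmetric_of_normal_form]) and fixes the pole, since it grows linearly in
    [x]. The groups of the theorem have generators in normal form: a one-parameter
    subgroup of SO(n) has an antisymmetric derivative. Conversely the rotations in
    coordinate planes have derivatives that span the antisymmetric matrices
    ([generated_rotation]), and the other terms of the normal form are multiples of
    the generators of the time translations, of the special group, and of a
    superposition. *)

Local Notation space := (@Defs.space _ _).
Local Notation point := (@Defs.point _ _).
Local Notation xi_ i := (lshift 1 i).
Local Notation sm := (smooth_on space).

(** * Smooth functions *)

Section DeriveAlongLines.
Context {R : realType} {V V' W : normedModType R}.

(** A directional derivative depends only on the restriction to a line, so it
    can be carried from one space to another. *)
Lemma eq_derive_lines (f : V -> W) (g : V' -> W) (v a : V) (v' a' : V') :
  (forall h : R, f (h *: v + a) = g (h *: v' + a')) -> 'D_v f a = 'D_v' g a'.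
Proof.
move=> fg; have E : f a = g a'.
  by have := fg 0; rewrite !scale0r !add0r.
rewrite /derive; apply: (congr1 (fun k : R -> W => lim (k @ 0^'))).
by apply: funext => h /=; rewrite fg E.
Qed.

End DeriveAlongLines.

Section SmoothFunctions.
Context {R : realType} {V W : normedModType R}.

Lemma near_eq_differentiable (f g : V -> W) (p : V) :
  (\near p, f p = g p) -> differentiable f p -> differentiable g p.
Proof.
move=> fg df.
have c := diff_continuous df.
have E : g \o shift p = cst (g p) + 'd f p +o_ 0 id.
  apply/eqaddoP => e e0.
  have := diff_locally df => /eqaddoP/(_ _ e0) H.
  rewrite near_simpl in H *.
  have fg' : \forall h \near (0 : V), f (h + p) = g (h + p).
    by move: fg; rewrite (near_shift 0) /= subr0.
  near=> h.
  have -> : (g \o shift p - (cst (g p) + 'd f p)) h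
            = (f \o shift p - (cst (f p) + 'd f p)) h.
    rewrite !fctE /= (nbhs_singleton fg); congr (_ - _).
    by apply: esym; near: h.
  by near: h.
apply/diff_locallyP; have -> : 'd g p = 'd f p :> (V -> W) by apply: diff_unique.
by split.
Unshelve. all: by end_near. Qed.

Variables (D : set V) (oD : open D).

Lemma eq_on_derive (f g : V -> W) v p :
  (forall p, D p -> f p = g p) -> D p -> 'D_v f p = 'D_v g p.
Proof.
move=> fg Dp; apply: near_eq_derive; near do apply: fg.
exact: open_nbhs_nbhs.
Unshelve. all: by end_near. Qed.

Lemma eq_on_differentiable (f g : V -> W) p :
  (forall p, D p -> f p = g p) -> D p ->
  differentiable f p -> differentiable g p.
Proof.
move=> fg Dp; apply: near_eq_differentiable; near do apply: fg.
exact: open_nbhs_nbhs.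
Unshelve. all: by end_near. Qed.

(** The order [k] serves for induction: a derivative of a product is no longer
    a product, but it is again of class C^k. *)
Fixpoint Cdiff (k : nat) (f : V -> W) : Prop :=
  (forall p, D p -> differentiable f p) /\
  if k is k'.+1 then forall v, Cdiff k' ('D_v f) else True.

Lemma iterD_rcons vs (v : V) (f : V -> W) :
  Defs.iterD (rcons vs v) f = Defs.iterD vs ('D_v f).
Proof. by rewrite /Defs.iterD foldr_rcons. Qed.

Lemma smoothP (f : V -> W) : smooth_on D f <-> forall k, Cdiff k f.
Proof.
split=> [sf k|H vs].
  elim: k f sf => [|k IH] f sf /=; split=> //; try exact: (sf [::]).
  by move=> v; apply: IH => vs p; rewrite -iterD_rcons; apply: sf.
elim/last_ind: vs f H => [|vs v IH] f H p Dp; first exact: (H 0%N).1.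
by rewrite iterD_rcons; apply: IH => // k; apply: (H k.+1).2.
Qed.

Lemma Cdiff_eq k (f g : V -> W) :
  (forall p, D p -> f p = g p) -> Cdiff k f -> Cdiff k g.
Proof.
elim: k f g => [|k IH] f g fg /= [d H]; split=> //.
- by move=> p Dp; apply: (eq_on_differentiable fg) => //; apply: d.
- by move=> p Dp; apply: (eq_on_differentiable fg) => //; apply: d.
- move=> v; apply: IH (H v) => p Dp; exact: eq_on_derive.
Qed.

Lemma CdiffW k (f : V -> W) : Cdiff k.+1 f -> Cdiff k f.
Proof.
elim: k f => [|k IH] f; first by case.
by move=> [d H]; split=> // v; apply: IH.
Qed.

Lemma smooth_eq (f g : V -> W) :
  (forall p, D p -> f p = g p) -> smooth_on D f -> smooth_on D g.
Proof. by move=> fg /smoothP H; apply/smoothP => k; apply: Cdiff_eq (H k). Qed.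

Lemma smooth_differentiable (f : V -> W) p :
  smooth_on D f -> D p -> differentiable f p.
Proof. by move=> H; apply: (H [::]). Qed.

Lemma smooth_derivable (f : V -> W) p v :
  smooth_on D f -> D p -> derivable f p v.
Proof. by move=> H Dp; apply: diff_derivable; apply: (H [::]). Qed.

Lemma smooth_derive (f : V -> W) v : smooth_on D f -> smooth_on D ('D_v f).
Proof. by move=> H vs p; rewrite -iterD_rcons; apply: H. Qed.

(** A class of differentiable functions that is closed under differentiation
    on [D] consists of smooth functions. *)
Lemma smooth_coind (S : (V -> W) -> Prop) (f : V -> W) :
  (forall f, S f -> (forall p, D p -> differentiable f p) /\
     forall v, exists2 g, S g & forall p, D p -> 'D_v f p = g p) ->
  S f -> smooth_on D f.
Proof.
move=> H Sf; apply/smoothP => k; elim: k f Sf => [|k IH] f /H[d e]; split=> // v.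
have [g Sg fg] := e v; apply: (Cdiff_eq (f:=g)); last exact: IH.
by move=> p Dp; rewrite fg.
Qed.

Lemma CdiffD k (f g : V -> W) :
  Cdiff k f -> Cdiff k g -> Cdiff k (fun p => f p + g p).
Proof.
elim: k f g => [|k IH] f g /= [df Hf] [dg Hg]; split=> //.
- by move=> p Dp; apply: differentiableD; [apply: df|apply: dg].
- by move=> p Dp; apply: differentiableD; [apply: df|apply: dg].
- move=> v; apply: (Cdiff_eq (f:=fun p => 'D_v f p + 'D_v g p)); last exact: IH.
  by move=> p Dp; rewrite deriveD //; apply: diff_derivable; [exact: df|exact: dg].
Qed.

Lemma Cdiff_cst k (c : W) : Cdiff k (fun=> c).
Proof.
elim: k c => [|k IH] c /=; split=> // v.
by apply: Cdiff_eq (IH 0) => p _; rewrite (derive_cst c).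
Qed.

Lemma smoothD (f g : V -> W) :
  smooth_on D f -> smooth_on D g -> smooth_on D (fun p => f p + g p).
Proof. by move=> /smoothP Hf /smoothP Hg; apply/smoothP => k; apply: CdiffD. Qed.

Lemma smooth_cst (c : W) : smooth_on D (fun=> c).
Proof. by apply/smoothP => k; apply: Cdiff_cst. Qed.

Lemma smooth_sum (I : Type) (s : seq I) (P : pred I) (F : I -> V -> W) :
  (forall i, P i -> smooth_on D (F i)) ->
  smooth_on D (fun p => \sum_(i <- s | P i) F i p).
Proof.
move=> H; elim: s => [|i s IH].
  by apply: smooth_eq (smooth_cst 0) => p _; rewrite big_nil.
case: (boolP (P i)) => Pi; last first.
  by apply: smooth_eq IH => p _; rewrite big_cons (negbTE Pi).
by apply: smooth_eq (smoothD (H i Pi) IH) => p _; rewrite big_cons Pi.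
Qed.

End SmoothFunctions.

Section SmoothComposition.
Context {R : realType} {V W W' : normedModType R} (D : set V) (oD : open D).

Lemma linear_fun_ind (U U' : normedModType R) (P : (U -> U') -> Prop) :
  (forall L : {linear U -> U'}, continuous L -> P L) ->
  forall f, linear f -> continuous f -> P f.
Proof.
move=> H f lf; pose fM := GRing.isLinear.Build _ _ _ _ _ lf.
pose L : {linear U -> U'} := HB.pack f fM.
exact: (H L).
Qed.

Lemma differentiable_linear_fun (U U' : normedModType R) (f : U -> U') p :
  linear f -> continuous f -> differentiable f p.
Proof. by move: f; apply: linear_fun_ind => L cL; exact: linear_differentiable. Qed.

Lemma derive_linear_fun (f : V -> W) v p :
  linear f -> continuous f -> 'D_v f p = f v.
Proof.
move: f; apply: linear_fun_ind => L cL.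
by rewrite deriveE ?diff_lin //; exact: linear_differentiable.
Qed.

Lemma derive_linear_fun_comp (f : W -> W') (g : V -> W) v p :
  linear f -> continuous f -> differentiable g p ->
  'D_v (fun p => f (g p)) p = f ('D_v g p).
Proof.
move=> + + dg; move: f; apply: linear_fun_ind => L cL.
have dL : differentiable L (g p) by apply: linear_differentiable.
rewrite (deriveE _ (differentiable_comp dg dL)) diff_comp //= diff_lin //.
by rewrite deriveE.
Qed.

Lemma smooth_linear_fun_comp (f : W -> W') (g : V -> W) :
  linear f -> continuous f -> smooth_on D g -> smooth_on D (fun p => f (g p)).
Proof.
move=> lf cf sg; set S := fun h : V -> W' => exists2 g, smooth_on D g & h = f \o g.
apply: (smooth_coind oD (S:=S)); last by exists g.
move=> _ {sg}[{}g sg ->]; split=> [p Dp|v].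
  apply: differentiable_comp; first exact: smooth_differentiable Dp.
  exact: differentiable_linear_fun.
exists (f \o 'D_v g); first by exists ('D_v g) => //; apply: smooth_derive.
by move=> p Dp /=; apply: derive_linear_fun_comp => //; exact: smooth_differentiable Dp.
Qed.

Lemma smooth_linear_fun (f : V -> W) :
  linear f -> continuous f -> smooth_on D f.
Proof.
move=> lf cf; apply/smoothP => -[|k] /=; split=> //;
  try by move=> p _; exact: differentiable_linear_fun.
move=> v; apply: (Cdiff_eq oD _ (Cdiff_cst oD k (f v))) => p _.
by rewrite derive_linear_fun.
Qed.

(** The functions [p |-> f (L p + a)] with [f] smooth are closed under
    differentiation, since the derivative of [L] is constant. *)
Lemma smooth_affine (D' : set W) (L : V -> W) (a : W) (f : W -> W') :
  linear L -> continuous L -> (forall p, D p -> D' (L p + a)) ->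
  smooth_on D' f -> smooth_on D (fun p => f (L p + a)).
Proof.
move=> lL cL DD' sf.
set S := fun g : V -> W' => exists2 f, smooth_on D' f & g = (fun p => f (L p + a)).
apply: (smooth_coind oD (S:=S)); last by exists f.
have dLa p : differentiable (fun p => L p + a) p.
  by apply: differentiableD => //; apply: differentiable_linear_fun.
move=> _ [g sg ->]; split=> [p Dp|v].
  apply: (@differentiable_comp _ _ _ _ (fun p => L p + a)) => //.
  exact: smooth_differentiable sg (DD' _ Dp).
exists (fun p => 'D_(L v) g (L p + a)).
  by refine (ex_intro2 _ _ ('D_(L v) g) (smooth_derive (L v) sg) _).
by move=> p Dp; apply: eq_derive_lines => h; rewrite lL addrA.
Qed.

Lemma smooth_linear_precomp (L : V -> W) (f : W -> W') : linear L -> continuous L ->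
  smooth_on setT f -> smooth_on D (fun p => f (L p)).
Proof.
move=> lL cL sf; have := smooth_affine lL cL (a := 0) (fun _ _ => I) sf.
by apply: (smooth_eq oD) => p _; rewrite addr0.
Qed.

End SmoothComposition.

Section SmoothScalar.
Context {R : realType} {V W : normedModType R} (D : set V) (oD : open D).
Implicit Types f g : V -> R.

Lemma CdiffM k f g :
  Cdiff D k f -> Cdiff D k g -> Cdiff D k (fun p => f p * g p).
Proof.
elim: k f g => [|k IH] f g /= Hf Hg.
  by split=> // p Dp; apply: differentiableM; [apply: Hf.1|apply: Hg.1].
split=> [p Dp|v]; first by apply: differentiableM; [apply: Hf.1|apply: Hg.1].
apply: (Cdiff_eq oD (f:=fun p => f p * 'D_v g p + g p * 'D_v f p)).
  move=> p Dp; rewrite deriveM //; apply: diff_derivable; [exact: Hf.1|exact: Hg.1].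
by apply: CdiffD => //; apply: IH; [exact: CdiffW|exact: Hg.2|exact: CdiffW|exact: Hf.2].
Qed.

Lemma smoothM f g :
  smooth_on D f -> smooth_on D g -> smooth_on D (fun p => f p * g p).
Proof.
by move=> /smoothP Hf /smoothP Hg; apply/smoothP => k; apply: CdiffM.
Qed.

Lemma smoothZl f (w : W) : smooth_on D f -> smooth_on D (fun p => f p *: w).
Proof.
set S := fun g : V -> W => exists2 f : V -> R, smooth_on D f & g = (fun p => f p *: w).
move=> sf; apply: (smooth_coind oD (S:=S)); last by exists f.
move=> _ [g sg ->]; split=> [p Dp|v].
  by apply: differentiableZl; apply: smooth_differentiable Dp.
exists (fun p => 'D_v g p *: w); first by exists ('D_v g) => //; apply: smooth_derive.
move=> p Dp; have dg : differentiable g p by exact: smooth_differentiable Dp.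
by rewrite deriveE ?diffZl ?deriveE //; apply: differentiableZl.
Qed.

Lemma smoothN f : smooth_on D f -> smooth_on D (fun p => - f p).
Proof.
move=> sf; have H := smoothM (smooth_cst oD (-1 : R)) sf.
apply: (smooth_eq oD _ H) => p _.
by rewrite mulN1r.
Qed.

Lemma smoothB f g :
  smooth_on D f -> smooth_on D g -> smooth_on D (fun p => f p - g p).
Proof. by move=> sf sg; apply: smoothD => //; apply: smoothN. Qed.

Lemma derive_real_comp (h : R -> R) (dh : R) f v p :
  differentiable f p -> is_derive (f p) 1 h dh ->
  differentiable (fun p => h (f p)) p /\ 'D_v (fun p => h (f p)) p = dh * 'D_v f p.
Proof.
move=> df hh.
have dh' : differentiable h (f p) by apply/derivable1_diffP.
have dc := differentiable_comp df dh'; split=> //.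
rewrite (deriveE _ dc) diff_comp //= -(deriveE _ df).
have -> : 'd h (f p) ('D_v f p) = 'D_v f p * 'd h (f p) 1.
  by rewrite -{1}['D_v f p]mulr1; exact: linearZ.
by rewrite -(deriveE _ dh') derive_val mulrC.
Qed.

(** The induction needs all the derivatives [hs k] of [hs 0] at once, because
    the chain rule replaces [hs m] by [hs m.+1]. *)
Lemma smooth_real_comp (U : set R) (hs : nat -> R -> R) f :
  (forall k x, U x -> is_derive x 1 (hs k) (hs k.+1 x)) ->
  (forall p, D p -> U (f p)) -> smooth_on D f ->
  smooth_on D (fun p => hs 0%N (f p)).
Proof.
move=> Hh DU sf; apply/smoothP => k.
have dc m v p (Dp : D p) :=
  derive_real_comp v (smooth_differentiable sf Dp) (Hh m _ (DU _ Dp)).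
elim: k {1}0%N => [|k IH] m /=; split=> //; try by move=> p /(dc m 0)[].
move=> v; apply: (Cdiff_eq oD (f:=fun p => hs m.+1 (f p) * 'D_v f p)).
  by move=> p Dp; rewrite (dc m v p Dp).2.
apply: CdiffM; first exact: IH.
by move/(smooth_derive v)/smoothP: sf.
Qed.

Lemma smooth_expR f : smooth_on D f -> smooth_on D (fun p => expR (f p)).
Proof.
by move=> sf; apply: (smooth_real_comp (U:=setT) (hs:=fun _ => expR)).
Qed.

Lemma smooth_powR f (a : R) : (forall p, D p -> 0 < f p) ->
  smooth_on D f -> smooth_on D (fun p => f p `^ a).
Proof.
move=> f0 sf.
  (* the derivatives of [x `^ a], with falling factorials of [a] *)
pose hs k x := \prod_(i < k) (a - i%:R) * x `^ (a - k%:R).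
apply: (smooth_eq oD (f:=fun p => hs 0%N (f p))).
  by move=> p _; rewrite /hs big_ord0 mul1r subr0.
apply: (smooth_real_comp (U:=[set x | 0 < x])) => // k x x0.
rewrite /hs big_ord_recr /= -mulrA -natr1 opprD addrA.
by apply: is_deriveZ; apply: is_derive1_powR.
Qed.

Lemma smooth_inv f : (forall p, D p -> 0 < f p) ->
  smooth_on D f -> smooth_on D (fun p => (f p)^-1).
Proof.
move=> f0 sf; apply: (smooth_eq oD _ (smooth_powR (-1) f0 sf)) => p Dp.
by rewrite powRN powRr1 // ltW // f0.
Qed.

Lemma smooth_ln f : (forall p, D p -> 0 < f p) ->
  smooth_on D f -> smooth_on D (fun p => ln (f p)).
Proof.
move=> f0 sf; apply/smoothP => k.
have d v p (Dp : D p) := derive_real_comp v (smooth_differentiable sf Dp) (is_derive1_ln (f0 _ Dp)).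
case: k => [|k] /=; split=> //; try by move=> p /(d 0)[].
move=> v; apply: (Cdiff_eq oD (f:=fun p => (f p)^-1 * 'D_v f p)).
  by move=> p Dp; rewrite (d _ _ _).2.
apply: CdiffM; first by move/smoothP: (smooth_inv f0 sf).
by move/(smooth_derive v)/smoothP: sf.
Qed.

End SmoothScalar.

(** * Symmetry of second derivatives *)

Section Lines.
Context {R : realType} {V W : normedModType R}.

Lemma is_derive_line (f : V -> W) (v a : V) (s : R) :
  differentiable f (s *: v + a) ->
  is_derive s 1 (fun t => f (t *: v + a)) ('D_v f (s *: v + a)).
Proof.
move=> df; apply: DeriveDef.
  apply: diff_derivable.
  apply: (@differentiable_comp _ _ _ _ (fun t : R => t *: v + a)) => //.
by apply: eq_derive_lines => h; rewrite scalerDl addrA [h%:A]mulr1.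
Qed.

End Lines.

Section Schwarz.
Context {R : realType} {V : normedModType R}.
Implicit Types (f : V -> R) (D : set V).

Lemma mvt_line f (v a : V) (h : R) : 0 <= h ->
  (forall s, 0 <= s <= h -> differentiable f (s *: v + a)) ->
  exists2 c, 0 <= c <= h & f (h *: v + a) - f a = h * 'D_v f (c *: v + a).
Proof.
move=> h0 df.
have := @MVT_segment R (fun s => f (s *: v + a)) (fun s => 'D_v f (s *: v + a)) 0 h h0.
case.
- move=> x; rewrite in_itv /= => /andP[x0 xh]; apply: is_derive_line.
  by apply: df; rewrite !ltW.
- apply: derivable_within_continuous => x; rewrite in_itv /= => xh.
  by apply: ex_derive; apply: is_derive_line; apply: df.
- move=> c; rewrite in_itv /= => ch; rewrite scale0r add0r subr0 mulrC => E.
  by exists c.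
Qed.

Lemma constant_on_line f (v a : V) :
  (forall s, 0 <= s <= 1 -> differentiable f (s *: v + a)) ->
  (forall s, 0 <= s <= 1 -> 'D_v f (s *: v + a) = 0) -> f (v + a) = f a.
Proof.
move=> df d0; have [c c01] := mvt_line ler01 df.
rewrite scale1r mul1r d0 // => /eqP; rewrite subr_eq0 => /eqP //.
Qed.

Variables (D : set V) (oD : open D).

(** The mean value theorem, applied along [v] to the increment of [f] in the
    direction [w], then along [w] to the derivative of [f] along [v]. *)
Lemma double_difference f (v w p : V) (h : R) : 0 <= h -> smooth_on D f ->
  (forall c d, 0 <= c <= h -> 0 <= d <= h -> D (c *: v + (d *: w + p))) ->
  exists c d, [/\ 0 <= c <= h, 0 <= d <= h &
  (f (h *: v + (h *: w + p)) - f (h *: v + p)) - (f (h *: w + p) - f p)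
   = h * (h * 'D_w ('D_v f) (c *: v + (d *: w + p)))].
Proof.
move=> h0 sf DD.
have h0' : (0 : R) <= 0 <= h by apply/andP.
have hh' : 0 <= h <= h by apply/andP.
pose g x := f (x + h *: w) - f x.
have dshift x : D (x + h *: w) -> differentiable (fun x => f (x + h *: w)) x.
  move=> Dx; apply: (@differentiable_comp _ _ _ _ (fun x => x + h *: w)) => //.
  exact: smooth_differentiable sf Dx.
have Dcv c : 0 <= c <= h -> D (c *: v + p).
  by move=> ch; have := DD c 0 ch h0'; rewrite scale0r add0r.
have Dcv' c : 0 <= c <= h -> D (c *: v + p + h *: w).
  by move=> ch; have := DD c h ch hh'; rewrite [h *: w + p]addrC addrA.
have [c ch Ec] : exists2 c, 0 <= c <= h & g (h *: v + p) - g p = h * 'D_v g (c *: v + p).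
  apply: mvt_line => // s sh; apply: differentiableB; first exact/dshift/Dcv'.
  by apply: smooth_differentiable sf _; apply: Dcv.
have Eg : 'D_v g (c *: v + p) = 'D_v f (h *: w + (c *: v + p)) - 'D_v f (c *: v + p).
  rewrite deriveB; last 2 first.
  - by apply: diff_derivable; apply/dshift/Dcv'.
  - by apply: smooth_derivable sf _; apply: Dcv.
  congr (_ - _); apply: eq_derive_lines => t.
  by rewrite [h *: w + _]addrC !addrA.
have [d dh Ed] : exists2 d, 0 <= d <= h & 'D_v f (h *: w + (c *: v + p)) - 'D_v f (c *: v + p)
    = h * 'D_w ('D_v f) (d *: w + (c *: v + p)).
  apply: (mvt_line (f := 'D_v f) (v := w) (a := c *: v + p) h0) => s sh.
  apply: (smooth_differentiable (smooth_derive v sf)).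
  by rewrite addrCA; apply: DD.
exists c, d; split=> //.
by rewrite [c *: v + (_ + _)]addrCA -Ed -Eg -Ec /g -!addrA [p + _]addrC.
Qed.

(** The second difference does not change when [v] and [w] are exchanged. By
    [double_difference] it is [h ^+ 2] times a value near [p] of either mixed
    derivative, and these are continuous at [p]. *)
Lemma schwarz f (v w p : V) : smooth_on D f -> D p ->
  'D_v ('D_w f) p = 'D_w ('D_v f) p.
Proof.
move=> sf Dp.
have [F EF] : exists F, F = 'D_w ('D_v f) by exact: (ex_intro _ _ erefl).
have [G EG] : exists G, G = 'D_v ('D_w f) by exact: (ex_intro _ _ erefl).
have EFx x : 'D_w ('D_v f) x = F x by rewrite EF.
have EGx x : 'D_v ('D_w f) x = G x by rewrite EG.
have cF : {for p, continuous F}.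
  apply: differentiable_continuous; rewrite EF.
  exact: (smooth_differentiable (smooth_derive w (smooth_derive v sf))).
have cG : {for p, continuous G}.
  apply: differentiable_continuous; rewrite EG.
  exact: (smooth_differentiable (smooth_derive v (smooth_derive w sf))).
rewrite EFx EGx.
suff H e : 0 < e -> `|G p - F p| < e + e.
  apply/eqP; rewrite -subr_eq0 -normr_le0 leNgt; apply/negP => /[dup] A.
  move: (H (`|G p - F p| / 2)); rewrite -splitr ltxx divr_gt0 // => /(_ isT) //.
move=> e0.
have nD : \forall x \near p, D x by exact: open_nbhs_nbhs.
have nF : \forall x \near p, `|F p - F x| < e by exact: (cvgrPdist_lt _ _).1 cF e e0.
have nG : \forall x \near p, `|G p - G x| < e by exact: (cvgrPdist_lt _ _).1 cG e e0.
have /nbhs_ballP[dl /= dl0 H] : \forall x \near p,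
    D x /\ (`|F p - F x| < e /\ `|G p - G x| < e).
  exact: filterI nD (filterI nF nG).
pose h := dl / 2 / (`|v| + `|w| + 1).
have vw1 : 0 < `|v| + `|w| + 1 by rewrite ltr_wpDl ?addr_ge0.
have h0 : 0 < h by rewrite !divr_gt0.
have near_p c d : 0 <= c <= h -> 0 <= d <= h -> ball p dl (c *: v + (d *: w + p)).
  move=> /andP[c0 ch] /andP[d0 dh]; rewrite -ball_normE /= addrA opprD addrCA addrN addr0 normrN.
  apply: (le_lt_trans (ler_normD _ _)); rewrite !normrZ !ger0_norm //.
  apply: (@le_lt_trans _ _ (h * (`|v| + `|w|))).
    by rewrite mulrDr lerD // ler_wpM2r.
  apply: (@le_lt_trans _ _ (h * (`|v| + `|w| + 1))).
    by rewrite ler_wpM2l ?(ltW h0) // lerDl.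
  by rewrite /h divfK ?gt_eqF // ltr_pdivrMr // ltr_pMr // ltr1n.
have [c [d [ch dh E]]] := double_difference (v := v) (w := w) (p := p) (ltW h0) sf
  (fun c d ch dh => (H _ (near_p c d ch dh)).1).
have near_p' c' d' : 0 <= c' <= h -> 0 <= d' <= h -> ball p dl (c' *: w + (d' *: v + p)).
  by move=> ? ?; rewrite addrCA; apply: near_p.
have [c' [d' [ch' dh' E']]] := double_difference (v := w) (w := v) (p := p) (ltW h0) sf
  (fun c d ch dh => (H _ (near_p' c d ch dh)).1).
rewrite EFx in E; rewrite EGx in E'.
have hn0 : h != 0 by rewrite gt_eqF.
have E2 : h * (h * F (c *: v + (d *: w + p))) = h * (h * G (c' *: w + (d' *: v + p))).
  by rewrite -E -E' [h *: w + (_ + _)]addrCA; ring.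
have EE := mulfI hn0 (mulfI hn0 E2).
have [_ [HF _]] := H _ (near_p _ _ ch dh).
have [_ [_ HG]] := H _ (near_p' _ _ ch' dh').
rewrite EE in HF.
rewrite -[G p](subrK (G (c' *: w + (d' *: v + p)))) -addrA.
by apply: (le_lt_trans (ler_normD _ _)); rewrite ltrD // distrC.
Qed.

End Schwarz.

(** * Differentiation of explicit expressions *)

Section LinearFunctions.
Context {R : realType} {V W : normedModType R}.

Lemma derive_linear (f : V -> W) (v p : V) : linear f ->
  is_derive p v f (f v).
Proof.
move=> lf.
have E : \forall h \near (0 : R)^', h^-1 *: ((f \o shift p) (h *: v) - f p) = f v.
  near=> h => /=.
  rewrite lf addrK scalerA mulVf ?scale1r //.
  by near: h; exact: nbhs_dnbhs_neq.
by split; [exact: (is_cvg_near_cst (f v))|exact/lim_near_cst].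
Unshelve. all: by end_near. Qed.

Lemma derive_along_constant (f : V -> W) (p w : V) : (forall h : R, f (h *: w + p) = f p) ->
  'D_w f p = 0.
Proof.
move=> fc; rewrite /derive; apply: lim_near_cst => //.
by near=> h => /=; rewrite fc subrr scaler0.
Unshelve. all: by end_near. Qed.

End LinearFunctions.

Section PointwiseDerivatives.
Context {R : realType} {V : normedModType R}.
Implicit Types (f g : V -> R) (x v : V).

Lemma is_derive_mul f g x v df dg : is_derive x v f df -> is_derive x v g dg ->
  is_derive x v (fun y => f y * g y) (f x * dg + g x * df).
Proof. move=> H K; exact: is_deriveM. Qed.

Lemma is_derive_add f g x v df dg : is_derive x v f df -> is_derive x v g dg ->
  is_derive x v (fun y => f y + g y) (df + dg).
Proof. move=> H K; exact: is_deriveD. Qed.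

Lemma is_derive_sub f g x v df dg : is_derive x v f df -> is_derive x v g dg ->
  is_derive x v (fun y => f y - g y) (df - dg).
Proof. move=> H K; exact: is_deriveB. Qed.

Lemma is_derive_bigsum m (f : 'I_m -> V -> R) x v df :
  (forall i, is_derive x v (f i) (df i)) ->
  is_derive x v (fun y => \sum_(i < m) f i y) (\sum_(i < m) df i).
Proof.
move=> H; have := is_derive_sum H; congr is_derive.
by apply: funext => y; rewrite fct_sumE.
Qed.

Lemma is_derive_const (c : R) x v : is_derive x v (fun=> c) 0.
Proof. exact: is_derive_cst. Qed.

Lemma is_derive_powRc (a : R) f x v :
  differentiable f x -> 0 < f x ->
  is_derive x v (fun y => f y `^ a) (a * f x `^ (a - 1) * 'D_v f x).
Proof.
move=> df f0; have [d <-] := derive_real_comp v df (is_derive1_powR a f0).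
by apply: derivableP; apply: diff_derivable.
Qed.

End PointwiseDerivatives.

(** * The equation and its differential *)

Section JetSpace.
Context {R : realType} {n : nat}.
Local Notation pt := (pt R n).
Local Notation jet := (jet R n).
Implicit Types (p : pt) (j d : jet) (x : 'rV[R]_n).

Lemma xcE p i : xc p 0 i = p.1 0 (xi_ i).
Proof. by rewrite /xc mxE. Qed.

(** The round metric is [weight x ^- 2] times the flat one. *)
Definition weight x : R := (normsq x + 1) / 2.

Definition dot x (y : 'rV[R]_n) : R := \sum_(i < n) x 0 i * y 0 i.

Lemma normsqE x : normsq x = dot x x.
Proof. by apply: eq_bigr => i _; rewrite expr2. Qed.

Lemma normsq_ge0 x : 0 <= normsq x.
Proof. by apply: sumr_ge0 => i _; apply: sqr_ge0. Qed.

Lemma weight_gt0 x : 0 < weight x.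
Proof. by rewrite divr_gt0 // ltr_wpDl ?normsq_ge0. Qed.

Lemma continuous_zcoord l : continuous (fun p : pt => p.1 0 l).
Proof.
move=> p; apply: (@continuous_comp _ _ _ (fst : pt -> _) (fun z : 'rV_(n+1) => z 0 l)).
  exact: cvg_fst.
exact: coord_continuous.
Qed.

Lemma continuous_ucoord : continuous (fun p : pt => p.2).
Proof. by move=> p; exact: cvg_snd. Qed.

Lemma open_space : open (@Defs.space R n).
Proof.
rewrite (_ : space = (fun p : pt => p.2) @^-1` [set x | 0 < x]) //.
by apply: open_comp (@open_gt R 0) => p _; exact: continuous_ucoord.
Qed.

Definition heat_derivative (q r : R) j d : R :=
  let x := xc (jpt j) in let u := uc (jpt j) in
  let dx := xc (jpt d) in let du := uc (jpt d) in
  u `^ r * j1 d 0 (tidx n) + j1 j 0 (tidx n) * (r * u `^ (r - 1) * du)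
  - (weight x ^+ 2 * (\sum_(i < n) j2 d (xi_ i) (xi_ i))
     + (\sum_(i < n) j2 j (xi_ i) (xi_ i)) * (2 * weight x * dot x dx)
     - (n%:R - 2) * (weight x * (\sum_(i < n) (x 0 i * j1 d 0 (xi_ i)
                                    + j1 j 0 (xi_ i) * dx 0 i))
        + (\sum_(i < n) x 0 i * j1 j 0 (xi_ i)) * dot x dx)
     + q * u `^ (q - 1) * du).

Lemma laplace_beltramiE j : laplace_beltrami j =
  weight (xc (jpt j)) ^+ 2 * (\sum_(i < n) j2 j (xi_ i) (xi_ i))
     - (n%:R - 2) * (weight (xc (jpt j)) * (\sum_(i < n) xc (jpt j) 0 i * j1 j 0 (xi_ i))).
Proof.
rewrite /laplace_beltrami /weight expr_div_n -natrX -!mulrA.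
by congr (_ * (_ * _) - _).
Qed.

Lemma heatE (q r : R) j : heat q r j =
  uc (jpt j) `^ r * j1 j 0 (tidx n)
  - (weight (xc (jpt j)) ^+ 2 * (\sum_(i < n) j2 j (xi_ i) (xi_ i))
     - (n%:R - 2) * (weight (xc (jpt j)) * (\sum_(i < n) xc (jpt j) 0 i * j1 j 0 (xi_ i)))
     + uc (jpt j) `^ q).
Proof. by rewrite /heat laplace_beltramiE. Qed.

Lemma derive_heat (q r : R) j d : space (jpt j) ->
  'D_d (heat q r) j = heat_derivative q r j d.
Proof.
move=> u0.
have Dx i : is_derive j d (fun j => xc (jpt j) 0 i) (xc (jpt d) 0 i).
  by apply: derive_linear => a y z; rewrite !xcE /= !mxE.
have Dp l : is_derive j d (fun j => j1 j 0 l) (j1 d 0 l).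
  by apply: derive_linear => a y z; rewrite /= !mxE.
have DH k l : is_derive j d (fun j => j2 j k l) (j2 d k l).
  by apply: derive_linear => a y z; rewrite /= !mxE.
have lu : linear (fun j => uc (jpt j)) by [].
have Du : 'D_d (fun j => uc (jpt j)) j = uc (jpt d).
  exact: (derive_val (is_derive := derive_linear d j lu)).
have du : differentiable (fun j => uc (jpt j)) j.
  apply: differentiable_linear_fun => // k.
  have c1 : {for k, continuous (fun j : jet => j.1)} by exact: cvg_fst.
  have c2 : {for k.1, continuous (fun y : pt * 'rV[R]_(n+1) => y.1)} by exact: cvg_fst.
  apply: (continuous_comp (f := fun j : jet => j.1.1) (g := fun p : pt => p.2)).
    exact: continuous_comp c1 c2.
  exact: continuous_ucoord.
have Dw : is_derive j d (fun j => weight (xc (jpt j))) (dot (xc (jpt j)) (xc (jpt d))).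
  have := is_derive_mul (is_derive_add (is_derive_bigsum (fun i => is_derive_mul (Dx i) (Dx i))) (is_derive_const 1 j d)) (is_derive_const 2^-1 j d).
  have -> : (fun y : jet => (\sum_(i < n) xc (jpt y) 0 i * xc (jpt y) 0 i + 1) * 2^-1)
    = (fun j => weight (xc (jpt j))).
    by apply: funext => y; rewrite /weight normsqE.
  move=> H; apply: is_derive_eq H _.
  by rewrite mulr0 add0r addr0 big_split /= /dot; lra.
have Dr := is_derive_powRc r d du u0.
have Dq := is_derive_powRc q d du u0.
rewrite Du in Dr Dq.
have Dlap := is_derive_mul (is_derive_mul Dw Dw) (is_derive_bigsum (fun i => DH (xi_ i) (xi_ i))).
have Dgrad := is_derive_mul (is_derive_const (n%:R - 2) j d)
  (is_derive_mul Dw (is_derive_bigsum (fun i => is_derive_mul (Dx i) (Dp (xi_ i))))).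
have := is_derive_sub (is_derive_mul Dr (Dp (tidx n))) (is_derive_add (is_derive_sub Dlap Dgrad) Dq).
set g := (fun y : jet => _).
have -> : g = heat q r by apply: funext => y; rewrite heatE expr2.
move=> H; have -> := @derive_val _ _ _ _ _ _ _ H.
rewrite /heat_derivative /=; congr (_ - (_ + _)).
by ring.
Qed.

End JetSpace.

(** * Calculus in the coordinates (x, t, u) *)

Section SmoothCalculus.
Context {R : realType} {V : normedModType R} {D : set V}.
Implicit Types (f g : V -> R) (p v : V).

Lemma smooth_is_derive f p v : smooth_on D f -> D p -> is_derive p v f ('D_v f p).
Proof. by move=> sf Dp; apply: derivableP; apply: smooth_derivable sf Dp. Qed.

(** An identity between functions on [D] may be differentiated: this is how
    each determining equation yields the next ones. *)
Lemma derive_ext_on (oD : open D) f g p v a b :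
  (forall y, D y -> f y = g y) -> D p ->
  is_derive p v f a -> is_derive p v g b -> a = b.
Proof.
move=> fg Dp Hf Hg; have <- := @derive_val _ _ _ _ _ _ _ Hf.
have <- := @derive_val _ _ _ _ _ _ _ Hg.
exact: (eq_on_derive oD).
Qed.

End SmoothCalculus.

Section CoordinateCalculus.
Context {R : realType} {n : nat}.
Local Notation pt := (pt R n).
Local Notation jet := (jet R n).
Implicit Types (p : pt) (f : pt -> R).


Lemma smooth_zcoord l : sm (fun p => p.1 0 l).
Proof.
apply: (smooth_linear_fun open_space); last exact: continuous_zcoord.
by move=> a y z; rewrite /= !mxE.
Qed.

Lemma smooth_ucoord : sm (fun p => p.2).
Proof. by apply: (smooth_linear_fun open_space) => //; exact: continuous_ucoord. Qed.

Lemma is_derive_zcoord (v p : pt) l : is_derive p v (fun p : pt => p.1 0 l) (v.1 0 l).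
Proof. by apply: derive_linear => a y z; rewrite /= !mxE. Qed.

Lemma is_derive_xc (v p : pt) i : is_derive p v (fun p : pt => xc p 0 i) (xc v 0 i).
Proof. by apply: derive_linear => a y z; rewrite !xcE /= !mxE. Qed.

Lemma smooth_xc i : sm (fun p => xc p 0 i).
Proof.
apply: (smooth_eq open_space _ (smooth_zcoord (xi_ i))) => p _.
by rewrite xcE.
Qed.

Lemma smooth_weight : sm (fun p => weight (xc p)).
Proof.
pose F (p : pt) := (\sum_(i < n) xc p 0 i * xc p 0 i + 1) * 2^-1.
apply: (smooth_eq open_space (f := F)) => [p _|]; first by rewrite /weight normsqE.
apply: smoothM; [exact: open_space| |apply: smooth_cst; exact: open_space].
apply: smoothD; [exact: open_space| |apply: smooth_cst; exact: open_space].
apply: smooth_sum => [|i _]; first exact: open_space.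
by apply: smoothM (smooth_xc i) (smooth_xc i); exact: open_space.
Qed.

Lemma smooth_inv_weight : sm (fun p => (weight (xc p))^-1).
Proof.
by apply: smooth_inv => [|p _|]; [exact: open_space|exact: weight_gt0|exact: smooth_weight].
Qed.

Lemma is_derive_weight (v p : pt) :
  is_derive p v (fun p : pt => weight (xc p)) (dot (xc p) (xc v)).
Proof.
have D i := is_derive_mul (is_derive_xc v p i) (is_derive_xc v p i).
have := is_derive_mul (is_derive_add (is_derive_bigsum D) (is_derive_const 1 p v)) (is_derive_const 2^-1 p v).
have -> : (fun y : pt => (\sum_(i < n) xc y 0 i * xc y 0 i + 1) * 2^-1)
  = (fun p => weight (xc p)) by apply: funext => y; rewrite /weight normsqE.
move=> H; apply: is_derive_eq H _.
by rewrite mulr0 add0r addr0 big_split /= /dot; lra.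
Qed.

Lemma dzE i f p : dz i f p = 'D_((delta_mx 0 i, 0) : pt) f p.
Proof. by []. Qed.

Lemma duE f p : du f p = 'D_((0, 1) : pt) f p.
Proof. by []. Qed.

Lemma derive_slice f (z : 'rV[R]_(n + 1)) l :
  'D_(delta_mx 0 l) (fun z => f (z, 1)) z = dz l f (z, 1).
Proof.
rewrite dzE; apply: eq_derive_lines => h.
by congr f; congr (_, _); rewrite /= scaler0 add0r.
Qed.

Lemma dz_fst (b : 'rV[R]_(n + 1) -> R) l p :
  dz l (fun p : pt => b p.1) p = 'D_(delta_mx 0 l) b p.1.
Proof. by []. Qed.

Lemma smooth_dz i f : sm f -> sm (dz i f).
Proof. exact: smooth_derive. Qed.

Lemma smooth_du f : sm f -> sm (du f).
Proof. exact: smooth_derive. Qed.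

Lemma is_derive_dz f p i : sm f -> space p ->
  is_derive p ((delta_mx 0 i, 0) : pt) f (dz i f p).
Proof. exact: smooth_is_derive. Qed.

Lemma is_derive_du f p : sm f -> space p ->
  is_derive p ((0, 1) : pt) f (du f p).
Proof. exact: smooth_is_derive. Qed.

Lemma dz_eq i f g p : (forall y, space y -> f y = g y) -> space p ->
  dz i f p = dz i g p.
Proof. by move=> fg sp; apply: (eq_on_derive open_space). Qed.

Lemma du_eq f g p : (forall y, space y -> f y = g y) -> space p ->
  du f p = du g p.
Proof. by move=> fg sp; apply: (eq_on_derive open_space). Qed.

Lemma dz_const0 i f c p : (forall y, space y -> f y = c) -> space p ->
  dz i f p = 0.
Proof. by move=> fg sp; rewrite (dz_eq i fg sp) /dz (derive_cst c). Qed.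

Lemma du_const0 f c p : (forall y, space y -> f y = c) -> space p -> du f p = 0.
Proof. by move=> fg sp; rewrite (du_eq fg sp) /du (derive_cst c). Qed.

Lemma dzC i k f p : sm f -> space p -> dz i (dz k f) p = dz k (dz i f) p.
Proof. by move=> sf sp; exact: (schwarz open_space _ _ sf sp). Qed.

Lemma du_dzC i f p : sm f -> space p -> du (dz i f) p = dz i (du f) p.
Proof. by move=> sf sp; exact: (schwarz open_space _ _ sf sp). Qed.

Lemma xc_delta (i : 'I_n) k : xc ((delta_mx 0 (xi_ i), 0) : pt) 0 k = (k == i)%:R.
Proof. by rewrite xcE /= mxE eqxx /= (inj_eq (@lshift_inj _ _)). Qed.

Lemma sum_delta_l (F : 'I_n -> R) k : \sum_(i < n) (i == k)%:R * F i = F k.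
Proof.
rewrite (bigD1 k) //= eqxx mul1r big1 ?addr0 // => i /negbTE ->.
by rewrite mul0r.
Qed.

Lemma sum_delta_r (F : 'I_n -> R) k : \sum_(i < n) F i * (i == k)%:R = F k.
Proof. by rewrite -[RHS]sum_delta_l; apply: eq_bigr => i _; rewrite mulrC. Qed.

Lemma is_derive_xc_dz p i k :
  is_derive p ((delta_mx 0 (xi_ i), 0) : pt) (fun p : pt => xc p 0 k) (k == i)%:R.
Proof. by rewrite -xc_delta; exact: is_derive_xc. Qed.

Lemma is_derive_weight_dz p i :
  is_derive p ((delta_mx 0 (xi_ i), 0) : pt) (fun p : pt => weight (xc p)) (xc p 0 i).
Proof.
apply: is_derive_eq (is_derive_weight _ p) _.
rewrite /dot -[RHS](sum_delta_r (fun k => xc p 0 k) i).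
by apply: eq_bigr => k _; rewrite xc_delta.
Qed.

Lemma sum_indices (F : 'I_(n + 1) -> R) :
  \sum_l F l = \sum_(i < n) F (xi_ i) + F (tidx n).
Proof. by rewrite big_split_ord /= big_ord1. Qed.

End CoordinateCalculus.

(** * The symmetry criterion on jets *)

Section Determining.
Context {R : realType} {n : nat}.
Local Notation pt := (pt R n).
Variables (q r : R) (v : pt -> pt).
Implicit Types (p : pt) (P : 'rV[R]_(n + 1)) (H K : 'M[R]_(n + 1)).

Definition total1 i (f : pt -> R) p P := dz i f p + P 0 i * du f p.

(** What is left of [totalDD i i] without its term in the second derivatives
    of [u], see [totalDD_diag]. *)
Definition total2 i (f : pt -> R) p P :=
  dz i (dz i f) p + 2 * P 0 i * dz i (du f) p + P 0 i ^+ 2 * du (du f) p.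

Definition trace H : R := \sum_(i < n) H (xi_ i) (xi_ i).

Lemma totalDD_diag i f p P H :
  totalDD i i f ((p, P), H) = total2 i f p P + H i i * du f p.
Proof.
rewrite /totalDD /total2 /jpt /j1 /j2 /fst /snd.
move: (dz i (dz i f) p) (dz i (du f) p) (du (du f) p) (du f p) => a b c d.
by ring.
Qed.

Lemma trace_pr2 p P H : H^T = H ->
  \sum_(i < n) pr_coef2 v (xi_ i) (xi_ i) ((p, P), H) =
    \sum_(i < n) (total2 (xi_ i) (ucoef v) p P
                  - \sum_l total2 (xi_ i) (zcoef v l) p P * P 0 l)
    + trace H * (du (ucoef v) p - \sum_l du (zcoef v l) p * P 0 l)
    - 2 * \sum_(i < n) \sum_l total1 (xi_ i) (zcoef v l) p P * H (xi_ i) l.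
Proof.
move=> sH; rewrite /trace mulr_suml mulr_sumr -big_split -sumrB /=.
apply: eq_bigr => i _.
rewrite /pr_coef2 totalDD_diag.
have -> : \sum_l totalDD (xi_ i) (xi_ i) (zcoef v l) (p, P, H) * j1 (p, P, H) 0 l
  = \sum_l total2 (xi_ i) (zcoef v l) p P * P 0 l
    + H (xi_ i) (xi_ i) * \sum_l du (zcoef v l) p * P 0 l.
  rewrite mulr_sumr -big_split /=; apply: eq_bigr => l _.
  by rewrite totalDD_diag mulrDl -mulrA.
rewrite [X in _ - X = _]big_split /=.
set A := \sum_l _ * _; set B := \sum_l du _ _ * _.
have -> : \sum_l totalD (xi_ i) (zcoef v l) (p, P, H) * j2 (p, P, H) (xi_ i) l
  = \sum_l total1 (xi_ i) (zcoef v l) p P * H (xi_ i) l by [].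
set C := \sum_l _ * H _ _; set D := total2 _ _ _ _; move: (du _ _) => E.
by ring.
Qed.

(** The equation restricts the second derivatives of [u] only by prescribing
    the spatial trace of the Hessian; this is the prescribed value. *)
Definition heat_trace p P : R :=
  (p.2 `^ r * P 0 (tidx n)
   + (n%:R - 2) * (weight (xc p) * \sum_(i < n) xc p 0 i * P 0 (xi_ i))
   - p.2 `^ q) / weight (xc p) ^+ 2.

Lemma heat_traceP p P H : heat q r ((p, P), H) = 0 <-> trace H = heat_trace p P.
Proof.
have w0 : weight (xc p) ^+ 2 != 0 by rewrite expf_neq0 // gt_eqF // weight_gt0.
rewrite heatE /= -/(trace H) /heat_trace /uc /j1 /jpt /=.
split=> [h0|->].
  apply: (mulIf w0); rewrite divfK //; apply/eqP; rewrite -subr_eq0 -oppr_eq0 -[X in _ == X]h0.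
  by apply/eqP; ring.
by rewrite [weight (xc p) ^+ 2 * _]mulrC divfK //; ring.
Qed.

(** The Hessian enters the criterion only through its spatial trace [h] and
    its pairing [K] with the total derivatives of [xi] and [eta]. *)
Definition reduced_symmetry p P (h : R) (K : R) : R :=
  let x := xc p in let u := p.2 in
  let X i := zcoef v (xi_ i) p in
  let phi1 l := total1 l (ucoef v) p P
                - \sum_k total1 l (zcoef v k) p P * P 0 k in
  u `^ r * phi1 (tidx n) + P 0 (tidx n) * (r * u `^ (r - 1) * ucoef v p)
  - (weight x ^+ 2 * (\sum_(i < n) (total2 (xi_ i) (ucoef v) p P
                       - \sum_l total2 (xi_ i) (zcoef v l) p P * P 0 l)
         + h * (du (ucoef v) p - \sum_l du (zcoef v l) p * P 0 l) - 2 * K)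
     + h * (2 * weight x * \sum_(i < n) x 0 i * X i)
     - (n%:R - 2) * (weight x * (\sum_(i < n) (x 0 i * phi1 (xi_ i)
                                    + P 0 (xi_ i) * X i))
        + (\sum_(i < n) x 0 i * P 0 (xi_ i)) * \sum_(i < n) x 0 i * X i)
     + q * u `^ (q - 1) * ucoef v p).

Lemma heat_derivative_pr2 p P H : H^T = H ->
  heat_derivative q r ((p, P), H) (pr2 v ((p, P), H)) =
  reduced_symmetry p P (trace H)
    (\sum_(i < n) \sum_l total1 (xi_ i) (zcoef v l) p P * H (xi_ i) l).
Proof.
move=> sH; rewrite /heat_derivative /reduced_symmetry /=.
have E l : j1 (pr2 v (p, P, H)) 0 l = total1 l (ucoef v) p P
                - \sum_k total1 l (zcoef v k) p P * P 0 k.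
  by rewrite /j1 /pr2 /= mxE /pr_coef1 /totalD.
have E2 : \sum_(i < n) j2 (pr2 v (p, P, H)) (xi_ i) (xi_ i) =
   \sum_(i < n) pr_coef2 v (xi_ i) (xi_ i) ((p, P), H).
  by apply: eq_bigr => i _; rewrite /j2 /pr2 /= mxE.
rewrite E2 (trace_pr2 _ _ sH) E -/(trace H) /j1 /jpt /uc /=.
congr (_ - (_ * _ + _ * (_ * _) - _ * (_ * _ + _ * _) + _)).
- by apply: eq_bigr => i _; rewrite (xcE (v _)).
- by apply: eq_bigr => i _; rewrite (xcE (v _)) -E.
- by apply: eq_bigr => i _; rewrite (xcE (v _)).
Qed.

Lemma reduced_symmetryE p P H : is_infinitesimal_symmetry (heat q r) v ->
  space p -> H^T = H -> trace H = heat_trace p P ->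
  reduced_symmetry p P (heat_trace p P)
    (\sum_(i < n) \sum_l total1 (xi_ i) (zcoef v l) p P * H (xi_ i) l) = 0.
Proof.
move=> sym sp sH tH; have h0 := (heat_traceP p P H).2 tH.
by rewrite -tH -heat_derivative_pr2 // -derive_heat //; apply: sym.
Qed.

Lemma symmetry_of_reduced :
  (forall p P H, space p -> H^T = H -> trace H = heat_trace p P ->
    reduced_symmetry p P (heat_trace p P)
      (\sum_(i < n) \sum_l total1 (xi_ i) (zcoef v l) p P * H (xi_ i) l) = 0) ->
  is_infinitesimal_symmetry (heat q r) v.
Proof.
move=> red [[p P] H] sp sH /heat_traceP tH.
by rewrite derive_heat // heat_derivative_pr2 // tH; apply: red.
Qed.

End Determining.

(** * Testing the criterion *)

Section JetTests.
Context {R : realType} {n : nat}.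
Local Notation pt := (pt R n).
Variables (q r : R) (v : pt -> pt).
Implicit Types (p : pt) (P : 'rV[R]_(n + 1)) (H K : 'M[R]_(n + 1)).

Hypothesis hn : (2 <= n)%N.
Hypothesis sv : smooth_on space v.
Hypothesis sym : is_infinitesimal_symmetry (heat q r) v.

Local Notation X i := (zcoef v (xi_ i)).
Local Notation eta := (zcoef v (tidx n)).
Local Notation phi := (ucoef v).
Local Notation d i := (dz (xi_ i)).
Local Notation dt := (dz (tidx n)).

Definition index0 : 'I_n := Ordinal (leq_trans (leqnSn 1) hn).
Definition index1 : 'I_n := Ordinal hn.

Lemma other_index (k : 'I_n) : exists i : 'I_n, i != k.
Proof.
by case: (eqVneq index0 k) => [<-|?]; [exists index1|exists index0].
Qed.

Lemma xi_tidx i : (xi_ i == tidx n) = false.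
Proof. exact: eq_lrshift. Qed.

Lemma smooth_zcoef l : sm (zcoef v l).
Proof.
apply: (smooth_linear_fun_comp open_space (f := fun p : pt => p.1 0 l)) sv.
- by move=> a y z; rewrite /= !mxE.
- exact: continuous_zcoord.
Qed.

Lemma smooth_ucoef : sm phi.
Proof.
apply: (smooth_linear_fun_comp open_space (f := fun p : pt => p.2)) sv => //.
exact: continuous_ucoord.
Qed.

Definition pairing (T : 'I_n -> 'I_(n + 1) -> R) K : R :=
  \sum_(i < n) \sum_l T i l * K (xi_ i) l.

Lemma pairingD T K K' : pairing T (K + K') = pairing T K + pairing T K'.
Proof.
rewrite -big_split /=; apply: eq_bigr => i _; rewrite -big_split /=.
by apply: eq_bigr => l _; rewrite mxE mulrDr.
Qed.

Lemma pairingN T K : pairing T (- K) = - pairing T K.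
Proof.
rewrite -sumrN; apply: eq_bigr => i _; rewrite -sumrN.
by apply: eq_bigr => l _; rewrite mxE mulrN.
Qed.

Lemma pairingZ T a K : pairing T (a *: K) = a * pairing T K.
Proof.
rewrite mulr_sumr; apply: eq_bigr => i _; rewrite mulr_sumr.
by apply: eq_bigr => l _; rewrite mxE mulrCA.
Qed.

Lemma pairing_delta T i l : pairing T (delta_mx (xi_ i) l) = T i l.
Proof.
rewrite /pairing (bigD1 i) //= (bigD1 l) //= mxE !eqxx mulr1.
rewrite big1 => [|k /negbTE kl]; last by rewrite mxE kl andbF mulr0.
rewrite big1 ?addr0 // => k /negbTE ki; apply: big1 => m _.
by rewrite mxE (inj_eq (@lshift_inj _ _)) ki mulr0.
Qed.

Lemma pairing_delta_t T l : pairing T (delta_mx (tidx n) l) = 0.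
Proof.
by apply: big1 => i _; apply: big1 => m _; rewrite mxE xi_tidx mulr0.
Qed.

Lemma traceD H K : trace (H + K) = trace H + trace K.
Proof. by rewrite -big_split; apply: eq_bigr => i _; rewrite mxE. Qed.

Lemma traceN H : trace (- H) = - trace H.
Proof. by rewrite -sumrN; apply: eq_bigr => i _; rewrite mxE. Qed.

Lemma traceZ a H : trace (a *: H) = a * trace H.
Proof. by rewrite mulr_sumr; apply: eq_bigr => i _; rewrite mxE. Qed.

Lemma trace_delta i k : trace (delta_mx (xi_ i) (xi_ k) : 'M[R]_(n + 1)) = (i == k)%:R.
Proof.
rewrite /trace (bigD1 i) //= mxE eqxx (inj_eq (@lshift_inj _ _)) /=.
rewrite big1 ?addr0 // => m /negbTE mi.
by rewrite mxE !(inj_eq (@lshift_inj _ _)) mi.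
Qed.

Lemma trace_delta_t l : trace (delta_mx (tidx n) l : 'M[R]_(n + 1)) = 0.
Proof. by apply: big1 => i _; rewrite mxE xi_tidx. Qed.

Lemma trace_delta_tr l : trace (delta_mx l (tidx n) : 'M[R]_(n + 1)) = 0.
Proof. by apply: big1 => i _; rewrite mxE xi_tidx andbF. Qed.

Definition heat_hessian p P : 'M[R]_(n + 1) :=
  heat_trace q r p P *: delta_mx (xi_ index0) (xi_ index0).

Lemma heat_hessian_sym p P : (heat_hessian p P)^T = heat_hessian p P.
Proof. by rewrite /heat_hessian linearZ /= trmx_delta. Qed.

Lemma heat_hessian_trace p P : trace (heat_hessian p P) = heat_trace q r p P.
Proof. by rewrite traceZ trace_delta eqxx mulr1. Qed.

Local Notation T p P := (fun i l => total1 (xi_ i) (zcoef v l) p P).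

Lemma reduced_difference p P (h K K' : R) :
  reduced_symmetry q r v p P h K - reduced_symmetry q r v p P h K'
  = 2 * weight (xc p) ^+ 2 * (K - K').
Proof. by rewrite /reduced_symmetry /=; ring. Qed.

(** A symmetric trace-free matrix may be added to the Hessian without leaving
    the equation, and the criterion changes by a multiple of the pairing. *)
Lemma traceless_test p P K : space p -> K^T = K -> trace K = 0 ->
  pairing (T p P) K = 0.
Proof.
move=> sp sK tK.
set H0 := heat_hessian p P; have sH0 := heat_hessian_sym p P; have tH0 := heat_hessian_trace p P.
have E0 := reduced_symmetryE sym sp sH0 tH0.
have sHK : (H0 + K)^T = H0 + K by rewrite linearD /= sK sH0.
have tHK : trace (H0 + K) = heat_trace q r p P by rewrite traceD tK addr0.
have EK := reduced_symmetryE sym sp sHK tHK.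
have D := reduced_difference p P (heat_trace q r p P) (pairing (T p P) (H0 + K)) (pairing (T p P) H0).
have w0 : 2 * weight (xc p) ^+ 2 != 0 by rewrite mulf_neq0 ?expf_neq0 ?pnatr_eq0 ?gt_eqF ?weight_gt0.
apply: (mulfI w0); rewrite mulr0 -[pairing _ K](addKr (pairing (T p P) H0)) -pairingD.
by rewrite addrC -D; rewrite {1 2}/pairing E0 EK subr0.
Qed.

Lemma total1_eta i p P : space p -> total1 (xi_ i) eta p P = 0.
Proof.
move=> sp; have := @traceless_test p P (delta_mx (xi_ i) (tidx n) + delta_mx (tidx n) (xi_ i)) sp.
rewrite pairingD pairing_delta pairing_delta_t addr0; apply.
  by rewrite linearD /= !trmx_delta addrC.
by rewrite traceD trace_delta_t trace_delta_tr addr0.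
Qed.

Lemma total1_offdiag i k p P : i != k -> space p ->
  total1 (xi_ i) (X k) p P + total1 (xi_ k) (X i) p P = 0.
Proof.
move=> ik sp; have := @traceless_test p P (delta_mx (xi_ i) (xi_ k) + delta_mx (xi_ k) (xi_ i)) sp.
rewrite pairingD !pairing_delta; apply.
  by rewrite linearD /= !trmx_delta addrC.
by rewrite traceD !trace_delta [k == i]eq_sym (negbTE ik) addr0.
Qed.

Lemma total1_diag i k p P : space p ->
  total1 (xi_ i) (X i) p P = total1 (xi_ k) (X k) p P.
Proof.
move=> sp; have := @traceless_test p P (delta_mx (xi_ i) (xi_ i) - delta_mx (xi_ k) (xi_ k)) sp.
rewrite pairingD pairingN !pairing_delta => H; apply/eqP; rewrite -subr_eq0; apply/eqP; apply: H.
  by rewrite linearB /= !trmx_delta.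
by rewrite traceD traceN !trace_delta !eqxx subrr.
Qed.

Lemma total1_0 l f p : total1 l f p 0 = dz l f p.
Proof. by rewrite /total1 mxE mul0r addr0. Qed.

Lemma eta_x i p : space p -> d i eta p = 0.
Proof. by move=> sp; rewrite -total1_0 total1_eta. Qed.

Lemma eta_u p : space p -> du eta p = 0.
Proof.
move=> sp; have := total1_eta index0 (const_mx 1) sp.
by rewrite /total1 eta_x // add0r mxE mul1r.
Qed.

Lemma xi_antisym i k p : i != k -> space p -> d i (X k) p = - d k (X i) p.
Proof.
move=> ik sp; have := total1_offdiag 0 ik sp.
by rewrite !total1_0 => /eqP; rewrite addr_eq0 => /eqP.
Qed.

Lemma xi_diag i k p : space p -> d i (X i) p = d k (X k) p.
Proof. by move=> sp; have := total1_diag i k 0 sp; rewrite !total1_0. Qed.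

(** The off-diagonal test at the gradient [e_i]: the terms in the derivatives
    along [x] cancel, and only that in the derivative along [u] is left. *)
Lemma xi_u k p : space p -> du (X k) p = 0.
Proof.
move=> sp; have [i ik] := other_index k.
have := total1_offdiag (delta_mx 0 (xi_ i)) ik sp.
rewrite /total1 !mxE !eqxx (inj_eq (@lshift_inj _ _)) [k == i]eq_sym (negbTE ik) /=.
by rewrite mul1r mul0r addr0 (xi_antisym ik sp) addrAC addNr add0r.
Qed.

(** By [xi_diag] the choice of the index is immaterial. *)
Definition expansion : pt -> R := dz (xi_ index0) (zcoef v (xi_ index0)).
Local Notation mu := expansion.

Lemma conformal i k p : space p ->
  d i (X k) p + d k (X i) p = 2 * mu p * (i == k)%:R.
Proof.
move=> sp; case: (eqVneq i k) => [->|ik].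
  by rewrite (xi_diag k index0 sp) mulr1 mulr_natl mulr2n.
by rewrite (xi_antisym ik sp) addNr mulr0.
Qed.

(** The criterion as a polynomial in the spatial gradient [y] and the time
    derivative [tau] of [u]: the equation has eliminated the Hessian, and the
    derivatives of [xi] and [eta] that vanish are left out. *)
Definition determining p (y : 'rV[R]_n) (tau : R) : R :=
  let x := xc p in let u := p.2 in let w := weight x in
  let xX := \sum_(i < n) x 0 i * X i p in
  let h := (u `^ r * tau + (n%:R - 2) * (w * \sum_(i < n) x 0 i * y 0 i)
            - u `^ q) / w ^+ 2 in
  u `^ r * (dt phi p + tau * du phi p - \sum_(k < n) dt (X k) p * y 0 k - dt eta p * tau)
  + tau * (r * u `^ (r - 1) * phi p)
  - (w ^+ 2 * (\sum_(i < n) (d i (d i phi) p + 2 * y 0 i * d i (du phi) p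
                   + y 0 i ^+ 2 * du (du phi) p
                   - \sum_(k < n) d i (d i (X k)) p * y 0 k)
               + h * (du phi p - 2 * mu p))
     + h * (2 * w * xX)
     - (n%:R - 2) * (w * (\sum_(i < n) (x 0 i * (d i phi p + y 0 i * du phi p
                              - \sum_(k < n) d i (X k) p * y 0 k) + y 0 i * X i p))
                     + (\sum_(i < n) x 0 i * y 0 i) * xX)
     + q * u `^ (q - 1) * phi p).

Lemma determiningE p y tau : space p -> determining p y tau = 0.
Proof.
move=> sp; pose P : 'rV[R]_(n + 1) := row_mx y (const_mx tau).
have Px i : P 0 (xi_ i) = y 0 i by rewrite row_mxEl.
have Pt : P 0 (tidx n) = tau by rewrite row_mxEr mxE.
have hE : heat_trace q r p P =
  (p.2 `^ r * tau + (n%:R - 2) * (weight (xc p) * \sum_(i < n) xc p 0 i * y 0 i)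
            - p.2 `^ q) / weight (xc p) ^+ 2.
  by rewrite /heat_trace Pt; under eq_bigr do rewrite Px.
set H0 := heat_hessian p P; have sH0 := heat_hessian_sym p P; have tH0 := heat_hessian_trace p P.
have := reduced_symmetryE sym sp sH0 tH0.
rewrite -/(pairing (T p P) _) pairingZ pairing_delta /total1 xi_u // mulr0 addr0 -/(mu p).
have zu l p' : space p' -> du (zcoef v l) p' = 0.
  move=> sp'; case: (split_ordP l) => k ->; first exact: xi_u.
  by rewrite (ord1 k); exact: eta_u.
have t1 l : \sum_k total1 l (zcoef v k) p P * P 0 k
    = \sum_(k < n) dz l (X k) p * y 0 k + dz l eta p * tau.
  rewrite sum_indices /total1 zu // mulr0 addr0 Pt; congr (_ + _).
  by apply: eq_bigr => k _; rewrite zu // mulr0 addr0 Px.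
have t2 i : \sum_l total2 (xi_ i) (zcoef v l) p P * P 0 l
    = \sum_(k < n) d i (d i (X k)) p * y 0 k.
  have E l : total2 (xi_ i) (zcoef v l) p P = d i (d i (zcoef v l)) p.
    rewrite /total2 (dz_const0 _ (zu l) sp) (du_const0 (zu l) sp).
    by rewrite !mulr0 !addr0.
  rewrite sum_indices E (dz_const0 _ (eta_x i) sp) mul0r addr0.
  by apply: eq_bigr => k _; rewrite E Px.
have t3 : \sum_l du (zcoef v l) p * P 0 l = 0.
  by apply: big1 => l _; rewrite zu // mul0r.
rewrite /reduced_symmetry /= t1 t3 /total1 Pt subr0 hE => E.
rewrite /determining /= -[RHS]E.
have -> : \sum_(i < n) (total2 (xi_ i) phi p P -
          \sum_l total2 (xi_ i) (zcoef v l) p P * P 0 l) =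
   \sum_(i < n) (d i (d i phi) p + 2 * y 0 i * d i (du phi) p
                   + y 0 i ^+ 2 * du (du phi) p
                   - \sum_(k < n) d i (d i (X k)) p * y 0 k).
  by apply: eq_bigr => i _; rewrite t2 /total2 Px.
have -> : \sum_(i < n) (xc p 0 i * (dz (xi_ i) phi p + P 0 (xi_ i) * du phi p -
       \sum_(k < n + 1) (dz (xi_ i) (zcoef v k) p + P 0 (xi_ i) * du (zcoef v k) p) * P 0 k) +
      P 0 (xi_ i) * X i p)
  = \sum_(i < n) (xc p 0 i * (d i phi p + y 0 i * du phi p
                              - \sum_(k < n) d i (X k) p * y 0 k) + y 0 i * X i p).
  apply: eq_bigr => i _; have := t1 (xi_ i); rewrite /total1 => ->.
  by rewrite eta_x // mul0r addr0 Px.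
have -> : \sum_(i < n) xc p 0 i * P 0 (xi_ i) = \sum_(i < n) xc p 0 i * y 0 i.
  by apply: eq_bigr => i _; rewrite Px.
by ring.
Qed.

End JetTests.

(** * The determining equations *)

Section SpatialOperators.
Context {R : realType} {n : nat}.
Local Notation pt := (pt R n).
Local Notation d i := (dz (lshift 1 i : 'I_(n + 1))).
Implicit Types (p : pt) (f : pt -> R).

Definition flat_laplacian f p : R := \sum_(i < n) d i (d i f) p.

Definition radial_derivative f p : R := \sum_(i < n) xc p 0 i * d i f p.

(** The Laplace-Beltrami operator of the round metric, acting on functions of
    [(x, t, u)] at fixed [t] and [u]. *)
Definition laplacian f p : R :=
  weight (xc p) ^+ 2 * flat_laplacian f p
     - (n%:R - 2) * (weight (xc p) * radial_derivative f p).

Definition radial (X : 'I_n -> pt -> R) p : R := \sum_(i < n) xc p 0 i * X i p.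

(** For a conformal field [X] of the flat metric, with expansion [mu], this is
    the factor of the round metric: the Lie derivative of [g] is
    [2 * sigma X mu] times [g]. *)
Definition sigma (X : 'I_n -> pt -> R) (mu : pt -> R) p : R :=
  mu p - radial X p / weight (xc p).

End SpatialOperators.

Section DeterminingEquations.
Context {R : realType} {n : nat}.
Local Notation pt := (pt R n).
Variables (q r : R) (v : pt -> pt).
Implicit Types (p : pt).

Hypothesis hn : (2 <= n)%N.
Hypothesis sv : smooth_on space v.
Hypothesis sym : is_infinitesimal_symmetry (heat q r) v.

Local Notation X i := (zcoef v (xi_ i)).
Local Notation eta := (zcoef v (tidx n)).
Local Notation phi := (ucoef v).
Local Notation d i := (dz (xi_ i)).
Local Notation dt := (dz (tidx n)).
Local Notation mu := (expansion v hn).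

Local Notation radial := (radial (fun i => X i)).
Local Notation sigma := (sigma (fun i => X i) mu).

(** Gradients along one coordinate axis suffice to separate the coefficients
    of the polynomial. *)
Lemma determining_delta p (s tau : R) k :
  determining q r v hn p (s *: delta_mx 0 k) tau =
  let x := xc p in let u := p.2 in let w := weight x in
  let h := (u `^ r * tau + (n%:R - 2) * (w * (s * x 0 k)) - u `^ q) / w ^+ 2 in
  u `^ r * (dt phi p + tau * du phi p - s * dt (X k) p - dt eta p * tau)
  + tau * (r * u `^ (r - 1) * phi p)
  - (w ^+ 2 * ((flat_laplacian phi p + 2 * s * d k (du phi) p + s ^+ 2 * du (du phi) p
                - s * flat_laplacian (X k) p)
               + h * (du phi p - 2 * mu p))
     + h * (2 * w * radial p)
     - (n%:R - 2) * (w * (radial_derivative phi p + s * x 0 k * du phi p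
                          - s * radial_derivative (X k) p + s * X k p)
                     + s * x 0 k * radial p)
     + q * u `^ (q - 1) * phi p).
Proof.
have yE i : (s *: delta_mx 0 k : 'rV[R]_n) 0 i = s * (i == k)%:R.
  by rewrite !mxE eqxx.
have sumE (F : 'I_n -> R) : \sum_(i < n) F i * (s *: delta_mx 0 k : 'rV[R]_n) 0 i = s * F k.
  under eq_bigr do rewrite yE mulrCA.
  by rewrite -mulr_sumr sum_delta_r.
rewrite /determining /= !sumE.
have -> : \sum_(i < n)
        (d i (d i phi) p + 2 * (s *: delta_mx 0 k : 'rV[R]_n) 0 i * d i (du phi) p +
         (s *: delta_mx 0 k : 'rV[R]_n) 0 i ^+ 2 * du (du phi) p -
         \sum_(k0 < n) d i (d i (X k0)) p * (s *: delta_mx 0 k : 'rV[R]_n) 0 k0)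
  = flat_laplacian phi p + 2 * s * d k (du phi) p + s ^+ 2 * du (du phi) p
                - s * flat_laplacian (X k) p.
  rewrite /flat_laplacian [in RHS]mulr_sumr.
  rewrite -[2 * s * _](sum_delta_l (fun i => 2 * s * d i (du phi) p) k).
  rewrite -[s ^+ 2 * _](sum_delta_l (fun i => s ^+ 2 * du (du phi) p) k).
  rewrite -!big_split -sumrB /=; apply: eq_bigr => i _; rewrite sumE yE.
  move: (d i (d i phi) p) (d i (du phi) p) (du (du phi) p) (d i (d i (X k)) p) => A B C D.
  by case: (i == k); rewrite ?mulr1n ?mulr0n; ring.
have -> : \sum_(i < n)
      (xc p 0 i *
       (d i phi p + (s *: delta_mx 0 k : 'rV[R]_n) 0 i * du phi p -
        \sum_(k0 < n) d i (X k0) p * (s *: delta_mx 0 k : 'rV[R]_n) 0 k0) +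
       (s *: delta_mx 0 k : 'rV[R]_n) 0 i * X i p)
  = radial_derivative phi p + s * xc p 0 k * du phi p
                          - s * radial_derivative (X k) p + s * X k p.
  rewrite /radial_derivative [in RHS]mulr_sumr.
  rewrite -[s * xc p 0 k * _](sum_delta_l (fun i => s * xc p 0 i * du phi p) k).
  rewrite -[s * X k p](sum_delta_l (fun i => s * X i p) k).
  rewrite -!big_split -sumrB -big_split /=; apply: eq_bigr => i _; rewrite sumE yE.
  move: (d i phi p) (du phi p) (d i (X k) p) (X i p) (xc p 0 i) => A B C D E.
  by case: (i == k); rewrite ?mulr1n ?mulr0n; ring.
by [].
Qed.

Lemma determining_delta0 p (s tau : R) k : space p ->
  determining q r v hn p (s *: delta_mx 0 k) tau = 0.
Proof. by move=> sp; apply: determiningE. Qed.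

Let w0 p : weight (xc p) != 0.
Proof. by rewrite gt_eqF // weight_gt0. Qed.

(* The identities below hold for arbitrary values of the coefficients; naming
   them keeps them opaque to the ring tactics. *)
Ltac generalize_coefficients p k :=
  move: (w0 p) (du (du phi) p) (dt phi p) (du phi p) (dt (X k) p) (dt eta p)
    (flat_laplacian phi p) (d k (du phi) p) (flat_laplacian (X k) p) (mu p) (radial p)
    (radial_derivative phi p) (radial_derivative (X k) p) (X k p) => *.

(** The second difference of the polynomial in [s], at [tau = 0]. *)
Lemma phi_affine p : space p -> du (du phi) p = 0.
Proof.
move=> sp; pose k := index0 hn.
have := determining_delta0 1 0 k sp; have := determining_delta0 (-1) 0 k sp.
have := determining_delta0 0 0 k sp; rewrite !determining_delta /=.
set a := _ - _; set b := _ - _; set c := _ - _ => a0 b0 c0.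
have E : a *+ 2 - b - c = 2 * weight (xc p) ^+ 2 * du (du phi) p.
  rewrite /a /b /c; generalize_coefficients p k.
  by ring.
apply/eqP; move: E; rewrite a0 b0 c0 mul0rn !subr0 => /esym/eqP.
by rewrite -mulrA mulf_eq0 pnatr_eq0 /= mulf_eq0 expf_eq0 /= (negbTE (w0 p)).
Qed.

(** The part of the polynomial that is linear in [tau], at gradient zero. *)
Lemma phi_sigma p : space p -> r * phi p = p.2 * (dt eta p - 2 * sigma p).
Proof.
move=> sp; pose k := index0 hn.
have := determining_delta0 0 0 k sp; have := determining_delta0 0 1 k sp.
rewrite !determining_delta /=; set a := _ - _; set b := _ - _ => a0 b0.
have E : a - b = r * p.2 `^ (r - 1) * phi p - p.2 `^ r * (dt eta p - 2 * sigma p).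
  rewrite /a /b /sigma; generalize_coefficients p k.
  by field.
have u0 : p.2 `^ (r - 1) != 0 by rewrite gt_eqF // powR_gt0.
apply: (mulfI u0); apply/eqP; rewrite -subr_eq0 !mulrA.
have -> : p.2 `^ (r - 1) * p.2 = p.2 `^ r.
  by rewrite -[Y in _ * Y]powRr1 ?(ltW sp) // -powRD ?subrK // (gt_eqF sp) implybT.
by rewrite [_ * r]mulrC -E a0 b0 subr0.
Qed.

(** The value at [s = tau = 0]. *)
Lemma constant_term p : space p ->
  p.2 `^ r * dt phi p - laplacian phi p + p.2 `^ q * (du phi p - 2 * sigma p) - q * p.2 `^ (q - 1) * phi p = 0.
Proof.
move=> sp; pose k := index0 hn; have := determining_delta0 0 0 k sp.
rewrite determining_delta /= => E; rewrite -[RHS]E /sigma /laplacian.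
generalize_coefficients p k.
by field.
Qed.

(** The part that is odd in [s], at [tau = 0]. *)
Lemma linear_term p k : space p ->
  p.2 `^ r * dt (X k) p + 2 * weight (xc p) ^+ 2 * d k (du phi) p
  = weight (xc p) ^+ 2 * flat_laplacian (X k) p
    + (n%:R - 2) * (2 * weight (xc p) * xc p 0 k * mu p - xc p 0 k * radial p
        - weight (xc p) * radial_derivative (X k) p + weight (xc p) * X k p).
Proof.
move=> sp; have := determining_delta0 1 0 k sp; have := determining_delta0 (-1) 0 k sp.
rewrite !determining_delta /=; set a := _ - _; set b := _ - _ => a0 b0.
apply/eqP; rewrite -subr_eq0; apply/eqP.
have E : a - b = 2 * (p.2 `^ r * dt (X k) p + 2 * weight (xc p) ^+ 2 * d k (du phi) p
   - (weight (xc p) ^+ 2 * flat_laplacian (X k) p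
    + (n%:R - 2) * (2 * weight (xc p) * xc p 0 k * mu p - xc p 0 k * radial p
        - weight (xc p) * radial_derivative (X k) p + weight (xc p) * X k p))).
  rewrite /a /b; generalize_coefficients p k.
  by field.
by move: E; rewrite a0 b0 subr0 => /esym/eqP; rewrite mulf_eq0 pnatr_eq0 /= => /eqP.
Qed.

End DeterminingEquations.

(** * Conformal fields of the sphere *)

Section ConformalFields.
Context {R : realType} {n : nat}.
Local Notation pt := (pt R n).
Local Notation d i := (dz (xi_ i)).
Variables (X : 'I_n -> pt -> R) (mu : pt -> R).
Implicit Types (p : pt).

Hypothesis sX : forall i, sm (X i).
Hypothesis smu : sm mu.
Hypothesis conf : forall i k p, space p ->
  d i (X k) p + d k (X i) p = 2 * mu p * (i == k)%:R.

Let ld i : pt := (delta_mx 0 (xi_ i), 0).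

Let Dd f p i : sm f -> space p -> is_derive p (ld i) f (d i f p).
Proof. exact: is_derive_dz. Qed.

Lemma divergence_term i p : space p -> d i (X i) p = mu p.
Proof. by move=> sp; have := conf i i sp; rewrite eqxx mulr1; lra. Qed.

(** The conformal equation for [(i, k)], differentiated along [i], and that
    for [(i, i)], differentiated along [k]. *)
Lemma second_derivative i k p : space p ->
  d i (d i (X k)) p = 2 * (i == k)%:R * d i mu p - d k mu p.
Proof.
move=> sp.
have H1 := is_derive_sub (is_derive_mul (is_derive_const (2 * (i == k)%:R) p (ld i)) (Dd i smu sp))
  (Dd i (smooth_dz (xi_ k) (sX i)) sp).
have H2 := Dd i (smooth_dz (xi_ i) (sX k)) sp.
have -> := derive_ext_on open_space _ sp H2 H1; last first.
  by move=> y sy; have := conf i k sy; lra.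
rewrite mulr0 addr0 (dzC _ _ (sX i) sp); congr (_ - _).
by apply: dz_eq sp => y sy; exact: divergence_term.
Qed.

Lemma laplacian_field k p : space p ->
  flat_laplacian (X k) p = (2 - n%:R) * d k mu p.
Proof.
move=> sp; rewrite /flat_laplacian; under eq_bigr do rewrite second_derivative //.
rewrite sumrB sumr_const card_ord.
under eq_bigr do rewrite -mulrA mulrCA.
by rewrite sum_delta_l -mulr_natl; ring.
Qed.

(** The derivative of [laplacian_field] along [k] gives
    [(2 - n) * d k (d k mu) = flat_laplacian mu] for each [k]; summing over [k]
    leaves [(n - 1) * flat_laplacian mu = 0]. *)
Lemma laplacian_expansion (hn : (2 <= n)%N) p : space p -> flat_laplacian mu p = 0.
Proof.
move=> sp.
have E k : (2 - n%:R) * d k (d k mu) p = flat_laplacian mu p.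
  have H1 := is_derive_mul (is_derive_const (2 - n%:R) p (ld k)) (Dd k (smooth_dz (xi_ k) smu) sp).
  have H2 := is_derive_bigsum (fun i => Dd k (smooth_dz (xi_ i) (smooth_dz (xi_ i) (sX k))) sp).
  have := derive_ext_on open_space (fun y sy => laplacian_field k sy) sp H2 H1.
  rewrite mulr0 addr0 => <-; apply: eq_bigr => i _.
  rewrite (dzC _ _ (smooth_dz (xi_ i) (sX k)) sp).
  apply: dz_eq sp => y sy; rewrite (dzC _ _ (sX k) sy).
  by apply: dz_eq sy => z sz; exact: divergence_term.
have : (2 - n%:R) * flat_laplacian mu p = n%:R * flat_laplacian mu p.
  rewrite {1}/flat_laplacian mulr_sumr; under eq_bigr do rewrite E.
  by rewrite sumr_const card_ord mulr_natl.
have n1 : (2 : R) <= n%:R by rewrite ler_nat.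
set L := flat_laplacian mu p => e.
have {}e : (n%:R - 1) * L = 0 by move: e; lra.
by apply/eqP; move/eqP: e; rewrite mulf_eq0 => /orP[/eqP ?|//]; exfalso; lra.
Qed.

Local Notation rad := (radial X).
Local Notation sig := (sigma X mu).

Lemma smooth_radial : sm rad.
Proof.
apply: smooth_sum => [|i _]; first exact: open_space.
by apply: smoothM (smooth_xc i) (sX i); exact: open_space.
Qed.

Lemma smooth_sigma : sm sig.
Proof.
apply: smoothB => //; first exact: open_space.
by apply: smoothM smooth_radial smooth_inv_weight; exact: open_space.
Qed.

(** The form of the definition of [sigma] without division; the derivatives of
    [sigma] are obtained by differentiating this identity. *)
Lemma weight_sigma p : weight (xc p) * sig p = weight (xc p) * mu p - rad p.
Proof. by rewrite /sigma; field; rewrite gt_eqF // weight_gt0. Qed.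

Let Dx p i k := is_derive_xc_dz p i k.
Let Dw p i := is_derive_weight_dz p i.

Lemma sigma_gradient k p : space p ->
  xc p 0 k * sig p + weight (xc p) * d k sig p =
  xc p 0 k * mu p + weight (xc p) * d k mu p - X k p
  - \sum_(i < n) xc p 0 i * d k (X i) p.
Proof.
move=> sp.
have H1 := is_derive_mul (Dw p k) (Dd k smooth_sigma sp).
have H2 := is_derive_sub (is_derive_mul (Dw p k) (Dd k smu sp))
   (is_derive_bigsum (fun i => is_derive_mul (Dx p k i) (Dd k (sX i) sp))).
have := derive_ext_on open_space (fun y _ => weight_sigma y) sp H1 H2.
rewrite big_split /= sum_delta_r.
by lra.
Qed.

Lemma sigma_hessian k p : space p ->
  sig p + 2 * xc p 0 k * d k sig p + weight (xc p) * d k (d k sig) p =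
  mu p + 2 * xc p 0 k * d k mu p + weight (xc p) * d k (d k mu) p - 2 * mu p
  - \sum_(i < n) xc p 0 i * d k (d k (X i)) p.
Proof.
move=> sp.
have H1 := is_derive_add (is_derive_mul (Dx p k k) (Dd k smooth_sigma sp))
  (is_derive_mul (Dw p k) (Dd k (smooth_dz (xi_ k) smooth_sigma) sp)).
have H2 := is_derive_sub (is_derive_sub
  (is_derive_add (is_derive_mul (Dx p k k) (Dd k smu sp))
    (is_derive_mul (Dw p k) (Dd k (smooth_dz (xi_ k) smu) sp)))
  (Dd k (sX k) sp))
  (is_derive_bigsum (fun i => is_derive_mul (Dx p k i) (Dd k (smooth_dz (xi_ k) (sX i)) sp))).
have := derive_ext_on open_space (fun y sy => sigma_gradient k sy) sp H1 H2.
rewrite big_split /= sum_delta_r eqxx (divergence_term k sp) !mulr1.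
move: (d k (d k sig) p) (d k (d k mu) p) (d k sig p) (d k mu p) (sig p) (mu p) (xc p 0 k)
  (weight (xc p)) (\sum_(i < n) _) => *.
by lra.
Qed.

Lemma radial_gradient k p : space p ->
  \sum_(i < n) xc p 0 i * d k (X i) p =
  2 * mu p * xc p 0 k - radial_derivative (X k) p.
Proof.
move=> sp; rewrite -[2 * mu p * _](sum_delta_l (fun i => 2 * mu p * xc p 0 i)).
rewrite -sumrB; apply: eq_bigr => i _.
have := conf i k sp; set a := d i (X k) p; set b := d k (X i) p.
move=> /(congr1 (fun z => xc p 0 i * z)); set e := (i == k)%:R.
by lra.
Qed.

Lemma conformal_quadratic (y : 'I_n -> R) p : space p ->
  \sum_(k < n) y k * \sum_(i < n) y i * d k (X i) p =
  mu p * \sum_(k < n) y k ^+ 2.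
Proof.
move=> sp; set S := LHS.
have : S = \sum_(k < n) y k * \sum_(i < n) y i * d i (X k) p.
  rewrite /S; under eq_bigr do rewrite mulr_sumr.
  rewrite exchange_big /=; apply: eq_bigr => i _; rewrite mulr_sumr.
  by apply: eq_bigr => k _; rewrite mulrCA.
set S' := RHS => SS'.
have : S + S' = \sum_(k < n) y k * (2 * mu p * y k).
  rewrite /S /S' -big_split /=; apply: eq_bigr => k _.
  rewrite -mulrDr -big_split /=; congr (_ * _).
  rewrite -[RHS](sum_delta_l (fun i => 2 * mu p * y i)); apply: eq_bigr => i _.
  by have := conf i k sp; set e := (i == k)%:R; move: (d k (X i) p) (d i (X k) p) => a b H;
     rewrite -mulrDr [a + b]addrC H; ring.
rewrite -SS' => E; have -> : mu p * \sum_(k < n) y k ^+ 2 = 2^-1 * (S + S); last by lra.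
rewrite E !mulr_sumr; apply: eq_bigr => k _.
by field.
Qed.

Lemma radial_radial p : space p ->
  \sum_(k < n) xc p 0 k * \sum_(i < n) xc p 0 i * d k (X i) p =
  mu p * normsq (xc p).
Proof. exact: conformal_quadratic. Qed.

(** The factor of a conformal field of the sphere is an eigenfunction, like
    the restrictions of linear functions of the ambient space. With
    [sigma_gradient] and [sigma_hessian] contracted, this is linear algebra in
    [sigma], [mu], [radial] and their radial derivatives and Laplacians. *)
Lemma laplace_sigma (hn : (2 <= n)%N) p : space p ->
  laplacian sig p = - n%:R * sig p.
Proof.
move=> sp; rewrite /laplacian.
have A : normsq (xc p) * sig p + weight (xc p) * radial_derivative sig p =
  normsq (xc p) * mu p + weight (xc p) * radial_derivative mu p - rad p
  - mu p * normsq (xc p).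
  rewrite -(radial_radial sp) /radial /radial_derivative normsqE /dot !mulr_suml !mulr_sumr.
  rewrite -!big_split -!sumrB /=; apply: eq_bigr => k _.
  have := sigma_gradient k sp => /(congr1 (fun z => xc p 0 k * z)).
  set a := \sum_(i < n) _; lra.
have B : n%:R * sig p + 2 * radial_derivative sig p + weight (xc p) * flat_laplacian sig p
  = n%:R * mu p + 2 * radial_derivative mu p + weight (xc p) * flat_laplacian mu p
    - n%:R * (2 * mu p) - \sum_(i < n) xc p 0 i * flat_laplacian (X i) p.
  have -> : \sum_(i < n) xc p 0 i * flat_laplacian (X i) p
    = \sum_(k < n) \sum_(i < n) xc p 0 i * d k (d k (X i)) p.
    rewrite exchange_big /=; apply: eq_bigr => i _.
    by rewrite /flat_laplacian mulr_sumr.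
  have nE (c : R) : n%:R * c = \sum_(k < n) c by rewrite sumr_const card_ord mulr_natl.
  rewrite (nE (sig p)) (nE (mu p)) (nE (2 * mu p)) /radial_derivative /flat_laplacian !mulr_sumr.
  rewrite -!big_split -!sumrB /=; apply: eq_bigr => k _.
  by have := sigma_hessian k sp; set a := \sum_(i < n) _; rewrite !mulrA.
have C : \sum_(i < n) xc p 0 i * flat_laplacian (X i) p = (2 - n%:R) * radial_derivative mu p.
  rewrite mulr_sumr; apply: eq_bigr => i _; rewrite laplacian_field //.
  by rewrite mulrCA.
rewrite C (laplacian_expansion hn sp) in B.
have W := weight_sigma p.
have N : normsq (xc p) = 2 * weight (xc p) - 1 by rewrite /weight; lra.
rewrite N in A.
move: A B W; move: (weight (xc p)) (sig p) (mu p) (rad p) (radial_derivative sig p)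
  (radial_derivative mu p) (flat_laplacian sig p) n%:R => w s m ra ds dm ls N' A B W.
have -> : w ^+ 2 * ls = w * (w * ls) by ring.
have -> : w * ls = N' * m + 2 * dm - N' * (2 * m) - (2 - N') * dm - N' * s - 2 * ds by lra.
have D : w * ds = w * dm - ra - (2 * w - 1) * s by move: A; lra.
have -> : w * (N' * m + 2 * dm - N' * (2 * m) - (2 - N') * dm - N' * s - 2 * ds) =
  - N' * (w * m) + N' * (w * dm) - N' * (w * s) - 2 * (w * ds) by ring.
have E : ra = w * m - w * s by lra.
by rewrite D E; ring.
Qed.

(** The first order terms of [linear_term] in terms of the gradients of [mu]
    and [sigma]; the one of [mu] cancels against [laplacian_field]. *)
Lemma gradient_sigma k p : space p ->
  2 * weight (xc p) * xc p 0 k * mu p - xc p 0 k * rad p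
     - weight (xc p) * radial_derivative (X k) p + weight (xc p) * X k p
  = weight (xc p) ^+ 2 * (d k mu p - d k sig p).
Proof.
move=> sp; have A := sigma_gradient k sp; rewrite (radial_gradient k sp) in A.
have W := weight_sigma p.
move: A W; move: (weight (xc p)) (sig p) (mu p) (rad p) (d k sig p)
  (d k mu p) (radial_derivative (X k) p) (X k p) (xc p 0 k) => w s m ra ds dm dX Xk x A W.
have -> : w ^+ 2 * (dm - ds) = w * (w * dm - w * ds) by ring.
have -> : w * dm - w * ds = x * s - x * m + Xk + (2 * m * x - dX) by lra.
have -> : w * (x * s - x * m + Xk + (2 * m * x - dX)) =
   x * (w * s) - w * x * m + w * Xk + w * (2 * m * x - dX) by ring.
by rewrite W; ring.
Qed.

End ConformalFields.

(** * Functions along lines *)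

Section Lines.
Context {R : realType} {n : nat}.
Local Notation pt := (pt R n).
Implicit Types (p : pt) (f : pt -> R).

Lemma pointE p : point (xc p) (tc p) (uc p) = p.
Proof.
case: p => z u; rewrite /point /xc /tc /uc /=; congr (_, _).
apply/rowP => l; case: (split_ordP l) => k ->; first by rewrite row_mxEl mxE.
by rewrite row_mxEr mxE (ord1 k).
Qed.

Lemma xc_point (x : 'rV[R]_n) t u : xc (point x t u) = x.
Proof. by rewrite /xc /point /= row_mxKl. Qed.

Lemma tc_point (x : 'rV[R]_n) t u : tc (point x t u) = t.
Proof. by rewrite /tc /point /= row_mxEr mxE. Qed.

Lemma derive_components f p (w : pt) : differentiable f p ->
  'D_w f p = \sum_(i < n) w.1 0 (xi_ i) * dz (xi_ i) f p
             + w.1 0 (tidx n) * dz (tidx n) f p + w.2 * du f p.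
Proof.
move=> df.
have Ew : w = \sum_l w.1 0 l *: ((delta_mx 0 l, 0) : pt) + w.2 *: ((0, 1) : pt).
  case: w => z u /=.
  have E : \sum_l z 0 l *: ((delta_mx 0 l, 0) : pt) = (z, 0).
    transitivity ((\sum_l z 0 l *: delta_mx 0 l, 0) : pt); last by rewrite -row_sum_delta.
    elim/big_rec2: _ => [//|l y1 y2 _ ->].
    by congr (_, _); rewrite /= ?scaler0 ?addr0.
  by rewrite E; congr (_, _); rewrite /= ?scaler0 ?addr0 // add0r [_%:A]mulr1.
have dE w' : 'd f p w' = 'D_w' f p by rewrite deriveE.
rewrite {1}Ew (deriveE _ df) linearD /= linear_sum /= linearZ /= dE -duE.
congr (_ + _).
  rewrite -[RHS](sum_indices (fun l => w.1 0 l * dz l f p)); apply: eq_bigr => l _.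
  by rewrite linearZ /= dE -dzE.
Qed.

Lemma is_derive_segment f (w a : pt) (s : R) : sm f -> space (s *: w + a) ->
  is_derive s 1 (fun s : R => f (s *: w + a))
    (\sum_(i < n) w.1 0 (xi_ i) * dz (xi_ i) f (s *: w + a)
             + w.1 0 (tidx n) * dz (tidx n) f (s *: w + a) + w.2 * du f (s *: w + a)).
Proof.
move=> sf sp; have df := smooth_differentiable sf sp.
by rewrite -derive_components //; exact: is_derive_line.
Qed.

(** [f] is constant on the segment from [p] to the point [(0, t, 1)], which
    stays in [u > 0]. *)
Lemma constant_in_xu f p : sm f ->
  (forall p, space p -> du f p = 0) ->
  (forall i p, space p -> dz (xi_ i) f p = 0) -> space p ->
  f p = f (point 0 (tc p) 1).
Proof.
move=> sf fu fx sp; pose w : pt := (row_mx (xc p) 0, uc p - 1).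
have Ep : p = w + point 0 (tc p) 1.
  rewrite -{1}(pointE p) /w /point; congr (_, _); last by rewrite /= subrK.
  by rewrite add_row_mx addr0 add0r.
have spl s : 0 <= s <= 1 -> space (s *: w + point 0 (tc p) 1).
  case/andP=> s0 s1; rewrite /Defs.space /=.
  have : 0 < uc p by [].
  move: (uc p) => u u0; have -> : s *: (u - 1) + 1 = s * u + (1 - s) by rewrite /GRing.scale /=; ring.
  case: (ltrP 0 s) => s0'; last by rewrite (_ : s = 0) ?mul0r ?add0r ?subr0 //; lra.
  by rewrite ltr_pwDl ?mulr_gt0 // subr_ge0.
rewrite {1}Ep; apply: constant_on_line.
- by move=> s s01; apply: smooth_differentiable sf _; apply: spl.
- move=> s s01; have sq := spl _ s01.
  rewrite derive_components; last exact: smooth_differentiable sf sq.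
  rewrite fu // mulr0 addr0 big1 ?add0r => [|i _]; last by rewrite fx // mulr0.
  by rewrite row_mxEr mxE mul0r.
Qed.

Lemma is_derive_t f (x : 'rV[R]_n) (t u : R) : sm f -> 0 < u ->
  is_derive t 1 (fun t : R => f (point x t u)) (dz (tidx n) f (point x t u)).
Proof.
move=> sf u0; pose w : pt := (row_mx 0 (const_mx 1), 0).
have E s : s *: w + point x 0 u = point x s u.
  rewrite /w /point; congr (_, _); last by rewrite /= scaler0 add0r.
  rewrite /= scale_row_mx add_row_mx scaler0 add0r; congr row_mx.
  by apply/rowP => i; rewrite !mxE mulr1 addr0.
have := @is_derive_segment f w (point x 0 u) t sf.
rewrite E => /(_ u0); under eq_fun do rewrite E; rewrite mul0r addr0 row_mxEr mxE mul1r.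
by rewrite big1 ?add0r // => i _; rewrite row_mxEl mxE mul0r.
Qed.

Lemma is_derive_ray f (x : 'rV[R]_n) (t u s : R) : sm f -> 0 < u ->
  is_derive s 1 (fun s : R => f (point (s *: x) t u))
    (\sum_(i < n) x 0 i * dz (xi_ i) f (point (s *: x) t u)).
Proof.
move=> sf u0; pose w : pt := (row_mx x 0, 0).
have E s' : s' *: w + point 0 t u = point (s' *: x) t u.
  rewrite /w /point; congr (_, _); last by rewrite /= scaler0 add0r.
  by rewrite /= scale_row_mx add_row_mx addr0 scaler0 add0r.
have := @is_derive_segment f w (point 0 t u) s sf.
rewrite E => /(_ u0); under eq_fun do rewrite E; rewrite mul0r addr0 row_mxEr mxE mul0r addr0.
by under eq_bigr do rewrite row_mxEl.
Qed.

End Lines.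

(** * Killing fields that fix the pole *)

Section KillingFields.
Context {R : realType} {n : nat}.
Local Notation pt := (pt R n).
Local Notation d i := (dz (xi_ i)).
Variables (X : 'I_n -> pt -> R) (mu : pt -> R).
Implicit Types (p : pt).

Hypothesis sX : forall i, sm (X i).
Hypothesis conf : forall i k p, space p ->
  d i (X k) p + d k (X i) p = 2 * mu p * (i == k)%:R.
Hypothesis Xu : forall i p, space p -> du (X i) p = 0.
Hypothesis sig0 : forall p, space p -> sigma X mu p = 0.
Hypothesis pole : forall t u : R, 0 < u -> forall e : R, 0 < e ->
  exists K : R, forall x : 'rV[R]_n, K < normsq x ->
    4 * (\sum_(i < n) X i (point x t u) ^+ 2) / (normsq x + 1) ^+ 2 < e.

Lemma normsqZ s (x : 'rV[R]_n) : normsq (s *: x) = s ^+ 2 * normsq x.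
Proof. by rewrite /normsq mulr_sumr; apply: eq_bigr => i _; rewrite mxE exprMn. Qed.

(** The rays [s |-> s *: x] are the geodesics through the two poles. Up to the
    length of [x], the left hand side is the [g]-product of the Killing field
    with their unit velocity, which is constant along a geodesic. *)
Lemma clairaut (x : 'rV[R]_n) (t u s : R) : 0 < u ->
  (\sum_(i < n) x 0 i * X i (point (s *: x) t u)) / weight (s *: x)
  = (\sum_(i < n) x 0 i * X i (point 0 t u)) / weight (0 : 'rV[R]_n).
Proof.
move=> u0.
have X' i s' := is_derive_ray x t s' (sX i) u0.
have h' s' := is_derive_ray x t s' (@smooth_inv_weight R n) u0.
have w' s' := is_derive_ray x t s' (@smooth_weight R n) u0.
pose g s' := (\sum_(i < n) x 0 i * X i (point (s' *: x) t u)) *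
  (weight (xc (point (s' *: x) t u)))^-1.
suff H s' : is_derive s' (1 : R) g 0.
  have := @is_derive_0_is_cst R g s 0 H; rewrite /g !xc_point scale0r.
  by [].
have Hg := is_derive_mul (is_derive_bigsum (fun i => is_derive_mul (is_derive_const (x 0 i) s' (1 : R)) (X' i s'))) (h' s').
apply: is_derive_eq Hg _.
set p := point (s' *: x) t u.
have sp : space p by [].
have w0 : weight (xc p) != 0 by rewrite gt_eqF // weight_gt0.
have xp k : xc p 0 k = s' * x 0 k by rewrite /p xc_point mxE.
set G := \sum_(i < n) x 0 i * X i p.
set hp := \sum_(i < n) _.
have -> : \sum_(i < n)
     (x 0 i * (\sum_(i0 < n) x 0 i0 * d i0 (X i) p) + X i p * 0)
   = mu p * normsq x.
  rewrite -(conformal_quadratic conf (fun i => x 0 i) sp).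
  rewrite (eq_bigr (fun i => \sum_(k < n) x 0 i * (x 0 k * d k (X i) p))); last first.
    by move=> i _; rewrite mulr0 addr0 mulr_sumr.
  rewrite exchange_big /=; apply: eq_bigr => k _; rewrite mulr_sumr.
  by apply: eq_bigr => i _; rewrite mulrCA.
have Eh : weight (xc p) * hp = - (s' * normsq x * (weight (xc p))^-1).
  have w1 := is_derive_mul (w' s') (h' s').
  have c1 := is_derive_const (1 : R) s' (1 : R).
  have := derive_ext_on openT (fun (y : R) _ => mulfV (lt0r_neq0 (weight_gt0 (xc (point (y *: x) t u))))) I w1 c1.
  rewrite -/p -/hp => H.
  have E : \sum_(i < n) x 0 i * d i (fun p : pt => weight (xc p)) p = s' * normsq x.
    rewrite /normsq mulr_sumr; apply: eq_bigr => i _.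
    have -> : d i (fun p : pt => weight (xc p)) p = xc p 0 i.
      by rewrite dzE; apply: derive_val; exact: is_derive_weight_dz.
    by rewrite xp; ring.
  by move: H; rewrite E; move: (weight _ * hp) (_^-1) => *; lra.
have mup : weight (xc p) * mu p = s' * G.
  have W := weight_sigma X mu p; rewrite (sig0 sp) mulr0 in W.
  have -> : s' * G = radial X p.
    by rewrite /G /radial mulr_sumr; apply: eq_bigr => i _; rewrite xp mulrA.
  by move/esym/eqP: W; rewrite subr_eq0 => /eqP.
apply: (mulfI w0); rewrite mulr0 mulrDr.
have -> : weight (xc p) * (G * hp) = G * (weight (xc p) * hp) by ring.
have -> : weight (xc p) * ((weight (xc p))^-1 * (mu p * normsq x)) =
  (weight (xc p))^-1 * ((weight (xc p) * mu p) * normsq x) by ring.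
by rewrite Eh mup; ring.
Qed.

(** The constant of [clairaut] is at most a multiple of the [g]-norm of the
    field, which tends to [0] as the ray approaches the north pole. *)
Lemma radial_axis0 (x : 'rV[R]_n) (t u : R) : 0 < u ->
  \sum_(i < n) x 0 i * X i (point 0 t u) = 0.
Proof.
move=> u0; set c := LHS; have [//|c0] := eqVneq c 0; exfalso.
pose N := normsq x; have N0 : 0 < N.
  rewrite lt_neqAle normsq_ge0 andbT eq_sym; apply/eqP => N0; case/eqP: c0.
  have x0 i : x 0 i = 0.
    apply/eqP; rewrite -sqrf_eq0; move/eqP: N0; rewrite psumr_eq0 => [|j _]; last exact: sqr_ge0.
    by move/allP => /(_ i); rewrite mem_index_enum => /(_ isT).
  by rewrite /c big1 // => i _; rewrite x0 mul0r.
pose M := \sum_(i < n) `|x 0 i|.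
have M0 : 0 <= M by apply: sumr_ge0.
have w0 : 0 < weight (0 : 'rV[R]_n) := weight_gt0 _.
pose dl := `|c / weight (0 : 'rV[R]_n)| / (M + 1).
have dl0 : 0 < dl by rewrite divr_gt0 ?ltr_wpDl // normr_gt0 mulf_neq0 // invr_neq0 // gt_eqF.
have [K HK] := pole t u0 (exprn_gt0 2 dl0).
(* chosen so that [s *: x] has squared norm above the threshold [K] *)
pose s := 1 + `|K| / N.
have KN0 : 0 <= `|K| / N by rewrite divr_ge0 // ltW.
have sK : K < normsq (s *: x).
  rewrite normsqZ -/N; apply: (@lt_le_trans _ _ (s * N)).
    rewrite /s mulrDl mul1r divfK ?gt_eqF //.
    by apply: (le_lt_trans (ler_norm K)); rewrite ltrDr.
  by rewrite ler_wpM2r ?(ltW N0) // expr2 ler_peMl ?lerDl // addr_ge0.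
have := HK _ sK; set S := \sum_(i < n) _ => HS.
have E := clairaut x t s u0; rewrite -/c in E.
have ws : 0 < weight (s *: x) := weight_gt0 _.
have bound i : `|X i (point (s *: x) t u) / weight (s *: x)| <= dl.
  rewrite -(@ler_pXn2r _ 2) ?nnegrE ?(ltW dl0) // -normrX ger0_norm ?sqr_ge0 //.
  apply: ltW; apply: le_lt_trans HS.
  have -> : (normsq (s *: x) + 1) ^+ 2 = 4 * weight (s *: x) ^+ 2 by rewrite /weight; field.
  have -> : 4 * S / (4 * weight (s *: x) ^+ 2) = S / weight (s *: x) ^+ 2.
    by field; rewrite gt_eqF.
  rewrite expr_div_n ler_wpM2r ?invr_ge0 ?sqr_ge0 //.
  rewrite /S (bigD1 i) //= lerDl; apply: sumr_ge0 => j _; exact: sqr_ge0.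
have : `|c / weight (0 : 'rV[R]_n)| <= M * dl.
  rewrite -E mulr_suml; apply: (le_trans (ler_norm_sum _ _ _)).
  rewrite /M mulr_suml; apply: ler_sum => i _.
  by rewrite -mulrA normrM ler_wpM2l.
apply/negP; rewrite -ltNge.
have -> : `|c / weight (0 : 'rV[R]_n)| = (M + 1) * dl.
  by rewrite /dl [RHS]mulrC divfK // gt_eqF // ltr_wpDl.
by rewrite ltr_pM2r // ltrDl.
Qed.

Lemma radial_zero p : space p -> radial X p = 0.
Proof.
move=> sp; have u0 : 0 < uc p by [].
have := clairaut (xc p) (tc p) 1 u0; rewrite (radial_axis0 _ _ u0) mul0r scale1r pointE.
move/eqP; rewrite mulf_eq0 invr_eq0 (gt_eqF (weight_gt0 _)) orbF => /eqP //.
Qed.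

Lemma expansion_zero p : space p -> mu p = 0.
Proof.
move=> sp; have := weight_sigma X mu p; rewrite sig0 // mulr0 radial_zero // subr0.
by move/esym/eqP; rewrite mulf_eq0 (gt_eqF (weight_gt0 _)) => /eqP.
Qed.

Lemma killing_antisym i k p : space p -> d i (X k) p = - d k (X i) p.
Proof.
by move=> sp; have := conf i k sp; rewrite expansion_zero // mulr0 mul0r => /eqP; rewrite addr_eq0 => /eqP.
Qed.

Lemma killing_affine i k l p : space p -> d l (d k (X i)) p = 0.
Proof.
move=> sp.
(* the second derivatives are symmetric in l, k and antisymmetric in k, i *)
have A a b c : d a (d b (X c)) p = - d a (d c (X b)) p.
  have H1 := is_derive_dz (xi_ a) (smooth_dz (xi_ b) (sX c)) sp.
  have H2 := is_derive_mul (is_derive_const (-1) p ((delta_mx 0 (xi_ a), 0) : pt))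
     (is_derive_dz (xi_ a) (smooth_dz (xi_ c) (sX b)) sp).
  have := derive_ext_on open_space _ sp H1 H2; rewrite mulr0 addr0 mulN1r; apply.
  by move=> y sy; rewrite mulN1r; exact: killing_antisym.
have C a b c : d a (d b (X c)) p = d b (d a (X c)) p by apply: dzC.
have : d l (d k (X i)) p = - d l (d k (X i)) p.
  by rewrite {1}(A l k i) (C l i k) (A i l k) opprK (C i k l) (A k i l) (C k l i).
by move=> H; lra.
Qed.

Lemma killing_gradient i k p : space p -> d k (X i) p = d k (X i) (point 0 (tc p) 1).
Proof.
move=> sp; apply: constant_in_xu => //; first exact: smooth_dz.
- move=> p' sp'; rewrite du_dzC //; apply: dz_const0 sp'; exact: Xu.
- by move=> l p' sp'; exact: killing_affine.
Qed.

(** The derivative along [i] of [radial X p = 0] expresses [X i] by its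
    gradient, which is constant in [x] and [u]. *)
Lemma killing_linear i p : space p ->
  X i p = \sum_(k < n) xc p 0 k * d k (X i) (point 0 (tc p) 1).
Proof.
move=> sp.
have H1 := is_derive_bigsum (fun k => is_derive_mul (is_derive_xc_dz p i k) (is_derive_dz (xi_ i) (sX k) sp)).
have := derive_ext_on open_space (fun y sy => radial_zero sy) sp H1 (is_derive_const 0 p _).
rewrite big_split /= sum_delta_r => E.
have -> : \sum_(k < n) xc p 0 k * d k (X i) (point 0 (tc p) 1)
  = - \sum_(k < n) xc p 0 k * d i (X k) p.
  rewrite -sumrN; apply: eq_bigr => k _; rewrite -killing_gradient //.
  by rewrite (killing_antisym k i sp) mulrN.
by lra.
Qed.

End KillingFields.

(** * Independence of powers *)

Section Powers.
Context {R : realType}.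

Lemma powR2_inj (a b : R) : (2 : R) `^ a = 2 `^ b -> a = b.
Proof.
move/(congr1 (@ln R)); rewrite !ln_powR; apply: mulIf.
by rewrite gt_eqF // ln_gt0 // ltr1n.
Qed.

Lemma powR_pred (u a : R) : 0 < u -> u `^ a = u `^ (a - 1) * u.
Proof.
by move=> u0; rewrite -[Y in _ = _ * Y]powRr1 ?(ltW u0) // -powRD ?subrK // (gt_eqF u0) implybT.
Qed.

(** Subtracting [2 `^ a] times the relation at [u] from the relation at [2 * u]
    removes the exponent [a] and multiplies every other coefficient by a nonzero
    number. *)
Lemma powR_independent (s : seq (R * R)) : uniq [seq x.1 | x <- s] ->
  (forall u, 0 < u -> \sum_(x <- s) x.2 * u `^ x.1 = 0) ->
  all (fun x => x.2 == 0) s.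
Proof.
have [m] := ubnP (size s); elim: m s => // m IH [//|[a c] s] /= sm /andP[as_ us] H.
have s0 : all (fun x => x.2 == 0) s.
  pose f (x : R * R) := (x.1, x.2 * (2 `^ x.1 - 2 `^ a)).
  have : all (fun x => x.2 == 0) (map f s).
    apply: IH; rewrite ?size_map -?map_comp // => u u0; rewrite big_map.
    have := H (2 * u); rewrite mulr_gt0 ?ltr0n // => /(_ isT) H2.
    have := H u u0; move: H2; rewrite !big_cons /= powRM ?(ltW u0) ?ler0n // => H2 H1.
    transitivity ((c * (2 `^ a * u `^ a) + \sum_(j <- s) j.2 * (2 * u) `^ j.1) -
       2 `^ a * (c * u `^ a + \sum_(j <- s) j.2 * u `^ j.1)); last by rewrite H1 H2 mulr0 subrr.
    rewrite mulrDr opprD addrACA mulr_sumr -sumrB.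
    have -> : c * (2 `^ a * u `^ a) - 2 `^ a * (c * u `^ a) = 0 by ring.
    rewrite add0r; apply: eq_bigr => j _; rewrite powRM ?(ltW u0) ?ler0n //=.
    by ring.
  rewrite all_map => /allP z; apply/allP => x xs; have /= := z x xs.
  rewrite mulf_eq0 => /orP[//|]; rewrite subr_eq0 => /eqP/powR2_inj xa.
  by case/negP: as_; rewrite -xa; apply/mapP; exists x.
rewrite s0 andbT; have := H 1 ltr01; rewrite big_cons /= powR1 mulr1 big_seq big1 ?addr0 => [/eqP //|y ys].
by rewrite (eqP (allP s0 y ys)) mul0r.
Qed.

End Powers.

Section Reduction.
Context {R : realType} {n : nat}.
Local Notation pt := (pt R n).
Implicit Types (p : pt) (f : pt -> R).

(** A coefficient that is free of [u] may be evaluated at every height, so that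
    an equation at the points [(p.1, u)] becomes a relation between powers of
    [u]. *)
Lemma constant_in_u f p u : sm f -> (forall p, space p -> du f p = 0) ->
  space p -> 0 < u -> f (p.1, u) = f p.
Proof.
move=> sf fu sp u0; pose w : pt := (0, u - p.2).
have E : (p.1, u) = w + p.
  by case: p @w {sp} => z u' /=; congr (_, _); rewrite /= ?add0r ?subrK.
have spl s : 0 <= s <= 1 -> space (s *: w + p).
  case/andP=> s0 s1; rewrite /Defs.space /=; have : 0 < p.2 by [].
  move: (p.2) => u' u'0; have -> : s *: (u - u') + u' = s * u + (1 - s) * u' by rewrite /GRing.scale /=; ring.
  case: (ltrP 0 s) => s0'; last by rewrite (_ : s = 0) ?mul0r ?add0r ?subr0 ?mul1r //; lra.
  by rewrite ltr_pwDl ?mulr_gt0 // mulr_ge0 ?subr_ge0 // ltW.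
rewrite E; apply: constant_on_line.
- by move=> s s01; apply: smooth_differentiable sf _; apply: spl.
- move=> s s01; have sq := spl _ s01.
  rewrite derive_components; last exact: smooth_differentiable sf sq.
  rewrite fu // mulr0 addr0 big1 ?add0r => [|i _]; rewrite mxE mul0r //.
Qed.

Lemma dz_no_u f l : sm f -> (forall p, space p -> du f p = 0) ->
  forall p, space p -> du (dz l f) p = 0.
Proof. by move=> sf fu p sp; rewrite (du_dzC _ sf sp); exact: dz_const0 fu sp. Qed.

Lemma dz_constant_in_u f l p u : sm f -> (forall p, space p -> du f p = 0) ->
  space p -> 0 < u -> dz l f (p.1, u) = dz l f p.
Proof.
by move=> sf fu; exact: constant_in_u (smooth_dz l sf) (dz_no_u l sf fu).
Qed.

Lemma is_derive_xc_du p k :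
  is_derive p ((0, 1) : pt) (fun p : pt => xc p 0 k) 0.
Proof. by apply: is_derive_eq (is_derive_xc _ p k) _; rewrite xcE /= mxE. Qed.

Lemma is_derive_weight_du p :
  is_derive p ((0, 1) : pt) (fun p : pt => weight (xc p)) 0.
Proof.
apply: is_derive_eq (is_derive_weight _ p) _; rewrite /dot big1 // => i _.
by have -> : xc ((0, 1) : pt) 0 i = 0; [rewrite xcE /= mxE|rewrite mulr0].
Qed.

Lemma is_derive_u_dz p l :
  is_derive p ((delta_mx 0 l, 0) : pt) (fun p : pt => p.2) 0.
Proof. exact: derive_linear. Qed.

Lemma is_derive_u_du p : is_derive p ((0, 1) : pt) (fun p : pt => p.2) 1.
Proof. exact: derive_linear. Qed.

Lemma du_sigma (X : 'I_n -> pt -> R) mu p : (forall i, sm (X i)) -> sm mu ->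
  (forall i p, space p -> du (X i) p = 0) ->
  (forall p, space p -> du mu p = 0) -> space p -> du (sigma X mu) p = 0.
Proof.
move=> sX smu Xu muu sp.
have ss := smooth_sigma sX smu.
have H1 := is_derive_mul (is_derive_weight_du p) (is_derive_du ss sp).
have H2 := is_derive_sub (is_derive_mul (is_derive_weight_du p) (is_derive_du smu sp))
  (is_derive_bigsum (fun i => is_derive_mul (is_derive_xc_du p i) (is_derive_du (sX i) sp))).
have := derive_ext_on open_space (fun y _ => weight_sigma X mu y) sp H1 H2.
rewrite muu // !mulr0 !addr0 big1 ?subr0 => [/eqP|i _]; last by rewrite Xu // !mulr0 addr0.
by rewrite mulf_eq0 gt_eqF ?weight_gt0 //= => /eqP.
Qed.

End Reduction.

Section Exponential.
Context {R : realType}.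

Lemma is_derive_expR_linear (c s : R) :
  is_derive s (1 : R) (fun s => expR (c * s)) (c * expR (c * s)).
Proof.
have H : is_derive s (1 : R) (fun s => c * s) c.
  by apply: is_derive_eq (is_derive_mul (is_derive_const c s (1 : R)) (is_derive_id s (1 : R))) _;
     rewrite mulr0 addr0 mulr1.
have dH : differentiable (fun s => c * s) s by apply/derivable1_diffP.
have [de e] := derive_real_comp (1 : R) dH (is_derive_expR _).
split; first by apply/derivable1_diffP.
by rewrite e derive_val mulrC.
Qed.

End Exponential.

(** * Solving the determining equations *)

Section Solution.
Context {R : realType} {n : nat}.
Local Notation pt := (pt R n).
Variables (q r : R) (v : pt -> pt).
Implicit Types (p : pt).

Hypothesis hn : (2 <= n)%N.
Hypothesis sv : smooth_on space v.
Hypothesis sym : is_infinitesimal_symmetry (heat q r) v.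

Local Notation X i := (zcoef v (xi_ i)).
Local Notation eta := (zcoef v (tidx n)).
Local Notation phi := (ucoef v).
Local Notation d i := (dz (xi_ i)).
Local Notation dt := (dz (tidx n)).
Local Notation mu := (expansion v hn).
Local Notation sg := (sigma (fun i => X i) mu).

Let sX i : sm (X i) := smooth_zcoef sv (xi_ i).
Let seta : sm eta := smooth_zcoef sv (tidx n).
Let sphi : sm phi := smooth_ucoef sv.
Let smu : sm mu := smooth_dz _ (sX (index0 hn)).
Let conf i k p (sp : space p) := conformal hn sym i k sp.
Let ssg : sm sg := smooth_sigma sX smu.
Let Xu i p (sp : space p) : du (X i) p = 0 := xi_u hn sym i sp.
Let etax i p (sp : space p) : d i eta p = 0 := eta_x hn sym i sp.

Lemma expansion_u p : space p -> du mu p = 0.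
Proof.
move=> sp; rewrite /expansion du_dzC //.
by apply: dz_const0 sp => y sy; exact: Xu.
Qed.

Lemma sigma_u p : space p -> du sg p = 0.
Proof. by move=> sp; apply: du_sigma sp => //; exact: expansion_u. Qed.

Lemma eta_t_x i p : space p -> d i (dt eta) p = 0.
Proof. by move=> sp; rewrite dzC //; apply: dz_const0 sp => y sy; exact: etax. Qed.

Lemma eta_t_u p : space p -> du (dt eta) p = 0.
Proof.
move=> sp; rewrite du_dzC //; apply: dz_const0 sp => y sy.
exact: (eta_u hn sym).
Qed.

Lemma laplacian_sigma p : space p -> laplacian sg p = - n%:R * sg p.
Proof. by move=> sp; apply: laplace_sigma. Qed.

(** No nonzero constant is an eigenfunction for the eigenvalue [- n]. *)
Lemma sigma_zero_of_gradient p :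
  (forall p, space p -> forall i, d i sg p = 0) -> space p -> sg p = 0.
Proof.
move=> H sp; have := laplacian_sigma sp.
rewrite /laplacian /flat_laplacian /radial_derivative !big1 => [|i _|i _]; last 2 first.
- by rewrite H // mulr0.
- by apply: dz_const0 sp => y sy; exact: H.
rewrite !mulr0 subrr => /esym/eqP; rewrite mulf_eq0 oppr_eq0 pnatr_eq0.
have /negbTE -> /= : n != 0%N by rewrite -lt0n (leq_trans _ hn).
by move/eqP.
Qed.

(** By [phi_sigma], [growth] is [r] times the relative rate [phi / u] at which
    the field moves [u]. *)
Definition growth p : R := dt eta p - 2 * sg p.
Local Notation A := growth.

Lemma smooth_growth : sm A.
Proof.
apply: smoothB; [exact: open_space|exact: smooth_dz|].
by apply: smoothM => //; [exact: open_space|apply: smooth_cst; exact: open_space].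
Qed.

Lemma dz_growth l p : space p -> dz l A p = dz l (dt eta) p - 2 * dz l sg p.
Proof.
move=> sp; rewrite dzE; apply: derive_val.
apply: is_derive_eq (is_derive_sub (is_derive_dz l (smooth_dz _ seta) sp)
  (is_derive_mul (is_derive_const 2 _ _) (is_derive_dz l ssg sp))) _.
by rewrite mulr0 addr0.
Qed.

Lemma growth_u p : space p -> du A p = 0.
Proof.
move=> sp; rewrite duE; apply: derive_val.
apply: is_derive_eq (is_derive_sub (is_derive_du (smooth_dz _ seta) sp)
  (is_derive_mul (is_derive_const 2 _ _) (is_derive_du ssg sp))) _.
by rewrite eta_t_u // sigma_u // !mulr0 addr0 subr0.
Qed.

Lemma growthE p : space p -> r * phi p = p.2 * A p.
Proof. exact: (phi_sigma hn sym). Qed.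

Lemma dz_phi l p : space p -> r * dz l phi p = p.2 * dz l A p.
Proof.
move=> sp.
have H1 := is_derive_mul (is_derive_const r p _) (is_derive_dz l sphi sp).
have H2 := is_derive_mul (is_derive_u_dz p l) (is_derive_dz l smooth_growth sp).
by have := derive_ext_on open_space growthE sp H1 H2; rewrite !mulr0 !addr0.
Qed.

Lemma dzz_phi l p : space p -> r * dz l (dz l phi) p = p.2 * dz l (dz l A) p.
Proof.
move=> sp.
have H1 := is_derive_mul (is_derive_const r p _) (is_derive_dz l (smooth_dz l sphi) sp).
have H2 := is_derive_mul (is_derive_u_dz p l) (is_derive_dz l (smooth_dz l smooth_growth) sp).
have F y : space y -> r * dz l phi y = y.2 * dz l A y by exact: dz_phi.
have := derive_ext_on open_space F sp H1 H2.
move: (dz l (dz l phi) p) (dz l (dz l A) p) (dz l phi p) (dz l A p) => a b c e H.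
by rewrite mulr0 mulr0 addr0 addr0 in H.
Qed.

Lemma du_phi p : space p -> r * du phi p = A p.
Proof.
move=> sp.
have H1 := is_derive_mul (is_derive_const r p _) (is_derive_du sphi sp).
have H2 := is_derive_mul (is_derive_u_du p) (is_derive_du smooth_growth sp).
have := derive_ext_on open_space growthE sp H1 H2.
by rewrite growth_u // !mulr0 addr0 add0r mulr1.
Qed.

Lemma laplacian_phi p : space p -> r * laplacian phi p = p.2 * laplacian A p.
Proof.
move=> sp.
have E1 : r * flat_laplacian phi p = p.2 * flat_laplacian A p.
  by rewrite !mulr_sumr; apply: eq_bigr => i _; rewrite dzz_phi.
have E2 : r * radial_derivative phi p = p.2 * radial_derivative A p.
  rewrite !mulr_sumr; apply: eq_bigr => i _.
  by rewrite mulrCA (dz_phi _ sp) [RHS]mulrCA.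
rewrite /laplacian; move: E1 E2; move: (flat_laplacian phi p) (radial_derivative phi p)
  (flat_laplacian A p) (radial_derivative A p) => a b c e E1 E2.
have -> : forall w m, r * (w ^+ 2 * a - m * (w * b)) = w ^+ 2 * (r * a) - m * (w * (r * b)) by move=> *; ring.
by rewrite E1 E2; ring.
Qed.

Lemma laplacian_growth p : space p -> laplacian A p = 2 * n%:R * sg p.
Proof.
move=> sp.
have D1 i y : space y -> d i A y = - 2 * d i sg y.
  by move=> sy; rewrite dz_growth // eta_t_x // add0r mulNr.
have D2 i : d i (d i A) p = - 2 * d i (d i sg) p.
  have H1 := is_derive_dz (xi_ i) (smooth_dz (xi_ i) smooth_growth) sp.
  have H2 := is_derive_mul (is_derive_const (- 2) p _) (is_derive_dz (xi_ i) (smooth_dz (xi_ i) ssg) sp).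
  by rewrite (derive_ext_on open_space (fun y sy => D1 i y sy) sp H1 H2) mulr0 addr0.
have := laplacian_sigma sp; rewrite /laplacian.
have -> : flat_laplacian A p = - 2 * flat_laplacian sg p.
  by rewrite mulr_sumr; apply: eq_bigr => i _.
have -> : radial_derivative A p = - 2 * radial_derivative sg p.
  by rewrite mulr_sumr; apply: eq_bigr => i _; rewrite D1 // mulrCA.
move: (flat_laplacian sg p) (radial_derivative sg p) (sg p) => a b c H.
have -> : forall w m, w ^+ 2 * (- 2 * a) - m * (w * (- 2 * b)) = - 2 * (w ^+ 2 * a - m * (w * b)) by move=> *; ring.
by rewrite H; ring.
Qed.

(** [r] times the constant term, at the height [u]: by [growthE] everything is
    expressed by [growth] and [sigma], and [laplace_sigma] removes the
    Laplacian. *)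
Lemma growth_equation p u : space p -> 0 < u ->
  dt A p * u `^ (r + 1) - 2 * n%:R * sg p * u `^ 1
  + ((1 - q) * A p - 2 * r * sg p) * u `^ q = 0.
Proof.
move=> sp u0; pose p' : pt := (p.1, u); have sp' : space p' by [].
have dtAu y : space y -> du (dt A) y = 0.
  move=> sy; rewrite du_dzC //; last exact: smooth_growth.
  by apply: dz_const0 sy => z sz; exact: growth_u.
have E1 : dt A p' = dt A p by apply: constant_in_u => //; apply: smooth_dz; exact: smooth_growth.
have E2 : A p' = A p by apply: constant_in_u => //; [exact: smooth_growth|exact: growth_u].
have E3 : sg p' = sg p by apply: constant_in_u => //; exact: sigma_u.
have := constant_term hn sym sp' => H.
have {}H : p'.2 `^ r * (r * dt phi p') - r * laplacian phi p'
  + p'.2 `^ q * (r * du phi p' - 2 * r * sg p') - q * p'.2 `^ (q - 1) * (r * phi p') = 0.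
  by rewrite -[RHS](mulr0 r) -H; ring.
move: H; rewrite dz_phi // laplacian_phi // du_phi // growthE // laplacian_growth //.
rewrite E1 E2 E3 /= powRr1 ?(ltW u0) // => H; rewrite -[RHS]H.
rewrite (powR_pred (r + 1) u0) addrK (powR_pred q u0).
by ring.
Qed.

(** In [linear_term] the gradients of [mu] cancel by [laplacian_field] and
    [gradient_sigma]. *)
Lemma gradient_equation k p : space p ->
  p.2 `^ r * dt (X k) p + 2 * weight (xc p) ^+ 2 * d k (du phi) p
  = (2 - n%:R) * weight (xc p) ^+ 2 * d k sg p.
Proof.
move=> sp; rewrite (linear_term hn sym k sp).
rewrite (laplacian_field sX smu (fun i k p sp => conf i k sp) k sp).
rewrite (gradient_sigma sX smu (fun i k p sp => conf i k sp) k sp).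
by ring.
Qed.

Let sA : sm A := smooth_growth.

Hypothesis fixed : fixes_north_pole v.

Let axis (t : R) : space (point (0 : 'rV_n) t 1).
Proof. exact: ltr01. Qed.

Let npos : (n%:R : R) != 0.
Proof. by rewrite pnatr_eq0 -lt0n (leq_trans _ hn). Qed.

Lemma pole_condition (t u : R) : 0 < u -> forall e : R, 0 < e ->
  exists K : R, forall x : 'rV[R]_n, K < normsq x ->
    4 * (\sum_(i < n) X i (point x t u) ^+ 2) / (normsq x + 1) ^+ 2 < e.
Proof.
move=> u0 e e0; have [K HK] := fixed t u0 e0; exists K => x /HK.
by rewrite {1}/normsq; under eq_bigr do rewrite xcE.
Qed.

Section Killing.
Hypothesis sg0 : forall p, space p -> sg p = 0.
Hypothesis X_t : forall k p, space p -> dt (X k) p = 0.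

(** The gradient of a Killing field that fixes the pole is constant, so any
    point may be taken; [X_t] makes it independent of time as well. *)
Definition rotation_matrix : 'M[R]_n := \matrix_(k, i) d k (X i) (point 0 0 1).

Lemma rotation_matrix_antisym : rotation_matrix^T = - rotation_matrix.
Proof.
apply/matrixP => i k; rewrite !mxE.
by apply: (killing_antisym sX conf sg0 pole_condition k i); exact: ltr01.
Qed.

Lemma rotation_field p : space p -> xc (v p) = xc p *m rotation_matrix.
Proof.
move=> sp; apply/rowP => i; rewrite xcE -/(zcoef v (xi_ i) p).
rewrite (killing_linear sX conf Xu sg0 pole_condition i sp) mxE.
apply: eq_bigr => k _; congr (_ * _); rewrite [RHS]mxE.
apply: (@is_derive_0_is_cst R (fun t => d k (X i) (point 0 t 1))) => t.
apply: is_derive_eq (is_derive_t 0 t (smooth_dz (xi_ k) (sX i)) ltr01) _.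
by rewrite dzC //; apply: dz_const0 (axis t) => y sy; exact: X_t.
Qed.

End Killing.

Lemma time_field p : space p -> tc (v p) = eta (point 0 (tc p) 1).
Proof.
move=> sp; have -> : tc (v p) = eta p by [].
by apply: constant_in_xu => // y sy; exact: (eta_u hn sym).
Qed.

Lemma vE p : v p = point (xc (v p)) (tc (v p)) (phi p).
Proof. by rewrite -[LHS]pointE. Qed.

Section NonlinearTime.
Hypothesis r0 : r != 0.
Hypothesis sg0 : forall p, space p -> sg p = 0.

Lemma growth_x k p : space p -> d k A p = 0.
Proof.
move=> sp; rewrite dz_growth // eta_t_x //.
by rewrite (dz_const0 _ sg0) // mulr0 subrr.
Qed.

Lemma field_t k p : space p -> dt (X k) p = 0.
Proof.
move=> sp; have := gradient_equation k sp.
rewrite (dz_const0 _ sg0) // mulr0.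
have -> : d k (du phi) p = 0.
  apply: (mulfI r0); rewrite mulr0 -[RHS](growth_x k sp).
  have H1 := is_derive_mul (is_derive_const r p _) (is_derive_dz (xi_ k) (smooth_du sphi) sp).
  have := derive_ext_on open_space (fun y sy => du_phi sy) sp H1 (is_derive_dz (xi_ k) sA sp).
  move: (d k (du phi) p) (du phi p) (d k A p) => a b c.
  by rewrite mulr0 addr0.
rewrite mulr0 addr0 => /eqP; rewrite mulf_eq0 gt_eqF ?powR_gt0 //=.
by move/eqP.
Qed.

Lemma growth_eta p : space p -> A p = dt eta p.
Proof. by move=> sp; rewrite /growth sg0 // mulr0 subr0. Qed.

Lemma phi_eta p : space p -> phi p = r^-1 * dt eta (point 0 (tc p) 1) * uc p.
Proof.
move=> sp; apply: (mulfI r0); rewrite (growthE sp) growth_eta //.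
rewrite [dt eta p](_ : _ = dt eta (point 0 (tc p) 1)); last first.
  apply: constant_in_xu sp; first exact: smooth_dz.
    by move=> y sy; exact: eta_t_u.
  by move=> i y sy; exact: eta_t_x.
by rewrite !mulrA divff // mul1r mulrC.
Qed.

Lemma eta_derive t : is_derive t (1 : R) (fun t => eta (point 0 t 1)) (dt eta (point 0 t 1)).
Proof. exact: (is_derive_t 0 t seta ltr01). Qed.

Lemma growth_derive t :
  is_derive t (1 : R) (fun t => dt eta (point 0 t 1)) (dt A (point 0 t 1)).
Proof.
have -> : dt A (point 0 t 1) = dt (dt eta) (point 0 t 1).
  by apply: dz_eq (axis t) => y sy; exact: growth_eta.
exact: (is_derive_t 0 t (smooth_dz _ seta) ltr01).
Qed.

Lemma normal_formE p : space p -> v p = point (xc p *m rotation_matrix)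
  (eta (point 0 (tc p) 1)) (r^-1 * dt eta (point 0 (tc p) 1) * uc p).
Proof.
move=> sp; rewrite [LHS]vE phi_eta // time_field //.
by rewrite (rotation_field sg0 (fun k p sp => field_t k sp)).
Qed.

End NonlinearTime.

(** The exponents [r + 1], [1] and [q] are distinct, so all three coefficients
    of [growth_equation] vanish. *)
Lemma normal_form_generic : q != r + 1 -> q != 1 -> r + 1 != 1 ->
  exists (B : 'M[R]_n) (c : R), B^T = - B /\
    forall p, space p -> v p = point (xc p *m B) c 0.
Proof.
move=> q1 q2 r1; have r0 : r != 0 by apply: contraNneq r1 => ->; rewrite add0r.
have E p : space p -> sg p = 0 /\ A p = 0.
  move=> sp.
  have /= /and4P[_ s0 A0 _] : all (fun x => x.2 == 0) [:: (r + 1, dt A p);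
      (1, - (2 * n%:R * sg p)); (q, (1 - q) * A p - 2 * r * sg p)].
    apply: powR_independent => [|u u0].
      by rewrite /= !inE negb_or r1 andbT [r + 1 == q]eq_sym q1 eq_sym q2.
    rewrite !big_cons big_nil addr0 addrA mulNr.
    exact: (growth_equation sp u0).
  move: s0; rewrite oppr_eq0 !mulf_eq0 pnatr_eq0 (negbTE npos) /= => /eqP s0; split=> //.
  by move: A0; rewrite s0 mulr0 subr0 mulf_eq0 subr_eq0 eq_sym (negbTE q2) /= => /eqP.
have sg0 p (sp : space p) := (E p sp).1.
have eta0 p : space p -> dt eta p = 0.
  by move=> sp; rewrite -(growth_eta sg0 sp); exact: (E p sp).2.
exists rotation_matrix, (eta (point 0 0 1)); split; first exact: rotation_matrix_antisym.
move=> p sp; rewrite normal_formE // eta0 // mulr0 mul0r; congr point.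
apply: (@is_derive_0_is_cst R (fun t => eta (point 0 t 1))) => t.
by apply: is_derive_eq (eta_derive t) _; exact: eta0 (axis t).
Qed.

(** The terms in [u `^ (r + 1)] and [u `^ q] merge, which leaves
    [growth' = r * growth] with [growth = eta'] and hence an exponential. *)
Lemma normal_form_exp : q = r + 1 -> r + 1 != 1 ->
  exists (B : 'M[R]_n) (c k : R), B^T = - B /\
    forall p, space p -> v p = point (xc p *m B) (c + k * expR (r * tc p))
                                     (k * expR (r * tc p) * uc p).
Proof.
move=> q1 r1; have r0 : r != 0 by apply: contraNneq r1 => ->; rewrite add0r.
have E p : space p -> sg p = 0 /\ dt A p = r * A p.
  move=> sp.
  have /= /and3P[A0 s0 _] : all (fun x => x.2 == 0)
      [:: (r + 1, dt A p + ((1 - q) * A p - 2 * r * sg p)); (1, - (2 * n%:R * sg p))].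
    apply: powR_independent => [|u u0]; first by rewrite /= !inE r1.
    rewrite !big_cons big_nil addr0 /= mulNr mulrDl addrAC.
    by have := growth_equation sp u0; rewrite (_ : u `^ q = u `^ (r + 1)) // q1.
  move: s0; rewrite oppr_eq0 !mulf_eq0 pnatr_eq0 (negbTE npos) /= => /eqP s0; split=> //.
  by move/eqP: A0; rewrite s0 q1; move: (dt A p) (A p) => a b; lra.
have sg0 p (sp : space p) := (E p sp).1.
pose k := dt eta (point 0 0 1).
have Ek t : dt eta (point 0 t 1) = k * expR (r * t).
  pose f t := dt eta (point 0 t 1) * expR (- r * t).
  have Hf : f t = f 0.
    apply: is_derive_0_is_cst => s.
    apply: is_derive_eq (is_derive_mul (growth_derive sg0 s) (is_derive_expR_linear (- r) s)) _.
    by rewrite (E _ (axis s)).2 (growth_eta sg0 (axis s)); ring.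
  move: Hf; rewrite /f mulr0 expR0 mulr1 -/k => <-.
  by rewrite -mulrA -expRD mulNr addNr expR0 mulr1.
pose c := eta (point 0 0 1) - k / r.
have Ec t : eta (point 0 t 1) = c + k / r * expR (r * t).
  pose f t := eta (point 0 t 1) - k / r * expR (r * t).
  have Hf : f t = f 0.
    apply: is_derive_0_is_cst => s.
    apply: is_derive_eq (is_derive_sub (eta_derive s)
      (is_derive_mul (is_derive_const (k / r) s (1 : R)) (is_derive_expR_linear r s))) _.
    by rewrite Ek mulr0 addr0; field.
  by move: Hf; rewrite /f mulr0 expR0 mulr1 -/c => <-; rewrite subrK.
exists rotation_matrix, c, (k / r); split; first exact: rotation_matrix_antisym.
move=> p sp; rewrite normal_formE // Ec Ek; congr point.
by ring.
Qed.

(** The terms in [u `^ 1] and [u `^ q] merge, and give only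
    [(r + n) * sigma = 0]. For [r = - n] the two exponents of the gradient
    equation give a second relation between the gradients of [du phi] and
    [sigma], next to the derivative of [du_phi]; together they force [sigma] to
    be constant, hence zero. Then [eta'' = 0]. *)
Lemma normal_form_dilation : q = 1 -> r + 1 != 1 ->
  exists (B : 'M[R]_n) (c k : R), B^T = - B /\
    forall p, space p -> v p = point (xc p *m B) (c + k * tc p) (k / r * uc p).
Proof.
move=> q1 r1; have r0 : r != 0 by apply: contraNneq r1 => ->; rewrite add0r.
have E p : space p -> (r + n%:R) * sg p = 0 /\ dt A p = 0.
  move=> sp; have /= /and3P[/eqP A0 s0 _] : all (fun x => x.2 == 0)
      [:: (r + 1, dt A p); (1, - (2 * (r + n%:R) * sg p))].
    apply: powR_independent => [|u u0]; first by rewrite /= !inE r1.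
    rewrite !big_cons big_nil addr0 /= -[RHS](growth_equation sp u0) q1.
    by move: (dt A p) (A p) (sg p) => a b c; ring.
  by move: s0; rewrite oppr_eq0 -mulrA mulf_eq0 pnatr_eq0 /= => /eqP.
have sg0 p : space p -> sg p = 0.
  have [rn|rn] := eqVneq (r + n%:R) 0; last first.
    by move=> sp; have /eqP := (E p sp).1; rewrite mulf_eq0 (negbTE rn) => /eqP.
  have rN : r = - n%:R by apply/eqP; rewrite -addr_eq0 rn.
  move=> sp0; apply: (sigma_zero_of_gradient) sp0 => {}p sp k.
  have /= /and3P[_ /eqP H _] : all (fun x => x.2 == 0) [:: (r, dt (X k) p);
     (0, 2 * weight (xc p) ^+ 2 * d k (du phi) p - (2 - n%:R) * weight (xc p) ^+ 2 * d k sg p)].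
    apply: powR_independent => [|u u0]; first by rewrite /= !inE r0.
    rewrite !big_cons big_nil addr0.
    pose p' : pt := (p.1, u); have sp' : space p' by [].
    have E1 : dt (X k) p' = dt (X k) p := dz_constant_in_u (tidx n) (sX k) (@Xu k) sp u0.
    have E2 : d k (du phi) p' = d k (du phi) p.
      exact: (dz_constant_in_u (xi_ k) (smooth_du sphi) (@phi_affine _ _ _ _ _ hn sym) sp u0).
    have E3 : d k sg p' = d k sg p.
      exact: (dz_constant_in_u (xi_ k) (smooth_sigma sX smu) sigma_u sp u0).
    have := gradient_equation k sp'; rewrite E1 E2 E3 /= powRr0 mulr1 => H.
    by rewrite addrA [_ * u `^ r]mulrC H; ring.
  have W : weight (xc p) ^+ 2 != 0 by rewrite expf_neq0 // gt_eqF // weight_gt0.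
  have F : r * d k (du phi) p = - 2 * d k sg p.
    have H1 := is_derive_mul (is_derive_const r p _) (is_derive_dz (xi_ k) (smooth_du sphi) sp).
    have := derive_ext_on open_space (fun y sy => du_phi sy) sp H1 (is_derive_dz (xi_ k) sA sp).
    rewrite dz_growth // eta_t_x //.
    move: (d k (du phi) p) (du phi p) (d k sg p) => a b c.
    by rewrite mulr0 addr0 sub0r => ->; ring.
  move: H F W; move: (d k (du phi) p) (d k sg p) (weight (xc p) ^+ 2) => a b w H F W.
  have {}H : 2 * a = (2 - n%:R) * b.
    by apply: (mulfI W); rewrite -[RHS]addr0 -H; ring.
  have n2 : (2 : R) <= n%:R by rewrite ler_nat.
  have : (4 + n%:R * (n%:R - 2)) * b = 0.
    move: F; rewrite rN => F.
    have -> : (4 + n%:R * (n%:R - 2)) * b = 4 * b - n%:R * ((2 - n%:R) * b) by ring.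
    have F2 : n%:R * (2 * a) = - 2 * (- n%:R * a) by ring.
    by rewrite -H F2 F; ring.
  move/eqP; rewrite mulf_eq0 => /orP[/eqP K|/eqP //]; exfalso.
  have : 0 <= n%:R * (n%:R - 2) :> R by rewrite mulr_ge0 ?ler0n // subr_ge0.
  by move: K; set z := _ * _; lra.
pose k := dt eta (point 0 0 1).
have Ek t : dt eta (point 0 t 1) = k.
  apply: (@is_derive_0_is_cst R (fun t => dt eta (point 0 t 1))) => s.
  by apply: is_derive_eq (growth_derive sg0 s) _; exact: (E _ (axis s)).2.
pose c := eta (point 0 0 1).
have Ec t : eta (point 0 t 1) = c + k * t.
  pose f t := eta (point 0 t 1) - k * t.
  have Hf : f t = f 0.
    apply: is_derive_0_is_cst => s.
    apply: is_derive_eq (is_derive_sub (eta_derive s)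
      (is_derive_mul (is_derive_const k s (1 : R)) (is_derive_id s (1 : R)))) _.
    by rewrite Ek mulr0 addr0 mulr1 subrr.
  by move: Hf; rewrite /f mulr0 subr0 -/c => <-; rewrite subrK.
exists rotation_matrix, c, k; split; first exact: rotation_matrix_antisym.
move=> p sp; rewrite normal_formE // Ec Ek; congr point.
by ring.
Qed.

(** For [r = 0] the relation [phi_sigma] does not determine [phi], which is
    affine in [u] by [phi_affine]: [phi = u * a + b]. *)
Section LinearTime.
Hypothesis r0 : r = 0.

Let a := du phi.
Let b p := phi p - p.2 * a p.

Let sa : sm a := smooth_du sphi.

(** Here [growth = 0], so [2 * sigma] is the time derivative of [eta] and does
    not depend on [x]. *)
Lemma sigma_zero_linear p : space p -> sg p = 0.
Proof.
move=> sp0; apply: (sigma_zero_of_gradient) sp0 => {}p sp k.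
have A0 y : space y -> A y = 0.
  move=> sy; have := growthE sy; rewrite r0 mul0r => /esym/eqP.
  by rewrite mulf_eq0 gt_eqF //= => /eqP.
have := dz_growth (xi_ k) sp; rewrite (dz_const0 _ A0 sp) eta_t_x //.
by move: (d k sg p) => z; lra.
Qed.

Lemma eta_t_linear p : space p -> dt eta p = 0.
Proof.
move=> sp; have := growthE sp; rewrite r0 mul0r => /esym/eqP.
by rewrite mulf_eq0 gt_eqF //= /growth sigma_zero_linear // mulr0 subr0 => /eqP.
Qed.

Lemma time_field_linear p : space p -> tc (v p) = eta (point 0 0 1).
Proof.
move=> sp; rewrite time_field //.
apply: (@is_derive_0_is_cst R (fun t => eta (point 0 t 1))) => t.
by apply: is_derive_eq (eta_derive t) _; exact: eta_t_linear (axis t).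
Qed.

Lemma field_t_linear k p : space p ->
  dt (X k) p = - (2 * weight (xc p) ^+ 2 * d k a p).
Proof.
move=> sp; have := gradient_equation k sp.
rewrite (dz_const0 _ sigma_zero_linear) // mulr0 r0 powRr0 mul1r => /eqP.
by rewrite addr_eq0 => /eqP.
Qed.

Let sb : sm b.
Proof.
by apply: smoothB => //; [exact: open_space|apply: smoothM => //; [exact: open_space|exact: smooth_ucoord]].
Qed.

Let au p (sp : space p) : du a p = 0 := phi_affine hn sym sp.

Let bu p : space p -> du b p = 0.
Proof.
move=> sp; rewrite duE; apply: derive_val.
apply: is_derive_eq (is_derive_sub (is_derive_du sphi sp)
  (is_derive_mul (is_derive_u_du p) (is_derive_du sa sp))) _.
by rewrite au // mulr0 add0r mulr1 subrr.
Qed.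

Let dz_affine l p : space p -> dz l phi p = p.2 * dz l a p + dz l b p.
Proof.
move=> sp.
have := is_derive_sub (is_derive_dz l sphi sp) (is_derive_mul (is_derive_u_dz p l) (is_derive_dz l sa sp)).
move=> /(@derive_val _ _ _ _ _ _ _); rewrite -/b -dzE => ->.
by move: (dz l phi p) (dz l a p) (a p) => x y z; rewrite mulr0 addr0; ring.
Qed.

Let dzz_affine l p : space p -> dz l (dz l phi) p = p.2 * dz l (dz l a) p + dz l (dz l b) p.
Proof.
move=> sp.
have F y : space y -> dz l phi y = y.2 * dz l a y + dz l b y by exact: dz_affine.
have H := derive_ext_on open_space F sp (is_derive_dz l (smooth_dz l sphi) sp)
  (is_derive_add (is_derive_mul (is_derive_u_dz p l) (is_derive_dz l (smooth_dz l sa) sp))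
     (is_derive_dz l (smooth_dz l sb) sp)).
move: H; move: (dz l (dz l phi) p) (dz l (dz l a) p) (dz l (dz l b) p) (dz l a p) => x y z w.
by rewrite mulr0 addr0.
Qed.

Let laplacian_affine p : space p -> laplacian phi p = p.2 * laplacian a p + laplacian b p.
Proof.
move=> sp; rewrite /laplacian.
have -> : flat_laplacian phi p = p.2 * flat_laplacian a p + flat_laplacian b p.
  by rewrite mulr_sumr -big_split; apply: eq_bigr => i _; exact: dzz_affine.
have -> : radial_derivative phi p = p.2 * radial_derivative a p + radial_derivative b p.
  rewrite mulr_sumr -big_split; apply: eq_bigr => i _; rewrite (dz_affine _ sp) /=.
  by move: (d i a p) (d i b p) => x y; ring.
move: (flat_laplacian a p) (flat_laplacian b p) (radial_derivative a p) (radial_derivative b p) => *.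
by ring.
Qed.

Let laplacian_u f p : sm f -> (forall p, space p -> du f p = 0) -> space p ->
  forall u, 0 < u -> laplacian f (p.1, u) = laplacian f p.
Proof.
move=> sf fu sp u u0; rewrite /laplacian.
have E l : dz l f (p.1, u) = dz l f p by exact: dz_constant_in_u.
have E2 l : dz l (dz l f) (p.1, u) = dz l (dz l f) p.
  exact: (dz_constant_in_u l (smooth_dz l sf) (dz_no_u l sf fu)).
have -> : flat_laplacian f (p.1, u) = flat_laplacian f p.
  by apply: eq_bigr => i _; exact: E2.
have -> : radial_derivative f (p.1, u) = radial_derivative f p.
  by apply: eq_bigr => i _; rewrite E.
by [].
Qed.

Lemma linear_time_equation p u : space p -> 0 < u ->
  (dt a p - laplacian a p) * u `^ 1 + (dt b p - laplacian b p) * u `^ 0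
  + (1 - q) * a p * u `^ q - q * b p * u `^ (q - 1) = 0.
Proof.
move=> sp u0; pose p' : pt := (p.1, u); have sp' : space p' by [].
have E1 : a p' = a p by apply: constant_in_u.
have E2 : b p' = b p by apply: constant_in_u.
have dta := dz_constant_in_u (tidx n) sa au sp u0.
have dtb := dz_constant_in_u (tidx n) sb bu sp u0.
have C := constant_term hn sym sp'.
have e1 := sigma_zero_linear sp'; have e2 := dz_affine (tidx n) sp'; have e3 := laplacian_affine sp'.
have La := laplacian_u sa au sp u0; have Lb := laplacian_u sb bu sp u0.
have e4 : phi p' = u * a p + b p by rewrite -E1 -E2 /b /=; ring.
rewrite La Lb in e3; rewrite dta dtb in e2.
rewrite e3 e2 e1 e4 -/a E1 r0 powRr0 in C.
have u1 := powRr1 (ltW u0).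
move: C; rewrite u1 powRr0 /= (powR_pred q u0).
move: (dt a p) (dt b p) (laplacian a p) (laplacian b p) (a p) (b p) => x y z t z1 z2 <-.
by ring.
Qed.

Lemma normal_form_static : q != 0 -> q != 1 ->
  exists (B : 'M[R]_n) (c : R), B^T = - B /\
    forall p, space p -> v p = point (xc p *m B) c 0.
Proof.
move=> q0 q1.
  (* For [q = 2] the terms in [u `^ 1] and [u `^ (q - 1)] merge, and [b] vanishes
     only after [a] is known to vanish everywhere. *)
have E p : space p -> a p = 0 /\ (a p = 0 -> dt a p = 0 -> laplacian a p = 0 -> b p = 0).
  move=> sp; have [q2|q2] := eqVneq q 2.
    have /= /and4P[b0 _ a0 _] : all (fun x => x.2 == 0) [:: (1 : R, dt a p - laplacian a p - 2 * b p);
        (0, dt b p - laplacian b p); (2, - a p)].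
      have n12 : (1 : R) != 2 by apply/eqP; lra.
      have n02 : (0 : R) != 2 by apply/eqP; lra.
      apply: powR_independent => [|u u0].
        by rewrite /= !inE (negbTE n12) (negbTE n02) oner_eq0.
      rewrite !big_cons big_nil addr0 -[RHS](linear_time_equation sp u0) q2 /=.
      have -> : (2 - 1 : R) = 1 by lra.
      by move: (dt a p) (dt b p) (laplacian a p) (laplacian b p) (a p) (b p) => *; ring.
    split=> [|_ ta la]; first by move: a0; rewrite oppr_eq0 => /eqP.
    by move/eqP: b0; rewrite ta la; move: (b p) => z; lra.
  have /= /and5P[_ _ a0 b0 _] : all (fun x => x.2 == 0) [:: (1 : R, dt a p - laplacian a p);
      (0, dt b p - laplacian b p); (q, (1 - q) * a p); (q - 1, - (q * b p))].
    apply: powR_independent => [|u u0].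
      have n1 : 1 != q by rewrite eq_sym.
      have n2 : 1 != q - 1 by apply: contraNneq q2 => e; apply/eqP; lra.
      have n3 : 0 != q by rewrite eq_sym.
      have n4 : 0 != q - 1 by apply: contraNneq q1 => e; apply/eqP; lra.
      have n5 : q != q - 1 by apply/eqP; lra.
      by rewrite /= !inE oner_eq0 (negbTE n1) (negbTE n2) (negbTE n3) (negbTE n4) n5.
    rewrite !big_cons big_nil addr0 -[RHS](linear_time_equation sp u0) /=.
    by move: (dt a p) (dt b p) (laplacian a p) (laplacian b p) (a p) (b p) => *; ring.
  split=> [|_ _ _].
    by move: a0; rewrite mulf_eq0 subr_eq0 eq_sym (negbTE q1) /= => /eqP.
  by move: b0; rewrite oppr_eq0 mulf_eq0 (negbTE q0) => /eqP.
have a0 p (sp : space p) : a p = 0 := (E p sp).1.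
have da0 l p (sp : space p) : dz l a p = 0 := dz_const0 l a0 sp.
have phi0 p : space p -> phi p = 0.
  move=> sp; have b0 : b p = 0.
    apply: (E p sp).2; [exact: a0|exact: da0|].
    rewrite /laplacian /flat_laplacian /radial_derivative !big1 ?mulr0 ?subrr // => i _.
      by rewrite da0 // mulr0.
    exact: dz_const0 (da0 _) sp.
  by move: b0; rewrite /b a0 // mulr0 subr0.
have Xt k p : space p -> dt (X k) p = 0.
  by move=> sp; rewrite field_t_linear // da0 // mulr0 oppr0.
exists rotation_matrix, (eta (point 0 0 1)); split.
  exact: rotation_matrix_antisym sigma_zero_linear.
move=> p sp; rewrite [LHS]vE phi0 // time_field_linear //.
by rewrite (rotation_field sigma_zero_linear Xt).
Qed.

(** The constant term splits into the equation for [b], which is the linear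
    equation itself, and the heat equation for [a]. The field [xi] is orthogonal
    to the rays from the origin at all times, so [a] is constant along them by
    [field_t_linear]; then [xi] is independent of time and [a] is constant. *)
Lemma normal_form_linear : q = 1 ->
  exists (B : 'M[R]_n) (c k : R) (h : 'rV[R]_(n + 1) -> R), [/\ B^T = - B,
    linear_solution h &
    forall p, space p -> v p = point (xc p *m B) c (k * uc p + h p.1)].
Proof.
move=> q1.
have E p : space p -> dt a p = laplacian a p /\ dt b p = laplacian b p + b p.
  move=> sp; have /= /and3P[a0 b0 _] : all (fun x => x.2 == 0) [:: (1 : R, dt a p - laplacian a p);
      (0, dt b p - laplacian b p - b p)].
    apply: powR_independent => [|u u0]; first by rewrite /= !inE oner_eq0.
    rewrite !big_cons big_nil addr0 -[RHS](linear_time_equation sp u0) q1 /= subrr.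
    by move: (dt a p) (dt b p) (laplacian a p) (laplacian b p) (a p) (b p) => *; ring.
  split; first by move: a0; rewrite subr_eq0 => /eqP.
  by move/eqP: b0; move: (dt b p) (laplacian b p) (b p) => *; lra.
have a_axis p : space p -> a p = a (point 0 (tc p) 1).
  move=> sp; have u0 : 0 < uc p by [].
  transitivity (a (point 0 (tc p) (uc p))); last first.
    exact: (constant_in_u sa au (p := point 0 (tc p) 1) (u := uc p)).
  rewrite -{1}(pointE p) -{1}[xc p]scale1r -[0 in RHS](scale0r (xc p)).
  apply: (@is_derive_0_is_cst R (fun s => a (point (s *: xc p) (tc p) (uc p)))) => s.
  apply: is_derive_eq (is_derive_ray (xc p) (tc p) s sa u0) _.
  have spp t : space (point (s *: xc p) t (uc p)) by [].
  have R0 t : \sum_(i < n) xc p 0 i * X i (point (s *: xc p) t (uc p)) = 0.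
    have := clairaut sX conf sigma_zero_linear (xc p) t s u0.
    rewrite (radial_axis0 sX conf sigma_zero_linear pole_condition (xc p) t u0) mul0r => /eqP.
    by rewrite mulf_eq0 invr_eq0 (gt_eqF (weight_gt0 _)) orbF => /eqP.
  have H := is_derive_bigsum (fun i => is_derive_mul (is_derive_const (xc p 0 i) (tc p) (1 : R))
     (is_derive_t (s *: xc p) (tc p) (sX i) u0)).
  have {}H := derive_ext_on openT (fun t _ => R0 t) I H (is_derive_const 0 (tc p) (1 : R)).
  have w0 : - (2 * weight (s *: xc p) ^+ 2) != 0.
    by rewrite oppr_eq0 mulf_neq0 ?pnatr_eq0 // expf_neq0 // gt_eqF // weight_gt0.
  apply: (mulfI w0); rewrite mulr0 -[RHS]H mulr_sumr; apply: eq_bigr => i _.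
  rewrite field_t_linear // xc_point; move: (d i a _) (X i _) => x y.
  by rewrite mulr0 addr0; ring.
have da0 i p : space p -> d i a p = 0.
  move=> sp; rewrite (dz_eq _ a_axis sp) dzE; apply: derive_along_constant => h.
  congr (a (point 0 _ 1)); rewrite /tc /= !mxE.
  by rewrite eq_sym xi_tidx andbF mulr0 add0r.
have Xt k p : space p -> dt (X k) p = 0.
  by move=> sp; rewrite field_t_linear // da0 // mulr0 oppr0.
have ta p : space p -> dt a p = 0.
  move=> sp; rewrite (E p sp).1.
  rewrite /laplacian /flat_laplacian /radial_derivative !big1 ?mulr0 ?subrr // => i _.
    by rewrite da0 // mulr0.
  exact: dz_const0 (da0 _) sp.
pose k := a (point 0 0 1).
pose h z := b (z, 1).
have ak p : space p -> a p = k.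
  move=> sp; rewrite a_axis //.
  apply: (@is_derive_0_is_cst R (fun t => a (point 0 t 1))) => t.
  by apply: is_derive_eq (is_derive_t 0 t sa ltr01) _; exact: ta (axis t).
have vf p : space p -> v p = point (xc p *m rotation_matrix) (eta (point 0 0 1)) (k * uc p + h p.1).
  move=> sp; rewrite [LHS]vE time_field_linear // (rotation_field sigma_zero_linear Xt sp).
  congr point; rewrite /h (constant_in_u sb bu sp ltr01) /b ak //.
  by rewrite mulrC addrC subrK.
exists rotation_matrix, (eta (point 0 0 1)), k, h; split => //.
  exact: rotation_matrix_antisym sigma_zero_linear.
split=> [|z].
  pose L (z : 'rV[R]_(n + 1)) : pt := (z, 0).
  have lL : linear L by move=> c x y; rewrite /L; congr (_, _); rewrite /= scaler0 addr0.
  have := @smooth_affine R _ _ _ setT openT space L ((0, 1) : pt) b lL.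
  have -> : (fun y => b (L y + ((0, 1) : pt))) = h.
    by apply: funext => y; rewrite /h; congr b; congr (_, _); rewrite /= ?addr0 ?add0r.
  have cL : continuous L.
    move=> y; apply: differentiable_continuous; rewrite /L.
    by apply: (differentiable_pair (f := id) (g := cst 0)).
  by move=> /(_ cL); apply=> // y _; rewrite /Defs.space /= add0r.
have D1 l y : 'D_(delta_mx 0 l) h y = dz l b (y, 1) by exact: derive_slice.
have D2 l : 'D_(delta_mx 0 l) ('D_(delta_mx 0 l) h) z = dz l (dz l b) (z, 1).
  have -> : 'D_(delta_mx 0 l) h = (fun y => dz l b (y, 1)) by apply: funext => y; exact: D1.
  exact: derive_slice.
have sz : space ((z, 1) : pt) by exact: ltr01.
rewrite laplace_beltramiE /j1 /j2 /jet_of /= mxE D1 (E _ sz).2.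
congr (_ + _).
rewrite /laplacian; congr (_ * _ - _ * (_ * _)); apply: eq_bigr => i _; rewrite mxE.
  by rewrite D2.
by rewrite D1.
Qed.

End LinearTime.

End Solution.

(** * Fields in normal form are symmetries *)

Section Sufficiency.
Context {R : realType} {n : nat}.
Local Notation pt := (pt R n).
Local Notation d i := (dz (xi_ i)).
Local Notation dt := (dz (tidx n)).
Implicit Types (p : pt).

Lemma smooth_tc : sm (fun p : pt => tc p).
Proof. exact: smooth_zcoord. Qed.

Lemma is_derive_tc_comp (f : R -> R) f' p l : is_derive (tc p) (1 : R) f f' ->
  space p -> is_derive p ((delta_mx 0 l, 0) : pt) (fun p => f (tc p)) (f' * (l == tidx n)%:R).
Proof.
move=> Hf sp; have dtc : differentiable (fun p : pt => tc p) p.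
  exact: smooth_differentiable smooth_tc sp.
have [dc e] := derive_real_comp ((delta_mx 0 l, 0) : pt) dtc Hf.
have E : 'D_((delta_mx 0 l, 0) : pt) (fun p : pt => tc p) p = (l == tidx n)%:R.
  apply: derive_val; apply: is_derive_eq (is_derive_zcoord _ p (tidx n)) _.
  by rewrite mxE eqxx /= eq_sym.
rewrite -E -e; apply: derivableP; exact: diff_derivable.
Qed.

Lemma du_no_u (f : pt -> R) p : (forall z u u', f (z, u) = f (z, u')) -> du f p = 0.
Proof.
move=> fu; rewrite duE; apply: derive_along_constant => h.
by case: p => z u; apply: etrans (fu _ _ u) _; congr f; congr (_, _); rewrite /= scaler0 add0r.
Qed.

Variables (q r : R) (v : pt -> pt) (B : 'M[R]_n) (E E' S S' : R -> R)
  (h : 'rV[R]_(n + 1) -> R).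
Local Notation H := (fun p : pt => h p.1).

Hypothesis vE : forall p, space p ->
  v p = point (xc p *m B) (E (tc p)) (S (tc p) * uc p + h p.1).
Hypothesis B_antisym : B^T = - B.
Hypothesis derE : forall t, is_derive t (1 : R) E (E' t).
Hypothesis derS : forall t, is_derive t (1 : R) S (S' t).
Hypothesis sh : sm H.
Hypothesis time_scale : forall t, r * S t = E' t.
Hypothesis hr : forall z, r * h z = 0.
Hypothesis balance : forall p, space p ->
  p.2 `^ r * (S' (tc p) * p.2 + dt H p) + (1 - q) * p.2 `^ q * S (tc p)
  - laplacian H p - q * p.2 `^ (q - 1) * H p = 0.

Let Bas i k : B i k = - B k i.
Proof. by have /matrixP/(_ k i) := B_antisym; rewrite !mxE. Qed.

Lemma antisym_form (y : 'I_n -> R) : \sum_(i < n) y i * \sum_(k < n) y k * B k i = 0.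
Proof.
set s := LHS; suff : s = - s by move=> ?; lra.
rewrite /s -sumrN; under eq_bigr do rewrite mulr_sumr.
rewrite exchange_big /=; apply: eq_bigr => i _; rewrite mulr_sumr -sumrN.
by apply: eq_bigr => k _; rewrite Bas; ring.
Qed.

Let spatial i p : space p -> zcoef v (xi_ i) p = \sum_(k < n) xc p 0 k * B k i.
Proof.
by move=> sp; rewrite /zcoef vE // /Defs.point /= row_mxEl mxE.
Qed.

Let time p : space p -> zcoef v (tidx n) p = E (tc p).
Proof. by move=> sp; rewrite /zcoef vE // /Defs.point /= row_mxEr mxE. Qed.

Let height p : space p -> ucoef v p = S (tc p) * p.2 + h p.1.
Proof. by move=> sp; rewrite /ucoef vE. Qed.

Let spatial_x i k p : space p -> d i (zcoef v (xi_ k)) p = B i k.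
Proof.
move=> sp; rewrite (dz_eq _ (spatial k) sp) dzE; apply: derive_val.
apply: is_derive_eq (is_derive_bigsum (fun l => is_derive_mul (is_derive_xc_dz p i l) (is_derive_const (B l k) _ _))) _.
rewrite -[RHS](sum_delta_r (fun l => B l k)); apply: eq_bigr => l _.
by rewrite mulr0 add0r.
Qed.

Let spatial_t k p : space p -> dt (zcoef v (xi_ k)) p = 0.
Proof.
move=> sp; rewrite (dz_eq _ (spatial k) sp) dzE; apply: derive_along_constant => c.
apply: eq_bigr => l _; congr (_ * _); rewrite !xcE /= !mxE.
by rewrite xi_tidx andbF mulr0 add0r.
Qed.

Let spatial_u k p : space p -> du (zcoef v (xi_ k)) p = 0.
Proof. by move=> sp; rewrite (du_eq (spatial k) sp); apply: du_no_u. Qed.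

Let time_z l p : space p -> dz l (zcoef v (tidx n)) p = E' (tc p) * (l == tidx n)%:R.
Proof.
move=> sp; rewrite (dz_eq _ time sp) dzE; apply: derive_val.
exact: is_derive_tc_comp (derE _) sp.
Qed.

Let time_u p : space p -> du (zcoef v (tidx n)) p = 0.
Proof. by move=> sp; rewrite (du_eq time sp); apply: du_no_u. Qed.

Let height_z l p : space p -> dz l (ucoef v) p = S' (tc p) * (l == tidx n)%:R * p.2 + dz l H p.
Proof.
move=> sp; rewrite (dz_eq _ height sp) [LHS]dzE; apply: derive_val.
apply: is_derive_eq (is_derive_add (is_derive_mul (is_derive_tc_comp l (derS _) sp) (is_derive_u_dz p l))
  (is_derive_dz l sh sp)) _.
by rewrite mulr0 add0r [p.2 * _]mulrC.
Qed.

Let height_u p : space p -> du (ucoef v) p = S (tc p).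
Proof.
move=> sp; rewrite (du_eq height sp) duE; apply: derive_val.
have HS : is_derive p ((0, 1) : pt) (fun p : pt => S (tc p)) 0.
  have dS : differentiable (fun p : pt => S (tc p)) p.
    exact: (derive_real_comp 0 (smooth_differentiable smooth_tc sp) (derS _)).1.
  have : du (fun p : pt => S (tc p)) p = 0 by apply: du_no_u.
  rewrite duE => <-; apply: derivableP; exact: diff_derivable.
have HH : is_derive p ((0, 1) : pt) H 0.
  have : du H p = 0 by apply: du_no_u.
  by rewrite duE => <-; exact: smooth_is_derive sh sp.
apply: is_derive_eq (is_derive_add (is_derive_mul HS (is_derive_u_du p)) HH) _.
by rewrite mulr0 mulr1 !addr0.
Qed.

Let field_u l p : space p -> du (zcoef v l) p = 0.
Proof.
by move=> sp; case: (split_ordP l) => k ->; [exact: spatial_u|rewrite (ord1 k); exact: time_u].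
Qed.

Let field_total2 i l p P : space p -> total2 (xi_ i) (zcoef v l) p P = 0.
Proof.
move=> sp; rewrite /total2 (dz_const0 _ (field_u l) sp) (du_const0 (field_u l) sp) !mulr0 !addr0.
case: (split_ordP l) => k ->; first exact: (dz_const0 _ (spatial_x i k) sp).
rewrite (ord1 k); apply: (dz_const0 (c := 0) _ _ sp) => y sy.
by rewrite time_z // xi_tidx mulr0.
Qed.

Let height_total2 i p P : space p -> total2 (xi_ i) (ucoef v) p P = d i (d i H) p.
Proof.
move=> sp; rewrite /total2.
have -> : d i (du (ucoef v)) p = 0.
  rewrite (dz_eq _ height_u sp) dzE; apply: derive_along_constant => c.
  by rewrite /tc /= !mxE eq_sym xi_tidx andbF mulr0 add0r.
have -> : du (du (ucoef v)) p = 0 by rewrite (du_eq height_u sp); exact: du_no_u.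
rewrite !mulr0 !addr0; apply: dz_eq sp => y sy.
by rewrite height_z // xi_tidx mulr0 mul0r add0r.
Qed.

(** As [B] is antisymmetric, the spatial part has no product with [x] and no
    pairing with the symmetric Hessian. What remains is [balance], plus the
    equation multiplied by [S], plus multiples of [time_scale] and [hr] that
    contain the time derivative of [u]. *)
Lemma symmetric_of_normal_form : is_infinitesimal_symmetry (heat q r) v.
Proof.
apply: symmetry_of_reduced => p P K sp sK _.
have t1 i l : total1 (xi_ i) (zcoef v l) p P = dz (xi_ i) (zcoef v l) p.
  by rewrite /total1 field_u // mulr0 addr0.
have -> : \sum_(i < n) \sum_l total1 (xi_ i) (zcoef v l) p P * K (xi_ i) l = 0.
  have -> : \sum_(i < n) \sum_l total1 (xi_ i) (zcoef v l) p P * K (xi_ i) l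
    = \sum_(i < n) \sum_(k < n) B i k * K (xi_ i) (xi_ k).
    apply: eq_bigr => i _; rewrite sum_indices t1 time_z // xi_tidx mulr0 mul0r addr0.
    by apply: eq_bigr => k _; rewrite t1 spatial_x.
  set s := LHS; suff : s = - s by move=> ?; lra.
  rewrite {1}/s exchange_big /= -sumrN; apply: eq_bigr => i _; rewrite -sumrN.
  apply: eq_bigr => k _; rewrite Bas mulNr; congr (- (_ * _)).
  by rewrite -{1}sK mxE.
rewrite /reduced_symmetry /=.
have -> : \sum_(i < n) (total2 (xi_ i) (ucoef v) p P -
        \sum_l total2 (xi_ i) (zcoef v l) p P * P 0 l) = flat_laplacian H p.
  apply: eq_bigr => i _; rewrite height_total2 // big1 ?subr0 // => l _.
  by rewrite field_total2 // mul0r.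
have -> : \sum_l du (zcoef v l) p * P 0 l = 0.
  by apply: big1 => l _; rewrite field_u // mul0r.
have -> : \sum_(i < n) xc p 0 i * zcoef v (xi_ i) p = 0.
  by rewrite -[RHS](antisym_form (fun i => xc p 0 i)); apply: eq_bigr => i _; rewrite spatial.
have -> : \sum_k total1 (tidx n) (zcoef v k) p P * P 0 k = E' (tc p) * P 0 (tidx n).
  rewrite sum_indices /total1 time_z // eqxx mulr1 field_u // mulr0 addr0 big1 ?add0r // => k _.
  by rewrite spatial_t // field_u // mulr0 addr0 mul0r.
have -> : \sum_(i < n) (xc p 0 i * (total1 (xi_ i) (ucoef v) p P -
       \sum_k total1 (xi_ i) (zcoef v k) p P * P 0 k) + P 0 (xi_ i) * zcoef v (xi_ i) p)
  = radial_derivative H p + S (tc p) * \sum_(i < n) xc p 0 i * P 0 (xi_ i).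
  have Z : \sum_(i < n) xc p 0 i * (\sum_(k < n) B i k * P 0 (xi_ k)) =
    \sum_(i < n) P 0 (xi_ i) * zcoef v (xi_ i) p.
    under eq_bigr do rewrite mulr_sumr; rewrite exchange_big /=.
    apply: eq_bigr => i _; rewrite spatial // mulr_sumr.
    by apply: eq_bigr => k _; ring.
  rewrite big_split /= -Z mulr_sumr -!big_split /=; apply: eq_bigr => i _.
  rewrite sum_indices t1 time_z // xi_tidx mulr0 mul0r addr0.
  have -> : \sum_(k < n) total1 (xi_ i) (zcoef v (xi_ k)) p P * P 0 (xi_ k)
    = \sum_(k < n) B i k * P 0 (xi_ k) by apply: eq_bigr => k _; rewrite t1 spatial_x.
  rewrite /total1 height_z // xi_tidx mulr0 mul0r add0r height_u //.
  by move: (d i H p) (\sum_(k < n) _) => x y; ring.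
rewrite /total1 height_z // eqxx mulr1 height_u // height //.
have W : weight (xc p) ^+ 2 * heat_trace q r p P = p.2 `^ r * P 0 (tidx n)
   + (n%:R - 2) * (weight (xc p) * \sum_(i < n) xc p 0 i * P 0 (xi_ i)) - p.2 `^ q.
  by rewrite /heat_trace mulrC divfK // expf_neq0 // gt_eqF // weight_gt0.
have Bal := balance sp; have Er := time_scale (tc p); have Hr := hr p.1.
have u0 : 0 < p.2 by [].
rewrite /laplacian in Bal; rewrite (powR_pred r u0) (powR_pred q u0) in Bal W *.
move: W Bal Er Hr.
move: (weight (xc p)) (heat_trace q r p P) (P 0 (tidx n)) (\sum_(i < n) _)
  (p.2) (p.2 `^ (r - 1)) (p.2 `^ (q - 1)) (flat_laplacian H p) (radial_derivative H p)
  (dt H p) (h p.1) (S (tc p)) (S' (tc p)) (E' (tc p)) (n%:R - 2).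
move=> w ht Pt xP u ur uq La rd th hp s s' e m W Bal Er Hr.
have {}W := congr1 (fun z => z * s) W.
have {}Er := congr1 (fun z => z * (ur * u * Pt)) Er.
have {}Hr := congr1 (fun z => z * (ur * Pt)) Hr.
by rewrite /= in W Er Hr; lra.
Qed.

(** The field [x *m B] grows linearly in [x], and the [g]-norm divides by
    [weight x], which grows quadratically. *)
Lemma fixes_of_normal_form : fixes_north_pole v.
Proof.
move=> t u u0 e e0.
pose C := \sum_(i < n) (\sum_(k < n) `|B k i|) ^+ 2.
have C0 : 0 <= C by apply: sumr_ge0 => i _; exact: sqr_ge0.
have bound (x : 'rV[R]_n) : normsq (x *m B) <= normsq x * C.
  rewrite /C mulr_sumr; apply: ler_sum => i _.
  have N0 := normsq_ge0 x; pose s := Num.sqrt (normsq x).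
  have s2 : s ^+ 2 = normsq x by rewrite sqr_sqrtr.
  rewrite -s2 -exprMn -ler_sqrt ?sqr_ge0 // !sqrtr_sqr.
  have s0 : 0 <= s by exact: sqrtr_ge0.
  rewrite [leRHS]ger0_norm; last by rewrite mulr_ge0 // sumr_ge0.
  rewrite mxE; apply: (le_trans (ler_norm_sum _ _ _)).
  rewrite mulr_sumr; apply: ler_sum => k _; rewrite normrM ler_wpM2r //.
  rewrite -sqrtr_sqr ler_sqrt // /normsq (bigD1 k) //= lerDl.
  by apply: sumr_ge0 => j _; exact: sqr_ge0.
exists (4 * C / e) => x; rewrite ltr_pdivrMr // => CN.
rewrite vE // /Defs.point /xc /= !row_mxKl.
have N0 := normsq_ge0 x.
rewrite ltr_pdivrMr; last by rewrite exprn_gt0 // ltr_wpDl.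
have := bound x; move: (normsq (x *m B)) (normsq x) N0 CN => b N N0 CN Hb.
by nra.
Qed.

End Sufficiency.

(** * The transformations and their generators *)

Section Flows.
Context {R : realType} {n : nat}.
Local Notation pt := (pt R n).
Local Notation dom := Defs.dom.
Implicit Types (p : pt).

Definition zbase l : pt := (delta_mx 0 l, 0).
Definition ubase : pt := (0, 1).

(** The coordinates of [point] are blocks of a row; as a sum over basis vectors,
    smoothness and derivatives reduce to those of the scalar coefficients. *)
Lemma point_sum (x : 'rV[R]_n) t u :
  point x t u = \sum_(i < n) x 0 i *: zbase (xi_ i) + t *: zbase (tidx n) + u *: ubase.
Proof.
have E : \sum_(i < n) x 0 i *: zbase (xi_ i) = (row_mx x 0, 0).
  transitivity ((\sum_(i < n) x 0 i *: delta_mx 0 (xi_ i), 0) : pt).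
    elim/big_rec2: _ => [//|l y1 y2 _ ->].
    by congr (_, _); rewrite /= ?scaler0 ?addr0.
  congr (_, _); apply/rowP => l; rewrite summxE; case: (split_ordP l) => k ->.
    rewrite row_mxEl -[RHS](sum_delta_r (fun i => x 0 i)).
    by apply: eq_bigr => i _; rewrite !mxE eqxx /= (inj_eq (@lshift_inj _ _)) eq_sym.
  rewrite row_mxEr mxE big1 // => i _.
  by rewrite !mxE eq_sym eq_lrshift andbF mulr0.
rewrite E /point /zbase /ubase; congr (_, _); last first.
  by rewrite /= scaler0 !add0r [u%:A]mulr1.
have -> : row_mx x (const_mx t) = row_mx x 0 + t *: delta_mx 0 (tidx n).
  apply/rowP => l; rewrite [RHS]mxE [in X in _ = _ + X]mxE.
  case: (split_ordP l) => k ->.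
    by rewrite !row_mxEl mxE eq_lrshift andbF mulr0 addr0.
  by rewrite !row_mxEr !mxE (ord1 k) !eqxx mulr1 add0r.
by rewrite /= scaler0 addr0.
Qed.

Lemma smooth_point (V : normedModType R) (D : set V) (f : V -> 'rV[R]_n)
  (T U : V -> R) : open D -> (forall i, smooth_on D (fun y => f y 0 i)) ->
  smooth_on D T -> smooth_on D U -> smooth_on D (fun y => point (f y) (T y) (U y)).
Proof.
move=> oD sf sT sU.
pose F y := \sum_(i < n) f y 0 i *: zbase (xi_ i) + T y *: zbase (tidx n) + U y *: ubase.
apply: (smooth_eq oD (f := F)) => [y _|]; first by rewrite point_sum.
apply: smoothD => //; last exact: smoothZl.
apply: smoothD => //; last exact: smoothZl.
by apply: smooth_sum => // i _; exact: smoothZl.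
Qed.

Lemma is_derive_scalel (W : normedModType R) (f : R -> R) (f' s : R) (w : W) :
  is_derive s (1 : R) f f' -> is_derive s (1 : R) (fun y => f y *: w) (f' *: w).
Proof.
move=> Hf; have df : differentiable f s by apply/derivable1_diffP.
split; first by apply: diff_derivable; exact: differentiableZl.
by rewrite deriveE ?diffZl //; [rewrite -deriveE // derive_val|exact: differentiableZl].
Qed.

Lemma is_derive_point (f : R -> 'rV[R]_n) (f' : 'rV[R]_n)
  (T U : R -> R) (T' U' s : R) :
  (forall i, is_derive s (1 : R) (fun y => f y 0 i) (f' 0 i)) ->
  is_derive s (1 : R) T T' -> is_derive s (1 : R) U U' ->
  is_derive s (1 : R) (fun y => point (f y) (T y) (U y)) (point f' T' U').
Proof.
move=> Hf HT HU; rewrite point_sum.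
have H1 := is_derive_sum (fun i => is_derive_scalel (zbase (xi_ i)) (Hf i)).
have H2 := is_derive_scalel (zbase (tidx n)) HT.
have H3 := is_derive_scalel ubase HU.
have -> : (fun y => point (f y) (T y) (U y)) =
   (\sum_(i < n) (fun y => f y 0 i *: zbase (xi_ i))) + (fun y => T y *: zbase (tidx n))
   + (fun y => U y *: ubase).
  by apply: funext => y; rewrite point_sum !fctE fct_sumE.
exact: (@is_deriveD _ _ _ _ _ _ _ _ _ (@is_deriveD _ _ _ _ _ _ _ _ _ H1 H2) H3).
Qed.

Lemma is_derive_point_fixed_x (x : 'rV[R]_n) (T U : R -> R) (T' U' s : R) :
  is_derive s (1 : R) T T' -> is_derive s (1 : R) U U' ->
  is_derive s (1 : R) (fun y => point x (T y) (U y)) (point 0 T' U').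
Proof.
move=> HT HU; have Hx i : is_derive s (1 : R) (fun=> x 0 i) ((0 : 'rV[R]_n) 0 i).
  by rewrite mxE; exact: is_derive_const.
exact: is_derive_point Hx HT HU.
Qed.

Local Notation ept := (R * pt)%type.

Lemma continuous_snd_comp (W : topologicalType) (f : pt -> W) :
  continuous f -> continuous (fun ep : ept => f ep.2).
Proof.
move=> cf ep; apply: (continuous_comp (f := snd) (g := f)); last exact: cf.
exact: cvg_snd.
Qed.

Lemma open_everywhere : open (@everywhere R n).
Proof.
rewrite (_ : @everywhere R n = (fun ep : ept => ep.2) @^-1` space) //.
apply: open_comp open_space => ep _; exact: cvg_snd.
Qed.

Lemma smooth_param D : open D -> smooth_on D (fun ep : ept => ep.1).
Proof.
move=> oD; apply: smooth_linear_fun => //.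
by move=> ep; exact: cvg_fst.
Qed.

Lemma smooth_z D l : open D -> smooth_on D (fun ep : ept => ep.2.1 0 l).
Proof.
move=> oD; apply: smooth_linear_fun => //; first by move=> a y z; rewrite /= !mxE.
exact: continuous_snd_comp (@continuous_zcoord R n l).
Qed.

Lemma smooth_u D : open D -> smooth_on D (fun ep : ept => ep.2.2).
Proof.
move=> oD; apply: smooth_linear_fun => //.
exact: continuous_snd_comp (@continuous_ucoord R n).
Qed.

Lemma smooth_t D : open D -> smooth_on D (fun ep : ept => tc ep.2).
Proof. exact: smooth_z. Qed.

Lemma smooth_x D i : open D -> smooth_on D (fun ep : ept => xc ep.2 0 i).
Proof.
move=> oD; apply: (smooth_eq oD _ (smooth_z (xi_ i) oD)) => ep _.
by rewrite xcE.
Qed.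

Lemma smooth_continuous (V W : normedModType R) (f : V -> W) :
  smooth_on setT f -> continuous f.
Proof. by move=> sf y; apply: differentiable_continuous; exact: smooth_differentiable sf I. Qed.

Lemma open_positive (f : ept -> R) : continuous f -> open [set ep | 0 < f ep].
Proof.
move=> cf; rewrite (_ : [set _ | _] = f @^-1` [set x | 0 < x]) //.
by apply: open_comp (@open_gt R 0) => ep _; exact: cf.
Qed.

Lemma uc_point (x : 'rV[R]_n) t u : uc (point x t u) = u.
Proof. by []. Qed.

Lemma one_param_time : is_one_param_group (time_translation R n).
Proof.
split=> //=.
- exact: open_everywhere.
- have o := open_everywhere.
  apply: smooth_point => // [i||]; [exact: smooth_x| |exact: smooth_u].
  by apply: smoothD => //; [exact: smooth_t|exact: smooth_param].
- by move=> p _; rewrite addr0 pointE.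
- by move=> d e p *; rewrite xc_point tc_point ?uc_point -addrA [d + e]addrC.
- by move=> e p sp; split=> //; rewrite xc_point tc_point ?uc_point addrK pointE.
Qed.

Lemma generator_time : is_generator (time_translation R n) (fun=> point 0 1 0).
Proof.
move=> p sp.
have := is_derive_add (is_derive_const (tc p) 0 (1 : R)) (is_derive_id 0 (1 : R)).
by rewrite add0r => HT; exact: is_derive_point_fixed_x HT (is_derive_const (uc p) 0 (1 : R)).
Qed.

Lemma one_param_dilation (r : R) : is_one_param_group (dilation n r).
Proof.
split=> //=.
- exact: open_everywhere.
- by move=> e p sp; rewrite /Defs.space /= mulr_gt0 ?expR_gt0.
- have o := open_everywhere.
  apply: smooth_point => // [i||]; first exact: smooth_x.
    apply: smoothM => //; last exact: smooth_t.
    by apply: smooth_expR => //; exact: smooth_param.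
  apply: smoothM => //; last exact: smooth_u.
  apply: smooth_expR => //; apply: smoothM => //; first exact: smooth_param.
  exact: smooth_cst.
- by move=> p _; rewrite mul0r expR0 !mul1r pointE.
- move=> d e p *; rewrite xc_point tc_point ?uc_point !mulrA -!expRD.
  by rewrite mulrDl.
- move=> e p sp; split; first by rewrite /everywhere /Defs.space /= mulr_gt0 ?expR_gt0.
  by rewrite xc_point tc_point ?uc_point !mulrA -!expRD mulNr !addNr expR0 !mul1r pointE.
Qed.

Lemma generator_dilation (r : R) :
  is_generator (dilation n r) (fun p => point 0 (tc p) (r^-1 * uc p)).
Proof.
move=> p sp /=.
have H := is_derive_expR_linear r^-1 0.
have HT : is_derive (0 : R) (1 : R) (fun y => expR y * tc p) (tc p).
  apply: is_derive_eq (is_derive_mul (is_derive_expR 0) (is_derive_const (tc p) 0 (1 : R))) _.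
  by rewrite mulr0 add0r expR0 mulr1.
have HU : is_derive (0 : R) (1 : R) (fun y => expR (y / r) * uc p) (r^-1 * uc p).
  have -> : (fun y => expR (y / r) * uc p) = (fun y => expR (r^-1 * y) * uc p).
    by apply: funext => y; rewrite [y / r]mulrC.
  apply: is_derive_eq (is_derive_mul H (is_derive_const (uc p) 0 (1 : R))) _.
  by rewrite !mulr0 add0r expR0 mulr1 mulrC.
exact: is_derive_point_fixed_x HT HU.
Qed.

Lemma one_param_scaling : is_one_param_group (u_scaling R n).
Proof.
split=> //=.
- exact: open_everywhere.
- by move=> e p sp; rewrite /Defs.space /= mulr_gt0 ?expR_gt0.
- have o := open_everywhere.
  apply: smooth_point => // [i||]; [exact: smooth_x|exact: smooth_t|].
  apply: smoothM => //; last exact: smooth_u.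
  by apply: smooth_expR => //; exact: smooth_param.
- by move=> p _; rewrite expR0 mul1r pointE.
- by move=> d e p *; rewrite xc_point tc_point ?uc_point mulrA -expRD.
- move=> e p sp; split; first by rewrite /everywhere /Defs.space /= mulr_gt0 ?expR_gt0.
  by rewrite xc_point tc_point ?uc_point mulrA -expRD addNr expR0 mul1r pointE.
Qed.

Lemma generator_scaling : is_generator (u_scaling R n) (fun p => point 0 0 (uc p)).
Proof.
move=> p sp /=.
have HU : is_derive (0 : R) (1 : R) (fun y => expR y * uc p) (uc p).
  apply: is_derive_eq (is_derive_mul (is_derive_expR 0) (is_derive_const (uc p) 0 (1 : R))) _.
  by rewrite mulr0 add0r expR0 mulr1.
exact: is_derive_point_fixed_x (is_derive_const (tc p) 0 (1 : R)) HU.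
Qed.

Lemma one_param_superposition (b : 'rV[R]_(n + 1) -> R) : smooth_on setT b ->
  is_one_param_group (superposition b).
Proof.
move=> sb.
have sb' D : open D -> smooth_on D (fun ep : ept => b ep.2.1).
  move=> oD; apply: (smooth_linear_precomp oD (L := fun ep : ept => ep.2.1)) => //.
  by apply: continuous_snd_comp => p; exact: cvg_fst.
have pz p : row_mx (xc p) (const_mx (tc p)) = p.1.
  by rewrite -[in RHS](pointE p).
have cf : continuous (fun ep : ept => uc ep.2 + ep.1 * b ep.2.1).
  apply: smooth_continuous; apply: smoothD; [exact: openT|exact: smooth_u openT|].
  by apply: smoothM; [exact: openT|exact: smooth_param openT|exact: sb' openT].
have o : open (dom (superposition b)).
  rewrite (_ : dom _ = @everywhere R n `&` [set ep | 0 < uc ep.2 + ep.1 * b ep.2.1]) //.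
  by apply: openI; [exact: open_everywhere|exact: open_positive].
split=> //=.
- by move=> e p [].
- by move=> p sp; split=> //=; rewrite mul0r addr0.
- by move=> e p [].
- apply: smooth_point => // [i||]; [exact: smooth_x|exact: smooth_t|].
  apply: smoothD => //; first exact: smooth_u.
  by apply: smoothM => //; [exact: smooth_param|exact: sb'].
- by move=> p _; rewrite mul0r addr0 pointE.
- by move=> d e p _ _ _; rewrite /= pz xc_point tc_point ?uc_point mulrDl [e * _ + _]addrC addrA.
- move=> e p [sp ep]; rewrite /= pz xc_point tc_point ?uc_point mulNr addrK pointE.
  by split=> //; split.
Qed.

Lemma generator_superposition (b : 'rV[R]_(n + 1) -> R) :
  is_generator (superposition b) (fun p => point 0 0 (b p.1)).
Proof.
move=> p sp /=.
have HU : is_derive (0 : R) (1 : R) (fun y => uc p + y * b p.1) (b p.1).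
  apply: is_derive_eq (is_derive_add (is_derive_const (uc p) 0 (1 : R))
    (is_derive_mul (is_derive_id 0 (1 : R)) (is_derive_const (b p.1) 0 (1 : R)))) _.
  by rewrite mulr0 !add0r mulr1.
exact: is_derive_point_fixed_x (is_derive_const (tc p) 0 (1 : R)) HU.
Qed.

Lemma exp_time_clock (r s : R) : r != 0 -> 0 < s -> expR (- (r * (- r^-1 * ln s))) = s.
Proof. by move=> r0 s0; rewrite mulNr mulrN opprK mulrA divff // mul1r lnK ?posrE. Qed.

Lemma powR_gt0E (s a : R) : 0 < s -> s `^ a = expR (a * ln s).
Proof. by move=> s0; rewrite /powR gt_eqF. Qed.

(** In the coordinates [s = expR (- (r * t))] and [u * expR (- t)] the flow is
    the translation [s - r * e], with the second coordinate fixed. *)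
Lemma one_param_exp_time (r : R) : r != 0 -> is_one_param_group (exp_time n r).
Proof.
move=> r0.
have cs D : open D -> smooth_on D (fun ep : ept => expR (- (r * tc ep.2)) - r * ep.1).
  move=> oD; have sr : smooth_on D (fun _ : ept => r) by exact: smooth_cst.
  apply: smoothB => //; last by apply: smoothM => //; exact: smooth_param.
  apply: smooth_expR => //; apply: smoothN => //; apply: smoothM => //; exact: smooth_t.
have o : open (dom (exp_time n r)).
  rewrite (_ : dom _ = @everywhere R n `&` [set ep | 0 < expR (- (r * tc ep.2)) - r * ep.1]) //.
  apply: openI; first exact: open_everywhere.
  by apply: open_positive; apply: smooth_continuous; exact: cs openT.
have rr : r * r^-1 = 1 by rewrite divff.
split=> //=.
- by move=> e p [].
- by move=> p sp; split=> //=; rewrite mulr0 subr0 expR_gt0.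
- move=> e p [sp ep]; rewrite /Defs.space /=.
  by rewrite !mulr_gt0 ?expR_gt0 // powR_gt0.
- have pos ep : dom (exp_time n r) ep -> 0 < expR (- (r * tc ep.2)) - r * ep.1 by case.
  apply: smooth_point => // [i||]; first exact: smooth_x.
    by apply: smoothM => //; [exact: smooth_cst|apply: smooth_ln => //; exact: cs].
  apply: smoothM => //; last by apply: smooth_expR => //; apply: smoothN => //; exact: smooth_t.
  by apply: smoothM => //; [exact: smooth_u|apply: smooth_powR => //; exact: cs].
- move=> p sp; rewrite mulr0 subr0 powR_gt0E ?expR_gt0 // expRK.
  rewrite mulrNN mulrA mulVf // mul1r -mulrA -expRD subrr expR0 mulr1.
  exact: pointE.
- move=> d e p [sp dp] [_ /=]; rewrite tc_point exp_time_clock // => ep _.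
  rewrite xc_point ?uc_point mulrDr opprD [- (r * e) + _]addrC addrA.
  set s := _ - r * d in dp ep *; congr point.
  rewrite [s `^ _]powR_gt0E // mulNr opprK.
  have K : expR (- r^-1 * ln s) * expR (r^-1 * ln s) = 1 by rewrite -expRD mulNr addNr expR0.
  rewrite -[RHS]mulr1 -K mulNr; move: (expR _) (expR _) (expR _) (_ `^ _) => *.
  by ring.
- move=> e p [sp ep]; rewrite tc_point exp_time_clock // ?uc_point xc_point.
  rewrite mulrN opprK subrK; split; first split => /=.
  + by rewrite /Defs.space /= !mulr_gt0 ?expR_gt0 // powR_gt0.
  + exact: expR_gt0.
  set s := _ - r * e in ep *; rewrite expRK mulrNN mulrA mulVf // mul1r.
  rewrite !powR_gt0E ?expR_gt0 // expRK.
  have K : expR (- r^-1 * ln s) * expR (- (- r^-1 * ln s)) = 1 by rewrite -expRD subrr expR0.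
  have K2 : expR (- tc p) * expR (- r^-1 * - (r * tc p)) = 1.
    by rewrite -expRD mulrNN mulrA mulVf // mul1r addNr expR0.
  rewrite -[RHS]pointE; congr point.
  rewrite -[RHS]mulr1 -[in RHS]K -[RHS]mulr1 -[in RHS]K2.
  by move: (expR _) (expR _) (expR _) (expR _) => *; ring.
Qed.

Lemma generator_exp_time (r : R) : r != 0 -> is_generator (exp_time n r)
  (fun p => point 0 (expR (r * tc p)) (expR (r * tc p) * uc p)).
Proof.
move=> r0 p sp /=; pose E0 := expR (- (r * tc p)).
have E0_gt0 : 0 < E0 by exact: expR_gt0.
pose s e := E0 - r * e.
have s0 : s 0 = E0 by rewrite /s mulr0 subr0.
have Hs : is_derive (0 : R) (1 : R) s (- r).
  apply: is_derive_eq (is_derive_sub (is_derive_const E0 0 (1 : R))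
    (is_derive_mul (is_derive_const r 0 (1 : R)) (is_derive_id 0 (1 : R)))) _.
  by rewrite mulr0 addr0 mulr1 sub0r.
have ds : differentiable s 0 by apply/derivable1_diffP.
have spos : 0 < s 0 by rewrite s0.
have E0V : E0^-1 = expR (r * tc p) by rewrite /E0 expRN invrK.
have Hln : is_derive (0 : R) (1 : R) (fun e => ln (s e)) (E0^-1 * - r).
  have [dl e] := derive_real_comp (1 : R) ds (is_derive1_ln spos).
  split; first by apply/derivable1_diffP.
  by rewrite e s0 derive_val.
have HT : is_derive (0 : R) (1 : R) (fun e => - r^-1 * ln (s e)) (expR (r * tc p)).
  apply: is_derive_eq (is_derive_mul (is_derive_const (- r^-1) 0 (1 : R)) Hln) _.
  by rewrite mulr0 addr0 -E0V; field; rewrite r0 gt_eqF.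
have Hp := is_derive_powRc (- r^-1) (1 : R) ds spos.
have HU : is_derive (0 : R) (1 : R) (fun e => uc p * s e `^ (- r^-1) * expR (- tc p))
    (expR (r * tc p) * uc p).
  apply: is_derive_eq (is_derive_mul (is_derive_mul (is_derive_const (uc p) 0 (1 : R)) Hp)
    (is_derive_const (expR (- tc p)) 0 (1 : R))) _.
  rewrite s0 derive_val !mulr0 addr0 add0r powR_gt0E // {1}/E0 expRK.
  have -> : (- r^-1 - 1) * - (r * tc p) = tc p + r * tc p by field.
  rewrite expRD.
  have K : expR (- tc p) * expR (tc p) = 1 by rewrite -expRD addNr expR0.
  have rK : r^-1 * r = 1 by rewrite mulVf.
  rewrite -[RHS]mulr1 -K -[RHS]mulr1 -rK.
  by move: (expR _) (expR _) (expR _) (r^-1) => *; ring.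
exact: is_derive_point_fixed_x HT HU.
Qed.

End Flows.

(** * Rotations *)

Section Rotations.
Context {R : realType} {n : nat}.
Local Notation pt := (pt R n).
Local Notation ept := (R * pt)%type.
Implicit Types (p : pt) (A : R -> 'M[R]_n).

Lemma subgroup_SO0 A : one_param_subgroup_SO A -> A 0 = 1%:M.
Proof.
case=> SO AD _; have [AA _] := SO 0.
by rewrite -AA -{2}[0]addr0 AD -mulmxA; have := AD 0 0; rewrite addr0 => E; rewrite -{1}[A 0]mulmx1 -AA mulmxA -E.
Qed.

Lemma continuous_entry (i k : 'I_n) : continuous (fun M : 'M[R]_n => M i k).
Proof. exact: coord_continuous. Qed.

Lemma linear_entry (i k : 'I_n) : linear (fun M : 'M[R]_n => M i k).
Proof. by move=> a M N; rewrite !mxE. Qed.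

Lemma smooth_entry A i k : smooth_on setT A -> smooth_on setT (fun e => A e i k).
Proof.
exact: (smooth_linear_fun_comp openT (@linear_entry i k) (@continuous_entry i k)).
Qed.

Lemma derive_entry A i k : smooth_on setT A ->
  is_derive (0 : R) (1 : R) (fun e => A e i k) (('D_1 A 0) i k).
Proof.
move=> sA; have dA : differentiable A 0 by exact: smooth_differentiable sA I.
rewrite -(derive_linear_fun_comp _ (@linear_entry i k) (@continuous_entry i k) dA).
exact: smooth_is_derive (smooth_entry i k sA) I.
Qed.

Lemma one_param_rotation A : one_param_subgroup_SO A ->
  is_one_param_group (rotation A).
Proof.
move=> SOA; have A0 := subgroup_SO0 SOA; have [SO AD sA] := SOA.
have o := @open_everywhere R n.
have sE i k : smooth_on (@everywhere R n) (fun ep : ept => A ep.1 i k).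
  apply: (smooth_linear_precomp o (L := fst) _ _ (smooth_entry i k sA)) => // ep.
  exact: cvg_fst.
have AT e d : (A d)^T *m (A e)^T = (A (e + d))^T by rewrite AD trmx_mul.
split=> //=.
- apply: smooth_point => // [i||]; [|exact: smooth_t|exact: smooth_u].
  pose F (ep : ept) := \sum_(k < n) xc ep.2 0 k * A ep.1 i k.
  apply: (smooth_eq o (f := F)) => [ep _|].
    by rewrite [RHS]mxE; apply: eq_bigr => k _; congr (_ * _); rewrite [RHS]mxE.
  apply: smooth_sum => // k _; apply: smoothM => //; exact: smooth_x.
- by move=> p _; rewrite A0 trmx1 mulmx1 pointE.
- by move=> d e p *; rewrite xc_point tc_point ?uc_point -mulmxA AT.
- move=> e p sp; split=> //.
  by rewrite xc_point tc_point ?uc_point -mulmxA AT addNr A0 trmx1 mulmx1 pointE.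
Qed.

Lemma generator_rotation A : one_param_subgroup_SO A ->
  is_generator (rotation A) (fun p => point (xc p *m ('D_1 A 0)^T) 0 0).
Proof.
move=> [_ _ sA] p sp /=.
have Hx i : is_derive (0 : R) (1 : R) (fun e => (xc p *m (A e)^T) 0 i)
    ((xc p *m ('D_1 A 0)^T) 0 i).
  have := is_derive_bigsum (fun k => is_derive_mul (is_derive_const (xc p 0 k) 0 (1 : R)) (derive_entry i k sA)).
  have -> : (fun y => \sum_(k < n) xc p 0 k * A y i k) = (fun e => (xc p *m (A e)^T) 0 i).
    by apply: funext => e; rewrite [RHS]mxE; apply: eq_bigr => k _; congr (_ * _); rewrite [RHS]mxE.
  move=> H; apply: is_derive_eq H _; rewrite [RHS]mxE.
  by apply: eq_bigr => k _; rewrite mulr0 addr0; congr (_ * _); rewrite [RHS]mxE.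
exact: is_derive_point Hx (is_derive_const (tc p) 0 (1 : R)) (is_derive_const (uc p) 0 (1 : R)).
Qed.

(** The derivative of [A e *m (A e)^T = 1%:M] at [e = 0]. *)
Lemma subgroup_SO_antisym A : one_param_subgroup_SO A ->
  ('D_1 A 0)^T = - 'D_1 A 0.
Proof.
move=> SOA; have A0 := subgroup_SO0 SOA; have [SO AD sA] := SOA.
apply/matrixP => i k; rewrite [LHS]mxE [RHS]mxE.
have E e : \sum_(l < n) A e i l * A e k l = (i == k)%:R.
  have [AA _] := SO e; have /matrixP/(_ i k) := AA; rewrite !mxE => <-.
  by apply: eq_bigr => l _; rewrite [in RHS]mxE.
have H := is_derive_bigsum (fun l => is_derive_mul (derive_entry i l sA) (derive_entry k l sA)).
have := derive_ext_on openT (fun e _ => E e) I H (is_derive_const (i == k)%:R 0 (1 : R)).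
rewrite A0 big_split /=.
have D (a b : 'I_n) : \sum_(l < n) (1%:M : 'M[R]_n) a l * ('D_1 A 0) b l = ('D_1 A 0) b a.
  rewrite -[RHS](sum_delta_l (fun l => ('D_1 A 0) b l)); apply: eq_bigr => l _.
  by rewrite mxE eq_sym.
by rewrite !D => /eqP; rewrite addr_eq0 => /eqP.
Qed.

Section PlanarRotations.
Variables (i k : 'I_n).
Hypothesis ik : i != k.

Definition plane_projection : 'M[R]_n := delta_mx i i + delta_mx k k.
Definition plane_turn : 'M[R]_n := delta_mx i k - delta_mx k i.
Local Notation P := plane_projection.
Local Notation J := plane_turn.

(** The rotation by [e] in the plane of the axes [i] and [k], on which [P]
    projects and [J] acts as a quarter turn. *)
Definition planar_rotation (e : R) : 'M[R]_n := 1%:M + (cos e - 1) *: P + sin e *: J.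

Let dmul (a b c d : 'I_n) : delta_mx a b *m delta_mx c d = (b == c)%:R *: delta_mx a d :> 'M[R]_n.
Proof.
case: (eqVneq b c) => [->|bc]; first by rewrite mul_delta_mx scale1r.
by rewrite mul_delta_mx_0 // scale0r.
Qed.

Let ki : (k == i) = false.
Proof. by rewrite eq_sym (negbTE ik). Qed.

Let PP : P *m P = P.
Proof.
rewrite /P mulmxDl !mulmxDr !dmul !eqxx ki (negbTE ik) !scale1r !scale0r.
by rewrite addr0 add0r.
Qed.

Let PJ : P *m J = J.
Proof.
rewrite /P /J mulmxDl !mulmxBr !dmul !eqxx ki (negbTE ik) !scale1r !scale0r.
by rewrite subr0 sub0r.
Qed.

Let JP : J *m P = J.
Proof.
rewrite /P /J mulmxBl !mulmxDr !dmul !eqxx ki (negbTE ik) !scale1r !scale0r.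
by rewrite add0r addr0.
Qed.

Let JJ : J *m J = - P.
Proof.
rewrite /P /J mulmxBl !mulmxBr !dmul !eqxx ki (negbTE ik) !scale1r !scale0r.
by rewrite sub0r subr0 opprD addrC.
Qed.

Let PT : P^T = P.
Proof. by rewrite /P linearD /= !trmx_delta. Qed.

Let JT : J^T = - J.
Proof. by rewrite /J linearB /= !trmx_delta opprB. Qed.

Lemma planar_rotationD d e :
  planar_rotation (d + e) = planar_rotation d *m planar_rotation e.
Proof.
rewrite /planar_rotation !mulmxDl !mulmxDr !mul1mx !mulmx1.
rewrite -!scalemxAl -!scalemxAr PP PJ JP JJ cosD sinD !scalerA !scalerN.
by apply/matrixP => a b; rewrite !mxE; ring.
Qed.

Lemma planar_rotation0 : planar_rotation 0 = 1%:M.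
Proof. by rewrite /planar_rotation cos0 sin0 subrr !scale0r !addr0. Qed.

Lemma planar_rotationT e : (planar_rotation e)^T = planar_rotation (- e).
Proof.
have T (a b : R) (M N : 'M[R]_n) : (1%:M + a *: M + b *: N)^T = 1%:M + a *: M^T + b *: N^T.
  by rewrite !linearD /= !linearZ /= trmx1.
by rewrite /planar_rotation cosN sinN T PT JT scalerN scaleNr.
Qed.

Lemma planar_orthogonal e : planar_rotation e *m (planar_rotation e)^T = 1%:M.
Proof. by rewrite planar_rotationT -planar_rotationD subrr planar_rotation0. Qed.

(** The rotation is the square of the one by half the angle. *)
Lemma planar_det e : \det (planar_rotation e) = 1.
Proof.
rewrite -[e](@divfK _ 2) ?pnatr_eq0 // mulr_natr mulr2n planar_rotationD det_mulmx.
by have := congr1 determinant (planar_orthogonal (e / 2)); rewrite det_mulmx det_tr det1.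
Qed.

Let is_derive_planar (M N K : 'M[R]_n) (e : R) :
  is_derive e (1 : R) (fun e => M + cos e *: N + sin e *: K)
    (0 + (- sin e) *: N + cos e *: K).
Proof.
have H1 := is_derive_scalel N (is_derive_cos e).
have H2 := is_derive_scalel K (is_derive_sin e).
have H0 : is_derive e (1 : R) (fun=> M) 0 by exact: is_derive_cst.
exact: (@is_deriveD _ _ _ _ _ _ _ _ _ (@is_deriveD _ _ _ _ _ _ _ _ _ H0 H1) H2).
Qed.

Lemma planar_subgroup : one_param_subgroup_SO planar_rotation.
Proof.
split=> [e|d e|]; first by split; [exact: planar_orthogonal|exact: planar_det].
  exact: planar_rotationD.
  (* a class of functions closed under differentiation *)
pose S (f : R -> 'M[R]_n) := exists M N K, f = (fun e => M + cos e *: N + sin e *: K).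
apply: (smooth_coind openT (S := S)); last first.
  exists (1%:M - P), P, J; apply: funext => e.
  by rewrite /planar_rotation scalerBl scale1r addrA addrAC.
move=> _ [M [N [K ->]]]; split=> [e _|w].
  by apply/derivable1_diffP; case: (is_derive_planar M N K e).
exists (fun e => 0 + cos e *: (w *: K) + sin e *: (- w *: N)).
  by exists 0, (w *: K), (- w *: N).
move=> e _; have H := is_derive_planar M N K e.
have de : differentiable (fun e => M + cos e *: N + sin e *: K) e.
  by apply/derivable1_diffP; case: H.
rewrite (deriveE _ de) -[w in 'd _ _ w]mulr1 -[w * 1]/(w *: (1 : R)) linearZ /=.
rewrite -(deriveE _ de) derive_val !add0r scalerDr !scalerA addrC.
by congr (_ *: _ + _ *: _); ring.
Qed.

Lemma derive_planar : 'D_1 planar_rotation 0 = J.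
Proof.
have -> : planar_rotation = (fun e => (1%:M - P) + cos e *: P + sin e *: J).
  by apply: funext => e; rewrite /planar_rotation scalerBl scale1r addrA addrAC.
have H := is_derive_planar (1%:M - P) P J 0.
by rewrite derive_val sin0 cos0 oppr0 scale0r !add0r scale1r.
Qed.

End PlanarRotations.
End Rotations.

(** * Generation and normal forms *)

Section GeneratorSmooth.
Context {R : realType} {n : nat}.
Local Notation pt := (pt R n).
Local Notation ept := (R * pt)%type.

(** The generator is the derivative of the smooth map [flow] in its parameter,
    restricted to the slice [e = 0]. *)
Lemma generator_smooth (G : local_flow R n) v :
  is_one_param_group G -> is_generator G v -> smooth_on space v.
Proof.
move=> opg gen.
pose F (ep : ept) := Defs.flow G ep.1 ep.2.
have sF' := smooth_derive ((1, 0) : ept) (opg_smooth opg).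
pose L (p : pt) : ept := (0, p).
have lL : linear L by move=> a p p'; rewrite /L; congr (_, _); rewrite /= scaler0 addr0.
have cL : continuous L.
  move=> p; apply: differentiable_continuous; rewrite /L.
  by apply: (differentiable_pair (f := cst 0) (g := id)).
have DD p : space p -> Defs.dom G (L p + 0).
  by move=> sp; rewrite addr0; exact: opg_dom0 opg _ sp.
apply: (smooth_eq open_space _ (smooth_affine open_space lL cL DD sF')) => p sp.
rewrite addr0 -(@derive_val _ _ _ _ _ _ _ (gen p sp)).
by apply: eq_derive_lines => h; rewrite /= scaler0 add0r.
Qed.

End GeneratorSmooth.

Section Generation.
Context {R : realType} {n : nat}.
Local Notation pt := (pt R n).
Variable L : set (local_flow R n).
Implicit Types (v w : pt -> pt).

Lemma generated_ext v w : (forall p, space p -> v p = w p) ->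
  generated_by L w -> generated_by L v.
Proof.
move=> vw [k [h [f [c [H E]]]]]; exists k, h, f, c; split=> // p sp.
by rewrite vw // E.
Qed.

Lemma generated0 : generated_by L (fun=> 0).
Proof.
exists 0%N, (fun i : 'I_0 => match i with Ordinal _ H => match notF H with end end),
  (fun=> fun=> 0), (fun=> 0); split=> [[]//|p sp].
by rewrite big_ord0.
Qed.

Lemma generated_generator G w : L G -> is_generator G w -> generated_by L w.
Proof.
move=> LG Gw; exists 1%N, (fun=> G), (fun=> w), (fun=> 1); split=> // p sp.
by rewrite big_ord1 scale1r.
Qed.

Lemma generatedZ a v : generated_by L v -> generated_by L (fun p => a *: v p).
Proof.
move=> [k [h [f [c [H E]]]]]; exists k, h, f, (fun i => a * c i); split=> // p sp.
by rewrite E // scaler_sumr; apply: eq_bigr => i _; rewrite scalerA.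
Qed.

Lemma generatedD v w : generated_by L v -> generated_by L w ->
  generated_by L (fun p => v p + w p).
Proof.
move=> [k1 [h1 [f1 [c1 [H1 E1]]]]] [k2 [h2 [f2 [c2 [H2 E2]]]]].
pose glue T (a : 'I_k1 -> T) (b : 'I_k2 -> T) (i : 'I_(k1 + k2)) :=
  match fintype.split i with inl j => a j | inr j => b j end.
have glueL T a b j : @glue T a b (lshift k2 j) = a j by rewrite /glue (unsplitK (inl _)).
have glueR T a b j : @glue T a b (rshift k1 j) = b j by rewrite /glue (unsplitK (inr _)).
exists (k1 + k2)%N, (glue _ h1 h2), (glue _ f1 f2), (glue _ c1 c2); split=> [i|p sp].
  by case: (split_ordP i) => j ->; rewrite ?glueL ?glueR.
rewrite big_split_ord E1 // E2 //.
by congr (_ + _); apply: eq_bigr => i _; rewrite ?glueL ?glueR.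
Qed.

Lemma generated_sum (I : eqType) (s : seq I) (P : pred I) (f : I -> pt -> pt) :
  (forall i, P i -> generated_by L (f i)) ->
  generated_by L (fun p => \sum_(i <- s | P i) f i p).
Proof.
move=> H; elim: s => [|i s IH].
  by apply: generated_ext generated0 => p _; rewrite big_nil.
case: (boolP (P i)) => Pi; last first.
  by apply: generated_ext IH => p _; rewrite big_cons (negbTE Pi).
by apply: generated_ext (generatedD (H i Pi) IH) => p _; rewrite big_cons Pi.
Qed.

Lemma pointD (x : 'rV[R]_n) t u x' t' u' :
  point x t u + point x' t' u' = point (x + x') (t + t') (u + u').
Proof.
rewrite /point; congr (_, _); rewrite /= add_row_mx; congr row_mx.
by apply/matrixP => a b; rewrite !mxE.
Qed.

Lemma pointZ a (x : 'rV[R]_n) t u : a *: point x t u = point (a *: x) (a * t) (a * u).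
Proof.
rewrite /point; congr (_, _); rewrite /= scale_row_mx; congr row_mx.
by apply/matrixP => b c; rewrite !mxE.
Qed.

Lemma point0 : point (0 : 'rV[R]_n) 0 0 = 0.
Proof.
rewrite /point; congr (_, _); apply/rowP => l.
by case: (split_ordP l) => k ->; rewrite ?row_mxEl ?row_mxEr !mxE.
Qed.

Hypothesis rotL : @rotations R n `<=` L.

(** The generators [plane_turn i k] of the planar rotations span the
    antisymmetric matrices. *)
Lemma generated_rotation (B : 'M[R]_n) : B^T = - B ->
  generated_by L (fun p => point (xc p *m B) 0 0).
Proof.
move=> Bas.
  (* The sum counts each pair of axes twice, whence the factor 1/2; the
     transpose of [plane_turn i k] is its opposite, whence the sign. *)
have EB : B = \sum_(i < n) \sum_(k < n | i != k) (- (B i k / 2)) *: (plane_turn (R := R) i k)^T.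
  have -> : \sum_(i < n) \sum_(k < n | i != k) (- (B i k / 2)) *: (plane_turn (R := R) i k)^T
    = \sum_(i < n) \sum_(k < n) (2^-1 *: (B i k *: delta_mx i k) - 2^-1 *: (B i k *: delta_mx k i)).
    apply: eq_bigr => i _; rewrite [RHS](bigID (fun k => i != k)) /=.
    rewrite [X in _ = _ + X]big1 ?addr0 => [|k]; last by rewrite negbK => /eqP ->; rewrite subrr.
    apply: eq_bigr => k _; rewrite /plane_turn linearB /= !trmx_delta scalerBr !scalerA.
    by rewrite !scaleNr opprK addrC [2^-1 * _]mulrC.
  have E1 : \sum_(i < n) \sum_(k < n) (2^-1 *: (B i k *: delta_mx i k)) = 2^-1 *: B.
    under eq_bigr do rewrite -scaler_sumr; rewrite -scaler_sumr; congr (_ *: _).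
    by rewrite -matrix_sum_delta.
  have E2 : \sum_(i < n) \sum_(k < n) (2^-1 *: (B i k *: delta_mx k i)) = 2^-1 *: B^T.
    under eq_bigr do rewrite -scaler_sumr; rewrite -scaler_sumr; congr (_ *: _).
    rewrite exchange_big [RHS]matrix_sum_delta /=; apply: eq_bigr => i _.
    by apply: eq_bigr => k _; rewrite mxE.
  under eq_bigr do rewrite sumrB; rewrite sumrB E1 E2 Bas scalerN opprK -scalerDl.
  by rewrite -[2^-1 + _](_ : 1 = _) ?scale1r //; lra.
have H i : generated_by L (fun p => \sum_(k < n | i != k)
    (- (B i k / 2)) *: point (xc p *m (plane_turn (R := R) i k)^T) 0 0).
  apply: generated_sum => k ik; apply: generatedZ.
  have SO := planar_subgroup (R := R) ik.
  apply: (@generated_generator (rotation (planar_rotation i k))).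
    by apply: rotL; exists (planar_rotation i k).
  by have := generator_rotation SO; rewrite derive_planar.
apply: generated_ext (generated_sum (index_enum 'I_n) (P := predT) (fun i _ => H i)) => p _.
rewrite {1}EB mulmx_sumr.
have P0 (I : finType) (P : pred I) (f : I -> 'rV[R]_n) :
    point (\sum_(i | P i) f i) 0 0 = \sum_(i | P i) point (f i) 0 0.
  elim/big_rec2: _ => [|i y1 y2 _ <-]; first exact: point0.
  by rewrite pointD !addr0.
rewrite P0; apply: eq_bigr => i _; rewrite mulmx_sumr P0; apply: eq_bigr => k _.
by rewrite pointZ !mulr0 scalemxAr.
Qed.

End Generation.

Section NormalForm.
Context {R : realType} {n : nat}.
Local Notation pt := (pt R n).
Local Notation fld := ('rV[R]_(n + 1) -> R).
Implicit Types (v w : pt -> pt).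

(** The common shape of the generators: an infinitesimal rotation, a time
    translation, a multiple of the generator [(T, S * u)] of one special group, and a
    superposition term [h]. *)
Definition normal_form (T S : R -> R) (hs : fld -> Prop) v : Prop :=
  exists (B : 'M[R]_n) (c k : R) (h : fld), [/\ B^T = - B, hs h &
    forall p, space p -> v p = point (xc p *m B) (c + k * T (tc p))
                                     (k * S (tc p) * uc p + h p.1)].

(** What the superposition terms need for the normal forms to be closed under
    linear combinations. *)
Definition linear_family (hs : fld -> Prop) :=
  hs (fun=> 0) /\ forall a h h', hs h -> hs h' -> hs (fun z => a * h z + h' z).

Lemma normal_form_combination T S hs a v w : linear_family hs ->
  normal_form T S hs v -> normal_form T S hs w ->
  normal_form T S hs (fun p => a *: v p + w p).
Proof.
move=> [_ hsL] [B [c [k [h [HB Hh E]]]]] [B' [c' [k' [h' [HB' Hh' E']]]]].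
exists (a *: B + B'), (a * c + c'), (a * k + k'), (fun z => a * h z + h' z); split.
- by rewrite linearD /= linearZ /= HB HB' scalerN opprD.
- exact: hsL.
- move=> p sp; rewrite E // E' // pointZ pointD mulmxDr -scalemxAr.
  by congr (point _ _ _); ring.
Qed.

Lemma normal_form0 T S hs : linear_family hs -> normal_form T S hs (fun=> 0).
Proof.
move=> [hs0 _]; exists 0, 0, 0, (fun=> 0); split=> //; first by rewrite trmx0 oppr0.
by move=> p sp; rewrite mulmx0 !mul0r !addr0 point0.
Qed.

Lemma normal_form_ext T S hs v w : (forall p, space p -> v p = w p) ->
  normal_form T S hs w -> normal_form T S hs v.
Proof.
move=> vw [B [c [k [h [HB Hh E]]]]]; exists B, c, k, h; split=> // p sp.
by rewrite vw // E.
Qed.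

Lemma normal_form_generated T S hs (L : set (local_flow R n)) v :
  linear_family hs ->
  (forall G w, L G -> is_generator G w -> normal_form T S hs w) ->
  generated_by L v -> normal_form T S hs v.
Proof.
move=> lin H [k [h [w [c [Hw E]]]]].
have K (s : seq 'I_k) : normal_form T S hs (fun p => \sum_(i <- s) c i *: w i p).
  elim: s => [|i s IH].
    by apply: normal_form_ext (normal_form0 T S lin) => p _; rewrite big_nil.
  have [Lh gh] := Hw i.
  apply: normal_form_ext (normal_form_combination (c i) lin (H _ _ Lh gh) IH) => p _.
  by rewrite big_cons.
exact: normal_form_ext E (K _).
Qed.

Lemma generator_unique (G : local_flow R n) v w p :
  is_generator G v -> is_generator G w -> space p -> v p = w p.
Proof.
move=> gv gw sp; rewrite -(@derive_val _ _ _ _ _ _ _ (gv p sp)).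
exact: (@derive_val _ _ _ _ _ _ _ (gw p sp)).
Qed.

Lemma normal_time T S hs w : hs (fun=> 0) ->
  is_generator (time_translation R n) w -> normal_form T S hs w.
Proof.
move=> hs0 gw; exists 0, 1, 0, (fun=> 0); split=> //; first by rewrite trmx0 oppr0.
move=> p sp; rewrite (generator_unique gw generator_time sp).
by rewrite mulmx0 !mul0r !addr0.
Qed.

Lemma normal_rotation T S hs A w : hs (fun=> 0) -> one_param_subgroup_SO A ->
  is_generator (rotation A) w -> normal_form T S hs w.
Proof.
move=> hs0 SO gw; exists ('D_1 A 0)^T, 0, 0, (fun=> 0); split=> //.
  by rewrite (subgroup_SO_antisym SO) linearN /= (subgroup_SO_antisym SO).
move=> p sp; rewrite (generator_unique gw (generator_rotation SO) sp).
by rewrite !mul0r !addr0.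
Qed.

Lemma normal_special T S hs G w : hs (fun=> 0) ->
  is_generator G (fun p => point 0 (T (tc p)) (S (tc p) * uc p)) ->
  is_generator G w -> normal_form T S hs w.
Proof.
move=> hs0 gG gw; exists 0, 0, 1, (fun=> 0); split=> //; first by rewrite trmx0 oppr0.
move=> p sp; rewrite (generator_unique gw gG sp).
by rewrite mulmx0 !mul1r add0r addr0.
Qed.

Lemma generated_normal_form (L : set (local_flow R n)) T S hs v :
  L (time_translation R n) -> @rotations R n `<=` L ->
  generated_by L (fun p => point 0 (T (tc p)) (S (tc p) * uc p)) ->
  (forall h, hs h -> generated_by L (fun p => point 0 0 (h p.1))) ->
  normal_form T S hs v -> generated_by L v.
Proof.
move=> Lt Lr Ls Lh [B [c [k [h [HB Hh E]]]]].
have G1 := generated_rotation Lr HB.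
have G2 := generatedZ c (generated_generator Lt generator_time).
have G3 := generatedZ k Ls.
apply: generated_ext (generatedD (generatedD G1 G2) (generatedD G3 (Lh h Hh))) => p sp.
rewrite E // !pointZ !pointD; congr (point _ _ _).
- by rewrite !scaler0 !addr0.
- by rewrite mulr1 add0r addr0.
- by rewrite mulr0 !add0r mulrA.
Qed.

(** The conditions on [T] and [S] and those on [hs] are imposed separately,
    because the criterion is linear in the field. *)
Lemma symmetry_of_normal_form (q r : R) (T S T' S' : R -> R) hs v :
  (forall t, is_derive t (1 : R) T (T' t)) ->
  (forall t, is_derive t (1 : R) S (S' t)) ->
  (forall t, r * S t = T' t) ->
  (forall t u, 0 < u -> u `^ r * (S' t * u) + (1 - q) * u `^ q * S t = 0) ->
  (forall h, hs h -> [/\ sm (fun p : pt => h p.1), forall z, r * h z = 0 &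
     forall p, space p -> p.2 `^ r * dz (tidx n) (fun p : pt => h p.1) p
       - laplacian (fun p : pt => h p.1) p - q * p.2 `^ (q - 1) * h p.1 = 0]) ->
  normal_form T S hs v ->
  is_infinitesimal_symmetry (heat q r) v /\ fixes_north_pole v.
Proof.
move=> dT dS rS bal Hhs [B [c [k [h [HB /Hhs[sh hr hE] E]]]]].
have dE t : is_derive t (1 : R) (fun t => c + k * T t) (k * T' t).
  apply: is_derive_eq (is_derive_add (is_derive_const c t (1 : R))
    (is_derive_mul (is_derive_const k t (1 : R)) (dT t))) _.
  by rewrite mulr0 addr0 add0r.
have dS' t : is_derive t (1 : R) (fun t => k * S t) (k * S' t).
  apply: is_derive_eq (is_derive_mul (is_derive_const k t (1 : R)) (dS t)) _.
  by rewrite mulr0 addr0.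
split; last exact: (@fixes_of_normal_form _ _ v B (fun t => c + k * T t) (fun t => k * S t) h E).
apply: (symmetric_of_normal_form E HB dE dS' sh _ hr) => [t|p sp].
  by rewrite mulrCA rS.
have H1 := hE p sp; have H2 := bal (tc p) p.2 sp.
have {}H2 := congr1 (fun z => k * z) H2; rewrite /= mulr0 in H2.
rewrite -[RHS]addr0 -{1}H1 -H2.
by move: (dz _ _ _) (laplacian _ _) (h p.1) => x y z; ring.
Qed.

Lemma symmetry_groups_of_normal_form (q r : R) (L : set (local_flow R n)) NF :
  (forall G, L G -> is_one_param_group G /\ exists v, is_generator G v) ->
  (forall v, smooth_on space v -> is_infinitesimal_symmetry (heat q r) v ->
     fixes_north_pole v -> NF v) ->
  (forall v, NF v -> is_infinitesimal_symmetry (heat q r) v /\ fixes_north_pole v) ->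
  (forall v, NF v -> generated_by L v) ->
  (forall v, generated_by L v -> NF v) ->
  symmetry_groups_generated_by q r L.
Proof.
move=> HL nec suf gen norm; split=> // G v opg gv; split=> [[sym fix_]|/norm/suf //].
by apply: gen; apply: nec => //; exact: generator_smooth opg gv.
Qed.

End NormalForm.

(** * The symmetry groups *)

Section LinearSolutions.
Context {R : realType} {n : nat}.
Local Notation pt := (pt R n).
Local Notation fld := ('rV[R]_(n + 1) -> R).

(** The superposition terms of the equations that are not linear. *)
Definition trivial_family (h : fld) : Prop := forall z, h z = 0.

Lemma linear_trivial_family : linear_family trivial_family.
Proof. by split=> // a h h' H H' z; rewrite H H' mulr0 addr0. Qed.

Lemma trivial_family_equation (q r : R) h : trivial_family h ->
  [/\ sm (fun p : pt => h p.1), forall z, r * h z = 0 &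
     forall p, space p -> p.2 `^ r * dz (tidx n) (fun p : pt => h p.1) p
       - laplacian (fun p : pt => h p.1) p - q * p.2 `^ (q - 1) * h p.1 = 0].
Proof.
move=> h0; have H0 (p : pt) : space p -> h p.1 = 0 by move=> _; exact: h0.
split=> [|z|p sp]; last 2 first.
- by rewrite h0 mulr0.
- have D l y (sy : space y) : dz l (fun p : pt => h p.1) y = 0 := dz_const0 l H0 sy.
  rewrite h0 D // !mulr0 subr0 /laplacian /flat_laplacian /radial_derivative.
  rewrite !big1 ?mulr0 ?subrr // => i _; first by rewrite D // mulr0.
  by apply: dz_const0 sp => y sy; exact: D.
by apply: (smooth_eq open_space (f := fun=> 0)) => [p /H0//|]; apply: smooth_cst; exact: open_space.
Qed.

Lemma smooth_fst (b : fld) : smooth_on setT b -> sm (fun p : pt => b p.1).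
Proof.
move=> sb; apply: (smooth_linear_precomp open_space (L := fst) _ _ sb) => // p.
exact: cvg_fst.
Qed.

Lemma laplace_beltrami_jet (b : fld) (p : pt) :
  laplace_beltrami (jet_of b p.1) = laplacian (fun p : pt => b p.1) p.
Proof.
have D l : dz l (fun p : pt => b p.1) = (fun p => 'D_(delta_mx 0 l) b p.1).
  by apply: funext => y; exact: dz_fst.
rewrite laplace_beltramiE /laplacian /flat_laplacian /radial_derivative.
congr (_ * _ - _ * (_ * _)); apply: eq_bigr => i _; rewrite /j1 /j2 /jet_of /= mxE.
  by rewrite D [RHS](dz_fst ('D_(delta_mx 0 (lshift 1 i)) b)).
by rewrite D.
Qed.

Lemma linear_solutionP (b : fld) : linear_solution b <->
  smooth_on setT b /\ forall p : pt, space p ->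
    dz (tidx n) (fun p : pt => b p.1) p = laplacian (fun p : pt => b p.1) p + b p.1.
Proof.
have E (p : pt) : j1 (jet_of b p.1) 0 (tidx n) = dz (tidx n) (fun p : pt => b p.1) p.
  by rewrite /j1 /jet_of /= mxE dz_fst.
split=> [[sb H]|[sb H]]; split=> //.
  by move=> p sp; rewrite -E -laplace_beltrami_jet; exact: H.
move=> z; have := H ((z, 1) : pt) ltr01.
by rewrite -E -laplace_beltrami_jet.
Qed.

Lemma dz_combination (f g : pt -> R) a l p : sm f -> sm g -> space p ->
  dz l (fun p => a * f p + g p) p = a * dz l f p + dz l g p.
Proof.
move=> sf sg sp; rewrite dzE; apply: derive_val.
apply: is_derive_eq (is_derive_add (is_derive_mul (is_derive_const a p _) (is_derive_dz l sf sp))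
  (is_derive_dz l sg sp)) _.
by rewrite mulr0 addr0.
Qed.

Lemma laplacian_combination (f g : pt -> R) a p : sm f -> sm g -> space p ->
  laplacian (fun p => a * f p + g p) p = a * laplacian f p + laplacian g p.
Proof.
move=> sf sg sp.
have [F EF] : exists F, F = (fun p => a * f p + g p) by exact: (ex_intro _ _ erefl).
have D l y (sy : space y) : dz l F y = a * dz l f y + dz l g y.
  by rewrite EF; exact: dz_combination.
have DD l : dz l (dz l F) p = a * dz l (dz l f) p + dz l (dz l g) p.
  rewrite (dz_eq l (fun y sy => D l y sy) sp).
  exact: dz_combination (smooth_dz l sf) (smooth_dz l sg) sp.
have E1 : flat_laplacian F p = a * flat_laplacian f p + flat_laplacian g p.
  by rewrite /flat_laplacian mulr_sumr -big_split; apply: eq_bigr => i _; exact: DD.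
have E2 : radial_derivative F p = a * radial_derivative f p + radial_derivative g p.
  rewrite /radial_derivative mulr_sumr -big_split; apply: eq_bigr => i _ /=.
  by rewrite (D _ _ sp) mulrDr mulrCA.
rewrite -EF /laplacian E1 E2; move: (flat_laplacian f p) (flat_laplacian g p)
  (radial_derivative f p) (radial_derivative g p) => *.
by ring.
Qed.

Lemma linear_family_solutions : linear_family (@linear_solution R n).
Proof.
split.
  apply/linear_solutionP; split; first by apply: smooth_cst; exact: openT.
  have [_ _ H] := @trivial_family_equation 1 0 (fun=> 0) (fun _ => erefl).
  move=> p sp; have := H p sp; rewrite powRr0 mul1r mulr0 subr0 addr0 => /eqP.
  by rewrite subr_eq0 => /eqP.
move=> a h h' /linear_solutionP[sh Eh] /linear_solutionP[sh' Eh'].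
apply/linear_solutionP; split=> [|p sp].
  apply: smoothD => //; first exact: openT.
  by apply: smoothM => //; [exact: openT|apply: smooth_cst; exact: openT].
have s1 := smooth_fst sh; have s2 := smooth_fst sh'.
rewrite (dz_combination a _ s1 s2 sp) (laplacian_combination a s1 s2 sp) Eh // Eh' //.
move: (laplacian _ _) (laplacian _ _) => x y.
by ring.
Qed.

End LinearSolutions.

Section SymmetryGroups.
Context {R : realType} {n : nat} (q r : R).
Local Notation pt := (pt R n).
Local Notation rigid_motions := (time_translation R n |` rotations R n).

Lemma rigid_motions_groups G : rigid_motions G ->
  is_one_param_group G /\ exists v, is_generator G v.
Proof.
case=> [->|[A SO ->]].
  by split; [exact: one_param_time|eexists; exact: generator_time].
by split; [exact: one_param_rotation|eexists; exact: generator_rotation SO].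
Qed.

Lemma normal_rigid_motion T S hs G (w : pt -> pt) : hs (fun=> 0) ->
  rigid_motions G -> is_generator G w -> normal_form T S hs w.
Proof. by move=> hs0 [->|[A SO ->]]; [exact: normal_time|exact: normal_rotation]. Qed.

Lemma generated_trivial (L : set (local_flow R n)) h : @trivial_family R n h ->
  generated_by L (fun p => point 0 0 (h p.1)).
Proof. by move=> h0; apply: generated_ext (generated0 _) => p _; rewrite h0 point0. Qed.

(** For equations without a special transformation; [T] and [S] are taken to be
    zero, so that every multiple of their field is zero as well. *)
Lemma symmetry_groups_rigid :
  (forall v : pt -> pt, smooth_on space v ->
     is_infinitesimal_symmetry (heat q r) v -> fixes_north_pole v ->
     exists (B : 'M[R]_n) (c : R), B^T = - B /\
       forall p, space p -> v p = point (xc p *m B) c 0) ->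
  symmetry_groups_generated_by q r rigid_motions.
Proof.
move=> nec; have dc t : is_derive t (1 : R) (fun=> 0 : R) 0 := is_derive_const 0 t (1 : R).
apply: (symmetry_groups_of_normal_form
  (NF := normal_form (fun=> 0) (fun=> 0) (@trivial_family R n))).
- exact: rigid_motions_groups.
- move=> v sv sym fx; have [B [c [HB E]]] := nec v sv sym fx.
  exists B, c, 0, (fun=> 0); split=> // p sp.
  by rewrite E // !mul0r !addr0.
- move=> v; apply: (symmetry_of_normal_form (T' := fun=> 0) (S' := fun=> 0) dc dc) => [t|t u _|h].
  + by rewrite mulr0.
  + by rewrite mul0r !mulr0 addr0.
  + exact: trivial_family_equation.
- move=> v; apply: generated_normal_form => [|G||h]; last exact: generated_trivial.
  + by left.
  + by right.
  + by apply: generated_ext (generated0 _) => p _; rewrite mul0r point0.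
- move=> v; apply: normal_form_generated; first exact: linear_trivial_family.
  by move=> G w; apply: normal_rigid_motion.
Qed.

Lemma symmetry_groups_special (G : local_flow R n) (T S T' S' : R -> R) :
  is_one_param_group G ->
  is_generator G (fun p => point 0 (T (tc p)) (S (tc p) * uc p)) ->
  (forall t, is_derive t (1 : R) T (T' t)) ->
  (forall t, is_derive t (1 : R) S (S' t)) ->
  (forall t, r * S t = T' t) ->
  (forall t u, 0 < u -> u `^ r * (S' t * u) + (1 - q) * u `^ q * S t = 0) ->
  (forall v : pt -> pt, smooth_on space v ->
     is_infinitesimal_symmetry (heat q r) v -> fixes_north_pole v ->
     exists (B : 'M[R]_n) (c k : R), B^T = - B /\
       forall p, space p -> v p = point (xc p *m B) (c + k * T (tc p))
                                        (k * S (tc p) * uc p)) ->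
  symmetry_groups_generated_by q r (G |` rigid_motions).
Proof.
move=> opg gen dT dS rS bal nec.
apply: (symmetry_groups_of_normal_form (NF := normal_form T S (@trivial_family R n))).
- by move=> F [->|/rigid_motions_groups //]; split=> //; eexists; exact: gen.
- move=> v sv sym fx; have [B [c [k [HB E]]]] := nec v sv sym fx.
  by exists B, c, k, (fun=> 0); split=> // p sp; rewrite E // addr0.
- move=> v; apply: symmetry_of_normal_form dT dS rS bal _ => h.
  exact: trivial_family_equation.
- move=> v; apply: generated_normal_form => [|F||h]; last exact: generated_trivial.
  + by right; left.
  + by right; right.
  + by apply: generated_generator gen; left.
- move=> v; apply: normal_form_generated; first exact: linear_trivial_family.
  move=> F w [->|]; last exact: normal_rigid_motion.
  exact: normal_special gen.
Qed.

(** The special group is the scaling of [u], with [T = 0] and [S = 1], and the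
    superposition terms are the solutions. *)
Lemma symmetry_groups_linear : r = 0 -> q = 1 -> (2 <= n)%N ->
  symmetry_groups_generated_by q r
    (u_scaling R n |` (superpositions R n `|` rigid_motions)).
Proof.
move=> r0 q1 hn.
have dc (c t : R) : is_derive t (1 : R) (fun=> c) 0 := is_derive_const c t (1 : R).
have gen_s : is_generator (u_scaling R n) (fun p => point 0 0 (1 * uc p)).
  by move=> p sp; rewrite mul1r; exact: generator_scaling.
have [sol0 _] := @linear_family_solutions R n.
apply: (symmetry_groups_of_normal_form
  (NF := normal_form (fun=> 0) (fun=> 1) (@linear_solution R n))).
- move=> G [->|[[b [sb _] ->]|/rigid_motions_groups //]].
    by split; [exact: one_param_scaling|eexists; exact: generator_scaling].
  by split; [exact: one_param_superposition|eexists; exact: generator_superposition].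
- move=> v sv sym fx.
  have [B [c [k [h [HB Hh E]]]]] := normal_form_linear hn sv sym fx r0 q1.
  by exists B, c, k, h; split=> // p sp; rewrite E // mulr0 addr0 mulr1.
- move=> v; apply: (symmetry_of_normal_form (T' := fun=> 0) (S' := fun=> 0) (dc 0) (dc 1)).
  + by move=> t; rewrite r0 mul0r.
  + by move=> t u u0; rewrite q1 subrr !mul0r mulr0 addr0.
  + move=> h /linear_solutionP[sh Eh].
    split; [exact: smooth_fst|by move=> z; rewrite r0 mul0r|].
    move=> p sp; rewrite Eh // r0 q1 subrr !powRr0.
    by move: (laplacian _ _) => x; ring.
- move=> v; apply: generated_normal_form => [|G||].
  + by right; right; left.
  + by right; right; right.
  + by apply: generated_generator gen_s; left.
  + move=> h Hh; apply: (generated_generator (G := superposition h)).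
      by right; left; exists h.
    exact: generator_superposition.
- move=> v; apply: normal_form_generated; first exact: linear_family_solutions.
  move=> G w [->|[[b Hb ->]|GL]] gw; last exact: normal_rigid_motion GL gw.
  + exact: (normal_special (T := fun=> 0) (S := fun=> 1)) sol0 gen_s gw.
  + exists 0, 0, 0, b; split=> //; first by rewrite trmx0 oppr0.
    move=> p sp; rewrite (generator_unique gw (generator_superposition b) sp).
    by rewrite mulmx0 !mul0r add0r add0r.
Qed.

End SymmetryGroups.

Unset Implicit Arguments.

Theorem theorem1p2 (R : realType) (n : nat) (q r : R)
    (hn : (2 <= n)%N) (hq : q != 0) (hr : r != -1) :
  [/\ (q != r + 1 -> q != 1 -> r + 1 != 1 ->
        symmetry_groups_generated_by q r
          (time_translation R n |` rotations R n)),
      (q = r + 1 -> r + 1 != 1 ->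
        symmetry_groups_generated_by q r
          (exp_time n r |` (time_translation R n |` rotations R n))),
      (q = 1 -> r + 1 != 1 ->
        symmetry_groups_generated_by q r
          (dilation n r |` (time_translation R n |` rotations R n))),
      (r + 1 = 1 -> q != 1 ->
        symmetry_groups_generated_by q r
          (time_translation R n |` rotations R n))
    & (q = 1 -> r + 1 = 1 ->
        symmetry_groups_generated_by q r
          (u_scaling R n |` (superpositions R n `|`
             (time_translation R n |` rotations R n))))].
Proof.
have r_neq0 : r + 1 != 1 -> r != 0 by apply: contraNneq => ->; rewrite add0r.
have r_eq0 : r + 1 = 1 -> r = 0 by move=> ?; lra.
split=> [q1 q2 r1|q1 r1|q1 r1|r1 q1|q1 r1].
- apply: symmetry_groups_rigid => v sv sym fx.
  exact: (normal_form_generic hn sv sym fx q1 q2 r1).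
- have r0 := r_neq0 r1; pose T t := expR (r * t).
  have dT t : is_derive t (1 : R) T (r * T t) by exact: is_derive_expR_linear.
  apply: (symmetry_groups_special (T := T) (S := T) (T' := fun t => r * T t)
    (S' := fun t => r * T t) (one_param_exp_time r0) (generator_exp_time r0)) => //.
    by move=> t u u0; rewrite q1 (powR_pred (r + 1) u0) addrK; ring.
  by move=> v sv sym fx; exact: (normal_form_exp hn sv sym fx q1 r1).
- have r0 := r_neq0 r1.
  apply: (symmetry_groups_special (T := id) (S := fun=> r^-1) (T' := fun=> 1) (S' := fun=> 0)
    (one_param_dilation r) (generator_dilation r) (fun t => is_derive_id t (1 : R))
    (fun t => is_derive_const r^-1 t (1 : R))).
  + by move=> t; rewrite divff.
  + by move=> t u u0; rewrite q1 subrr !mul0r mulr0 addr0.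
  + by move=> v sv sym fx; exact: (normal_form_dilation hn sv sym fx q1 r1).
- apply: symmetry_groups_rigid => v sv sym fx.
  exact: (normal_form_static hn sv sym fx (r_eq0 r1) hq q1).
- exact: symmetry_groups_linear (r_eq0 r1) q1 hn.
Qed.
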